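(* Let $r$ be a nonnegative integer. Then $$\log\mathcal{F}_{r,1}=\frac12\log\mathcal{A}_r-\log\mathcal{A}_{r+1}+\sum_{j=0}^r\binom rj(-1)^{r-j}\frac{B_{r-j}}{j+1}\left(\widehat{B}_{j+2,1}-\log\mathcal{A}_{j+1}\right).$$ In the case $r=0$: $$\log\mathcal{F}_{0,1}=\frac1{12}+\frac12\log\mathcal{A}_0-2\log\mathcal{A}_1.$$ In the case $r>0$: $$\log\mathcal{F}_{r,1}=\alpha_{r,0}+\sum_{j=1}^{r+1}\alpha_{r,j}\log\mathcal{A}_j,$$ where $$\alpha_{r,0}=\begin{cases}\dfrac{B_{r+1}}{2r(r+1)}, & r \text{ odd},\\[2ex] \displaystyle\sum_{i=0}^r\binom ri\frac{B_{r-i}\,B_{i+2}}{(i+1)^2(i+2)}, & r\text{ even},\end{cases}$$ and, for $1\le j\le r+1$, $$\alpha_{r,j}=\begin{cases}-\delta_{r+1,j}-\dbinom{r+1}{j}\dfrac{B_{r+1-j}}{r+1}, & r\not\equiv j\pmod 2,\\[2ex] 0, & r\equiv j\pmod2,\end{cases}$$ with $\delta_{i,j}$ Kronecker's delta.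
   Context: $B_m$ are the Bernoulli numbers, $z/(e^z-1)=\sum_{m\ge0}B_mz^m/m!$ (so $B_1=-\frac12$); $\zeta$ is the Riemann zeta function; $H_0=0$, $H_n=\sum_{\nu=1}^n\frac1\nu$; $f\sim g$ means $f/g\to1$. $\widehat{B}_{m,k}=\dfrac{B_m}{m(m-1)k^{m-1}}$ for $m\ge2$. For $r\ge0$, $S_r(n)=\sum_{\nu=1}^n\nu^r=\sum_{j=0}^r\binom rj(-1)^{r-j}B_{r-j}\frac{n^{j+1}}{j+1}$. The generalized Glaisher--Kinkelin constants $\mathcal{A}_r$ are defined by $\log\mathcal{A}_r=-\zeta(-r)H_r-\zeta'(-r)$, and $Q_r$ by $$\log Q_r(n)=(S_r(n)-\zeta(-r))\log n+\sum_{j=0}^r\binom rj(-1)^{r-j}B_{r-j}\frac{n^{j+1}}{j+1}\,(H_r-H_{j+1}).$$ $\mathcal{F}_{r,1}>0$ is the (unique) real constant for which, as $n\to\infty$, $$\prod_{\nu=1}^n\nu!^{\,\nu^r}\;\sim\;\mathcal{F}_{r,1}\,\mathcal{A}_r^{\frac12}\,\mathcal{A}_{r+1}\,P_{r,1}(n)\,Q_r(n)^{\frac12}\,Q_{r+1}(n),$$ where $$\log P_{r,1}(n)=\frac12S_r(n)\log(2\pi)-S_{r+1}(n)+\widehat{B}_{r+2,1}\log n+\sum_{j=1}^{\lfloor\frac{r+1}2\rfloor}\widehat{B}_{2j,1}\,S_{r+1-2j}(n).$$ *)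

(* Defs.v *)
(* The real and complex numbers are those of Stdlib and Coquelicot; after these
   imports [C] is the type of complex numbers, so the binomial coefficient is
   written [Binomial.C]. *)
From Stdlib Require Import Reals Arith List.
From Coquelicot Require Import Coquelicot.
Open Scope R_scope.

(* On its disc of convergence the series determines all the coefficients, so
   this predicate determines [B]. *)
Definition is_bernoulli (B : nat -> R) : Prop :=
  exists rho : R, 0 < rho /\
    forall z : R, 0 < Rabs z < rho ->
      is_pseries (fun m => B m / INR (fact m)) z (z / (exp z - 1)).

Definition Cexp (z : C) : C :=
  (exp (Re z) * cos (Im z), exp (Re z) * sin (Im z)).

Definition analytic_at (f : C -> C) (z0 : C) : Prop :=
  exists (a : nat -> C) (rho : R), 0 < rho /\
    forall z : C, Cmod (z - z0) < rho ->
      @is_pseries C_AbsRing C_NormedModule a (z - z0)%C (f z).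

(* The Dirichlet series on the half-plane [Re s > 1], continued analytically to
   the (connected) punctured plane; this determines [zeta s] for all [s <> 1].
   The series starts at index 0, whence [INR (S n)]. *)
Definition is_riemann_zeta (zeta : C -> C) : Prop :=
  (forall s : C, 1 < Re s ->
     @is_series C_AbsRing C_NormedModule
       (fun n => Cexp (- s * RtoC (ln (INR (S n))))%C) (zeta s)) /\
  (forall s : C, s <> RtoC 1 -> analytic_at zeta s).

Definition H (n : nat) : R := sum_n_m (fun nu => / INR nu) 1 n.

Definition Bhat (B : nat -> R) (m k : nat) : R :=
  B m / (INR m * (INR m - 1) * INR k ^ (m - 1)).

Definition S_pow (r n : nat) : R := sum_n_m (fun nu => INR nu ^ r) 1 n.

(* [zeta] is real on the real axis away from 1, so [zeta (-r)] and
   [zeta' (-r)] are real and [Re] only changes the type. *)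
Definition zeta_neg (zeta : C -> C) (r : nat) : R := Re (zeta (RtoC (- INR r))).

Definition dzeta_neg (zeta : C -> C) (r : nat) : R :=
  Re (C_derive zeta (RtoC (- INR r))).

Definition logA (zeta : C -> C) (r : nat) : R :=
  - zeta_neg zeta r * H r - dzeta_neg zeta r.

Definition A (zeta : C -> C) (r : nat) : R := exp (logA zeta r).

Definition logQ (B : nat -> R) (zeta : C -> C) (r n : nat) : R :=
  (S_pow r n - zeta_neg zeta r) * ln (INR n) +
  sum_n_m (fun j => Binomial.C r j * (-1) ^ (r - j) * B (r - j)%nat *
                    (INR n ^ (j + 1) / INR (j + 1)) * (H r - H (j + 1))) 0 r.

Definition Q (B : nat -> R) (zeta : C -> C) (r n : nat) : R :=
  exp (logQ B zeta r n).

Definition logP1 (B : nat -> R) (r n : nat) : R :=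
  1 / 2 * S_pow r n * ln (2 * PI) - S_pow (r + 1) n
  + Bhat B (r + 2) 1 * ln (INR n)
  + sum_n_m (fun j => Bhat B (2 * j) 1 * S_pow (r + 1 - 2 * j) n)
      1 ((r + 1) / 2)%nat.

Definition P1 (B : nat -> R) (r n : nat) : R := exp (logP1 B r n).

Definition fact_prod (r n : nat) : R :=
  fold_right Rmult 1 (map (fun nu => INR (fact nu) ^ (nu ^ r)) (seq 1 n)).

Definition asymp_equiv (f g : nat -> R) : Prop :=
  is_lim_seq (fun n => f n / g n) 1.

Definition is_F1 (B : nat -> R) (zeta : C -> C) (r : nat) (F : R) : Prop :=
  0 < F /\
  asymp_equiv (fact_prod r)
    (fun n => F * sqrt (A zeta r) * A zeta (r + 1) *
              P1 B r n * sqrt (Q B zeta r n) * Q B zeta (r + 1) n).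

Definition alpha0 (B : nat -> R) (r : nat) : R :=
  if Nat.odd r then B (r + 1)%nat / (2 * INR r * INR (r + 1))
  else sum_n_m (fun i => Binomial.C r i *
                  (B (r - i)%nat * B (i + 2)%nat /
                   (INR (i + 1) ^ 2 * INR (i + 2)))) 0 r.

Definition kronecker (i j : nat) : R := if Nat.eqb i j then 1 else 0.

(* Only used for [1 <= j <= r + 1]. *)
Definition alpha (B : nat -> R) (r j : nat) : R :=
  if Nat.eqb (r mod 2) (j mod 2) then 0
  else - kronecker (r + 1) j
       - Binomial.C (r + 1) j * (B (r + 1 - j)%nat / INR (r + 1)).

(* Main.v *)
Require Import Defs.
From Stdlib Require Import Reals Arith List Lra Lia FunctionalExtensionality Classical.
From Coquelicot Require Import Coquelicot.
Open Scope R_scope.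
Set Bullet Behavior "Strict Subproofs".

(** Let [L_k(n)] be the sum of [nu^k log nu] over [1 <= nu <= n]. Exchanging the
    order of summation in [sum_nu nu^r log nu!] and expanding [S_r] by Faulhaber's
    formula, [S_r(n) = sum_j s_j n^(j+1)], gives
      [log prod_nu nu!^(nu^r) = S_r(n) L_0(n) + L_r(n) - sum_j s_j L_(j+1)(n)]
    ([ln_fact_prod]). Up to [o(1)], each summand is a combination of the monomials
    [n^k] and [n^k log n], and such an expansion can only converge to its constant
    term ([asy_limit]). As the defining relation of [F] says that
    [log prod - log P - (log Q_r)/2 - log Q_(r+1)] converges, only constant terms have
    to be collected: those of [log P], [log Q_r] and [log Q_(r+1)] are zero, that of
    [L_k] is [log A_k] ([asy_sum_pow_ln]), and [n^(j+1) L_0(n)] contributes [Bhat_(j+2)],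
    the coefficient of [n^(-j-1)] in Stirling's series ([asy_pow_stirling]). This is
    the first formula ([ln_F1]); the other two follow from it because the odd
    Bernoulli numbers other than [B_1] vanish.

    The analytic core is the link between [L_k] and [zeta'(-k)]. The function [zeta]
    is given only by its Dirichlet series on [Re s > 1] and by the existence of local
    power series away from [1]. Put [x = -s] and
      [g_N(x) = (x+1) sum_(n <= N) n^x
                - sum_(i <= M) binom(x+1,i) (-1)^i B_i N^(x+1-i)].
    For [Re x < -1] this tends to [(x+1) zeta(-x)] ([em_fun_dirichlet]). The increments
    [g_(N+1) - g_N] are combinations of remainders of binomial expansions of
    [(X-1)^(x+1-i)], [X = N+1], because the recursion of the Bernoulli numbers cancels
    all the terms that are kept ([em_coef_step]); so the Taylor coefficients of [g_N] at
    any centre converge, as fast as any given power of [1/N] when [M] is large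
    ([em_coef_limit]). Therefore the limit of [g_N] is a power series around every
    centre, and the identity theorem, applied along the segment from [-2+i] to [r],
    which misses the pole [x = -1], shows that the coefficients of [(x+1) zeta(-x)] at
    [r] are the limits of those of [g_N] ([em_coef_clim]). Degree [0] yields [zeta(-r)],
    degree [1] yields [zeta'(-r)], and the rate of convergence yields Stirling's series.

    All estimates are made on Taylor coefficients rather than on functions: a bound
    [|a_k| <= K rho^(-k)] survives multiplication by linear polynomials and passes
    through the mean value theorem, which makes Cauchy's integral formula
    unnecessary. *)

(** Equations obtained from generic algebraic lemmas are stated over structures whose
    carrier is only convertible to [R]; [ring] has to be shown [R] itself. *)
Ltac real_ring := match goal with |- ?a = ?b => change (@eq R a b) end; ring.

(** * Finite sums *)

(** Half-open sums: with the empty sum available at [n = 0], inductions need no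
    side condition on the bounds. *)
Fixpoint csum (f : nat -> C) (n : nat) : C :=
  match n with O => RtoC 0 | S m => (csum f m + f m)%C end.

Fixpoint rsum (f : nat -> R) (n : nat) : R :=
  match n with O => 0 | S m => rsum f m + f m end.

Lemma csum_ext (f g : nat -> C) (n : nat) :
  (forall i, (i < n)%nat -> f i = g i) -> csum f n = csum g n.
Proof.
  induction n as [|n IH]; intros Hfg; simpl; auto.
  rewrite IH by (intros; apply Hfg; lia). now rewrite Hfg by lia.
Qed.

Lemma csum_plus (f g : nat -> C) (n : nat) :
  csum (fun i => f i + g i)%C n = (csum f n + csum g n)%C.
Proof. induction n as [|n IH]; simpl; [ring|]. rewrite IH; ring. Qed.

Lemma csum_scal (a : C) (f : nat -> C) (n : nat) :
  csum (fun i => a * f i)%C n = (a * csum f n)%C.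
Proof. induction n as [|n IH]; simpl; [ring|]. rewrite IH; ring. Qed.

Lemma csum_RtoC (f : nat -> R) (n : nat) :
  csum (fun i => RtoC (f i)) n = RtoC (rsum f n).
Proof. induction n as [|n IH]; simpl; [auto|]. now rewrite IH, RtoC_plus. Qed.

Lemma csum_0 (f : nat -> C) (n : nat) :
  (forall i, (i < n)%nat -> f i = RtoC 0) -> csum f n = RtoC 0.
Proof.
  induction n as [|n IH]; intros Hf; simpl; auto.
  rewrite IH, Hf; try lia; [ring|]. intros; apply Hf; lia.
Qed.

Lemma rsum_ext (f g : nat -> R) (n : nat) :
  (forall i, (i < n)%nat -> f i = g i) -> rsum f n = rsum g n.
Proof.
  induction n as [|n IH]; intros Hfg; simpl; auto.
  rewrite IH by (intros; apply Hfg; lia). now rewrite Hfg by lia.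
Qed.

Lemma rsum_plus (f g : nat -> R) (n : nat) :
  rsum (fun i => f i + g i) n = rsum f n + rsum g n.
Proof. induction n as [|n IH]; simpl; [ring|]. rewrite IH; ring. Qed.

Lemma rsum_scal (a : R) (f : nat -> R) (n : nat) :
  rsum (fun i => a * f i) n = a * rsum f n.
Proof. induction n as [|n IH]; simpl; [ring|]. rewrite IH; ring. Qed.

Lemma rsum_0 (f : nat -> R) (n : nat) :
  (forall i, (i < n)%nat -> f i = 0) -> rsum f n = 0.
Proof.
  induction n as [|n IH]; intros Hf; simpl; auto.
  rewrite IH, Hf; try lia; [ring|]. intros; apply Hf; lia.
Qed.

Lemma rsum_first (f : nat -> R) (n : nat) :
  rsum f (S n) = f 0%nat + rsum (fun i => f (S i)) n.
Proof. induction n as [|n IH]; simpl in *; [ring|]. rewrite IH; ring. Qed.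

Lemma rsum_sum_n_m_0 (f : nat -> R) (n : nat) :
  sum_n_m f 0 n = rsum f (S n).
Proof.
  induction n as [|n IH].
  - rewrite sum_n_n. simpl. ring.
  - rewrite sum_n_Sm by lia. rewrite IH. reflexivity.
Qed.

Lemma rsum_sum_n_m_1 (f : nat -> R) (n : nat) :
  sum_n_m f 1 n = rsum (fun i => f (S i)) n.
Proof.
  induction n as [|n IH].
  - rewrite sum_n_m_zero by lia. reflexivity.
  - rewrite sum_n_Sm by lia. rewrite IH. reflexivity.
Qed.

Lemma rsum_split (f : nat -> R) (n m : nat) :
  rsum f (n + m) = rsum f n + rsum (fun j => f (n + j)%nat) m.
Proof.
  induction m as [|m IH].
  - rewrite Nat.add_0_r. simpl. ring.
  - rewrite Nat.add_succ_r. simpl. rewrite IH. ring.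
Qed.

Lemma rsum_rev (f : nat -> R) (n : nat) :
  rsum f (S n) = rsum (fun i => f (n - i)%nat) (S n).
Proof.
  induction n as [|n IH]; [reflexivity|].
  rewrite (rsum_first (fun i => f (S n - i)%nat)). rewrite Nat.sub_0_r.
  change (rsum f (S (S n))) with (rsum f (S n) + f (S n)). rewrite IH.
  rewrite (rsum_ext (fun i => f (n - i)%nat) (fun i => f (S n - S i)%nat)) by (intros; f_equal; lia).
  ring.
Qed.

Lemma rsum_delta (f : nat -> R) (m n : nat) :
  (m < n)%nat -> rsum (fun i => if Nat.eqb i m then f i else 0) n = f m.
Proof.
  induction n as [|n IH]; [lia|]. intros Hm. simpl.
  destruct (Nat.eqb_spec n m) as [->|Hn].
  - rewrite rsum_0; [ring|]. intros i Hi. destruct (Nat.eqb_spec i m); [lia|reflexivity].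
  - rewrite IH by lia. ring.
Qed.

(** Summation over the diagonals [q = i + m]. *)
Lemma csum_triangle (g : nat -> nat -> C) (n : nat) :
  csum (fun i => csum (fun m => g i (i + m)%nat) (n - i)) n =
  csum (fun q => csum (fun i => g i q) (S q)) n.
Proof.
  induction n as [|n IH]; [reflexivity|].
  transitivity (csum (fun i => csum (fun m => g i (i + m)%nat) (n - i) + g i n)%C (S n)).
  - apply csum_ext; intros i Hi.
    replace (S n - i)%nat with (S (n - i)) by lia. simpl.
    now replace (i + (n - i))%nat with n by lia.
  - rewrite csum_plus. simpl. rewrite IH, Nat.sub_diag. simpl. ring.
Qed.

Lemma rsum_triangle (g : nat -> nat -> R) (n : nat) :
  rsum (fun i => rsum (fun m => g i (i + m)%nat) (n - i)) n =
  rsum (fun q => rsum (fun i => g i q) (S q)) n.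
Proof.
  apply RtoC_inj. rewrite <- !csum_RtoC.
  rewrite (csum_ext _ (fun i => csum (fun m => RtoC (g i (i + m)%nat)) (n - i)))
    by (intros; now rewrite csum_RtoC).
  rewrite (csum_triangle (fun i q => RtoC (g i q))).
  apply csum_ext. intros q _. apply csum_RtoC.
Qed.

(** * Operators on coefficient sequences *)

(** Multiplication by the linear polynomial [c + u] of a power series in [u]
    given by its coefficients. *)
Definition mul_lin (c : C) (a : nat -> C) : nat -> C :=
  fun k => (c * a k + match k with O => RtoC 0 | S j => a j end)%C.

(** Multiplication by the generalized binomial coefficient of [c + u] over [m]. *)
Fixpoint mul_binom (c : C) (m : nat) (a : nat -> C) : nat -> C :=
  match m with
  | O => a
  | S j => fun k => (RtoC (/ INR (S j)) * mul_lin (c - INR j) (mul_binom c j a) k)%C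
  end.

Lemma mul_lin_comm (c d : C) (a : nat -> C) : mul_lin c (mul_lin d a) = mul_lin d (mul_lin c a).
Proof.
  apply functional_extensionality; intros [|[|k]]; unfold mul_lin; ring.
Qed.

Lemma mul_lin_scal (c s : C) (a : nat -> C) :
  mul_lin c (fun k => s * a k)%C = (fun k => s * mul_lin c a k)%C.
Proof. apply functional_extensionality; intros [|k]; unfold mul_lin; ring. Qed.

Lemma mul_lin_minus (c : C) (a b : nat -> C) :
  mul_lin c (fun k => a k - b k)%C = (fun k => mul_lin c a k - mul_lin c b k)%C.
Proof. apply functional_extensionality; intros [|k]; unfold mul_lin; ring. Qed.

Lemma mul_lin_csum (c : C) (f : nat -> nat -> C) (n : nat) :
  mul_lin c (fun k => csum (fun i => f i k) n) = (fun k => csum (fun i => mul_lin c (f i) k) n).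
Proof.
  apply functional_extensionality; intros k; induction n as [|n IH]; simpl.
  - destruct k; unfold mul_lin; ring.
  - rewrite <- IH. destruct k; unfold mul_lin; ring.
Qed.

Lemma mul_binom_scal (c s : C) (m : nat) (a : nat -> C) :
  mul_binom c m (fun k => s * a k)%C = (fun k => s * mul_binom c m a k)%C.
Proof.
  induction m as [|m IH]; [reflexivity|]. simpl. rewrite IH, mul_lin_scal.
  apply functional_extensionality; intros k; ring.
Qed.

Lemma mul_binom_minus (c : C) (m : nat) (a b : nat -> C) :
  mul_binom c m (fun k => a k - b k)%C = (fun k => mul_binom c m a k - mul_binom c m b k)%C.
Proof.
  induction m as [|m IH]; [reflexivity|]. simpl. rewrite IH, mul_lin_minus.
  apply functional_extensionality; intros k; ring.
Qed.

Lemma mul_binom_csum (c : C) (m : nat) (f : nat -> nat -> C) (n : nat) :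
  mul_binom c m (fun k => csum (fun i => f i k) n) = (fun k => csum (fun i => mul_binom c m (f i) k) n).
Proof.
  induction m as [|m IH]; [reflexivity|]. simpl. rewrite IH, mul_lin_csum.
  apply functional_extensionality; intros k; now rewrite <- csum_scal.
Qed.

Lemma mul_lin_binom_comm (c d : C) (m : nat) (a : nat -> C) :
  mul_lin d (mul_binom c m a) = mul_binom c m (mul_lin d a).
Proof.
  induction m as [|m IH]; [reflexivity|]. simpl.
  now rewrite mul_lin_scal, mul_lin_comm, IH.
Qed.

Lemma mul_binom_comm (c d : C) (m n : nat) (a : nat -> C) :
  mul_binom c m (mul_binom d n a) = mul_binom d n (mul_binom c m a).
Proof.
  induction m as [|m IH]; [reflexivity|]. simpl.
  now rewrite IH, mul_lin_binom_comm, <- mul_binom_scal.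
Qed.

Lemma RtoC_INR_neq (n : nat) : RtoC (INR (S n)) <> RtoC 0.
Proof. intros E. injection E. apply (not_0_INR (S n)). lia. Qed.

(** Absorption identity: [m binom(x,m) = x binom(x-1,m-1)]. *)
Lemma mul_binom_absorb (c : C) (m : nat) (a : nat -> C) :
  (fun k => RtoC (INR (S m)) * mul_binom c (S m) a k)%C = mul_lin c (mul_binom (c - RtoC 1)%C m a).
Proof.
  induction m as [|m IH].
  - apply functional_extensionality; intros k; simpl.
    replace (c - 0)%C with c by ring. rewrite Rinv_1. ring.
  - transitivity (mul_lin (c - INR (S m))%C (mul_binom c (S m) a)).
    + apply functional_extensionality; intros k.
      change (mul_binom c (S (S m)) a k) with
        (RtoC (/ INR (S (S m))) * mul_lin (c - INR (S m)) (mul_binom c (S m) a) k)%C.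
      rewrite RtoC_inv by (apply not_0_INR; lia). field; apply RtoC_INR_neq.
    + assert (E : mul_binom c (S m) a =
                (fun k => / RtoC (INR (S m)) * mul_lin c (mul_binom (c - RtoC 1) m a) k)%C).
      { rewrite <- IH. apply functional_extensionality; intros k.
        field; apply RtoC_INR_neq. }
      rewrite E, mul_lin_scal, mul_lin_comm, <- mul_lin_scal. f_equal.
      apply functional_extensionality; intros k.
      change (mul_binom (c - 1) (S m) a k) with
        (RtoC (/ INR (S m)) * mul_lin (c - 1 - INR m) (mul_binom (c - 1) m a) k)%C.
      rewrite RtoC_inv by (apply not_0_INR; lia). f_equal. f_equal.
      rewrite S_INR, RtoC_plus. ring.
Qed.

Lemma binomial_step (i m : nat) :
  Binomial.C (i + S m) i * INR (S m) = Binomial.C (i + m) i * INR (i + S m).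
Proof.
  unfold Binomial.C.
  replace (i + S m - i)%nat with (S m) by lia.
  replace (i + m - i)%nat with m by lia.
  replace (i + S m)%nat with (S (i + m)) by lia.
  rewrite !fact_simpl, !mult_INR. field.
  repeat split; try apply INR_fact_neq_0. apply (not_0_INR (S m)); lia.
Qed.

(** [binom(x,i) binom(x-i,m) = binom(i+m,i) binom(x,i+m)]. *)
Lemma mul_binom_trinomial (c : C) (i m : nat) (a : nat -> C) (k : nat) :
  mul_binom (c - INR i) m (mul_binom c i a) k = (RtoC (Binomial.C (i + m) i) * mul_binom c (i + m) a k)%C.
Proof.
  revert k; induction m as [|m IH]; intros k.
  - rewrite Nat.add_0_r, C_n_n. simpl. ring.
  - apply functional_extensionality in IH.
    change (mul_binom (c - INR i) (S m) (mul_binom c i a) k) with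
      (RtoC (/ INR (S m)) * mul_lin (c - INR i - INR m) (mul_binom (c - INR i) m (mul_binom c i a)) k)%C.
    rewrite IH, mul_lin_scal.
    replace (mul_binom c (i + S m) a k) with
      (RtoC (/ INR (i + S m)) * mul_lin (c - INR (i + m)) (mul_binom c (i + m) a) k)%C
      by (replace (i + S m)%nat with (S (i + m)) by lia; reflexivity).
    replace (c - INR i - INR m)%C with (c - INR (i + m))%C
      by (rewrite plus_INR, RtoC_plus; ring).
    rewrite !Cmult_assoc, <- !RtoC_mult. f_equal. f_equal.
    assert (E := binomial_step i m).
    assert (INR (S m) <> 0) by (apply not_0_INR; lia).
    assert (INR (i + S m) <> 0) by (apply not_0_INR; lia).
    apply Rmult_eq_reg_r with (INR (S m) * INR (i + S m)); [|now apply Rmult_integral_contrapositive_currified].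
    transitivity (Binomial.C (i + m) i * INR (i + S m)); [field; auto|].
    rewrite <- E. field; auto.
Qed.

(** * Geometric bounds on coefficients *)

(** A Cauchy estimate for the disc of radius [rho], used as a definition. *)
Definition coef_bound (K rho : R) (a : nat -> C) : Prop :=
  forall k, Cmod (a k) * rho ^ k <= K.

Lemma coef_bound_mul_lin (K rho : R) (c : C) (a : nat -> C) :
  0 < rho -> coef_bound K rho a -> coef_bound ((Cmod c + rho) * K) rho (mul_lin c a).
Proof.
  intros Hr Ha k. unfold mul_lin.
  apply Rle_trans with ((Cmod c * Cmod (a k) +
     Cmod (match k with O => RtoC 0 | S j => a j end)) * rho ^ k).
  - apply Rmult_le_compat_r; [apply pow_le; lra|].
    rewrite <- Cmod_mult. apply Cmod_triangle.
  - assert (Hk := Ha k). assert (Hc := Cmod_ge_0 c).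
    assert (E : Cmod (match k with O => RtoC 0 | S j => a j end) * rho ^ k <= rho * K).
    { destruct k as [|j].
      - rewrite Cmod_0. pose proof (Ha 0%nat) as H0. simpl in *.
        assert (0 <= K) by (pose proof (Cmod_ge_0 (a 0%nat)); lra). nra.
      - pose proof (Ha j). simpl. nra. }
    nra.
Qed.

Lemma coef_bound_scal (K rho : R) (s : C) (a : nat -> C) :
  coef_bound K rho a -> coef_bound (Cmod s * K) rho (fun k => s * a k)%C.
Proof.
  intros Ha k. rewrite Cmod_mult, Rmult_assoc.
  apply Rmult_le_compat_l; [apply Cmod_ge_0|apply Ha].
Qed.

(** The constant depends neither on the sequence nor on its bound, so it is uniform
    in the parameters [X] and [y] of the remainders below. *)
Lemma coef_bound_mul_binom (rho : R) (c : C) (m : nat) :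
  0 < rho ->
  exists D, 0 <= D /\ forall K a, 0 <= K -> coef_bound K rho a -> coef_bound (D * K) rho (mul_binom c m a).
Proof.
  intros Hr. induction m as [|m [D [HD IH]]].
  - exists 1; split; [lra|]. intros K a _ Ha. now rewrite Rmult_1_l.
  - exists (Cmod (RtoC (/ INR (S m))) * ((Cmod (c - INR m) + rho) * D)); split.
    + pose proof (Cmod_ge_0 (c - INR m)). pose proof (Cmod_ge_0 (RtoC (/ INR (S m)))).
      apply Rmult_le_pos; [lra|]. apply Rmult_le_pos; lra.
    + intros K a HK Ha. rewrite Rmult_assoc, (Rmult_assoc _ D).
      apply (coef_bound_scal _ _ (RtoC (/ INR (S m))) (mul_lin (c - INR m) (mul_binom c m a))).
      apply coef_bound_mul_lin; auto.
Qed.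

(** * Complex-valued functions of a real variable *)

Definition cderiv (f : R -> C) (x : R) (l : C) : Prop :=
  is_derive (fun t => Re (f t)) x (Re l) /\ is_derive (fun t => Im (f t)) x (Im l).

Lemma C_eq (z z' : C) : Re z = Re z' -> Im z = Im z' -> z = z'.
Proof. destruct z, z'; simpl; intros; subst; auto. Qed.

Lemma cderiv_ext (f g : R -> C) (x : R) (l : C) :
  (forall t, f t = g t) -> cderiv f x l -> cderiv g x l.
Proof.
  intros E [H1 H2]; split; (eapply is_derive_ext; [|eassumption]); intros t; simpl; now rewrite E.
Qed.

Lemma cderiv_val (f : R -> C) (x : R) (l l' : C) : l = l' -> cderiv f x l -> cderiv f x l'.
Proof. now intros ->. Qed.

Lemma is_derive_val (f : R -> R) (x l l' : R) :
  l = l' -> is_derive f x l -> is_derive f x l'.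
Proof. now intros ->. Qed.

Lemma is_derive_plus_R (f g : R -> R) (x l l' : R) :
  is_derive f x l -> is_derive g x l' -> is_derive (fun t => f t + g t) x (l + l').
Proof. intros. now apply (is_derive_plus f g x l l'). Qed.

Lemma is_derive_minus_R (f g : R -> R) (x l l' : R) :
  is_derive f x l -> is_derive g x l' -> is_derive (fun t => f t - g t) x (l - l').
Proof. intros. now apply (is_derive_minus f g x l l'). Qed.

Lemma cderiv_const (c : C) (x : R) : cderiv (fun _ => c) x (RtoC 0).
Proof. split; simpl; apply @is_derive_const. Qed.

Lemma cderiv_plus (f g : R -> C) (x : R) (l l' : C) :
  cderiv f x l -> cderiv g x l' -> cderiv (fun t => f t + g t)%C x (l + l')%C.
Proof. intros [H1 H2] [H3 H4]; split; simpl; now apply is_derive_plus_R. Qed.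

Lemma is_derive_mult_R (f g : R -> R) (x l l' : R) :
  is_derive f x l -> is_derive g x l' ->
  is_derive (fun t => f t * g t) x (l * g x + f x * l').
Proof. intros. apply (is_derive_mult f g x l l'); auto. intros; apply Rmult_comm. Qed.

Lemma cderiv_mult (f g : R -> C) (x : R) (l l' : C) :
  cderiv f x l -> cderiv g x l' ->
  cderiv (fun t => f t * g t)%C x (l * g x + f x * l')%C.
Proof.
  intros [H1 H2] [H3 H4]; split.
  - apply (is_derive_val (fun t => Re (f t) * Re (g t) - Im (f t) * Im (g t)) x
      ((Re l * Re (g x) + Re (f x) * Re l') - (Im l * Im (g x) + Im (f x) * Im l'))).
    { simpl. unfold Re, Im. ring. }
    apply is_derive_minus_R; now apply is_derive_mult_R.
  - apply (is_derive_val (fun t => Re (f t) * Im (g t) + Im (f t) * Re (g t)) x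
      ((Re l * Im (g x) + Re (f x) * Im l') + (Im l * Re (g x) + Im (f x) * Re l'))).
    { simpl. unfold Re, Im. ring. }
    apply is_derive_plus_R; now apply is_derive_mult_R.
Qed.

Lemma cderiv_scal (s : C) (f : R -> C) (x : R) (l : C) :
  cderiv f x l -> cderiv (fun t => s * f t)%C x (s * l)%C.
Proof.
  intros H1. apply cderiv_val with (RtoC 0 * f x + s * l)%C; [ring|].
  apply cderiv_mult; auto. apply cderiv_const.
Qed.

Lemma cderiv_minus (f g : R -> C) (x : R) (l l' : C) :
  cderiv f x l -> cderiv g x l' -> cderiv (fun t => f t - g t)%C x (l - l')%C.
Proof. intros [H1 H2] [H3 H4]; split; simpl; now apply is_derive_minus_R. Qed.

Lemma cderiv_csum (f : nat -> R -> C) (x : R) (l : nat -> C) (n : nat) :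
  (forall i, (i < n)%nat -> cderiv (f i) x (l i)) ->
  cderiv (fun t => csum (fun i => f i t) n) x (csum l n).
Proof.
  induction n as [|n IH]; intros Hf; simpl.
  - apply cderiv_const.
  - apply cderiv_plus; [apply IH; intros; apply Hf; lia|apply Hf; lia].
Qed.

Lemma cderiv_RtoC (f : R -> R) (x l : R) :
  is_derive f x l -> cderiv (fun t => RtoC (f t)) x (RtoC l).
Proof. intros Hf; split; simpl; [auto|apply @is_derive_const]. Qed.

(** The factor [2] comes from treating the two components separately. *)
Lemma cderiv_mvt (f g : R -> C) (K : R) :
  (forall x, 0 <= x <= 1 -> cderiv f x (g x)) -> f 0 = RtoC 0 ->
  (forall x, 0 <= x <= 1 -> Cmod (g x) <= K) ->
  forall y, 0 <= y <= 1 -> Cmod (f y) <= 2 * K.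
Proof.
  intros Hd H0 HK y Hy.
  assert (aux : forall h h' : R -> R, h 0 = 0 ->
            (forall x, 0 <= x <= 1 -> is_derive h x (h' x)) ->
            (forall x, 0 <= x <= 1 -> Rabs (h' x) <= K) -> Rabs (h y) <= K).
  { intros h h' h0 Hh Hb.
    destruct (MVT_gen h 0 y h') as [c [Hc E]].
    - rewrite Rmin_left, Rmax_right by lra. intros; apply Hh; lra.
    - rewrite Rmin_left, Rmax_right by lra. intros x Hx.
      apply continuity_pt_filterlim, @ex_derive_continuous.
      exists (h' x); apply Hh; lra.
    - rewrite Rmin_left, Rmax_right in Hc by lra.
      rewrite h0, !Rminus_0_r in E. rewrite E, Rabs_mult, (Rabs_right y) by lra.
      specialize (Hb c ltac:(lra)). pose proof (Rabs_pos (h' c)). nra. }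
  assert (H1 : Rabs (Re (f y)) <= K).
  { apply (aux (fun t => Re (f t)) (fun t => Re (g t))).
    - now rewrite H0.
    - intros; now apply Hd.
    - intros x Hx. eapply Rle_trans; [apply re_le_Cmod|auto]. }
  assert (H2 : Rabs (Im (f y)) <= K).
  { apply (aux (fun t => Im (f t)) (fun t => Im (g t))).
    - now rewrite H0.
    - intros; now apply Hd.
    - intros x Hx. eapply Rle_trans; [|apply HK, Hx].
      eapply Rle_trans; [apply Rmax_r|apply Rmax_Cmod]. }
  replace (f y) with (RtoC (Re (f y)) + Ci * RtoC (Im (f y)))%C
    by (apply C_eq; simpl; ring).
  eapply Rle_trans; [apply Cmod_triangle|].
  rewrite Cmod_mult, Cmod_Ci, !Cmod_R. lra.
Qed.

(** * The complex exponential *)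

Lemma Cexp_plus (z z' : C) : Cexp (z + z') = (Cexp z * Cexp z')%C.
Proof.
  unfold Cexp. apply C_eq; simpl; unfold Re, Im; rewrite exp_plus, ?cos_plus, ?sin_plus; ring.
Qed.

Lemma Cexp_RtoC (x : R) : Cexp (RtoC x) = RtoC (exp x).
Proof. unfold Cexp. apply C_eq; simpl; rewrite ?cos_0, ?sin_0; ring. Qed.

Lemma Cmod_Cexp (z : C) : Cmod (Cexp z) = exp (Re z).
Proof.
  unfold Cexp, Cmod; simpl fst; simpl snd.
  replace ((exp (Re z) * cos (Im z)) ^ 2 + (exp (Re z) * sin (Im z)) ^ 2)
    with (exp (Re z) ^ 2 * ((sin (Im z))² + (cos (Im z))²)) by (unfold Rsqr; ring).
  rewrite sin2_cos2, Rmult_1_r. apply sqrt_pow2. left; apply exp_pos.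
Qed.

(** Through [g = ln] this differentiates a power [X^c] with respect to its base. *)
Lemma cderiv_Cexp (c : C) (g : R -> R) (x l : R) :
  is_derive g x l ->
  cderiv (fun t => Cexp (c * RtoC (g t))) x (c * RtoC l * Cexp (c * RtoC (g x)))%C.
Proof.
  intros Hg.
  assert (Hre : is_derive (fun t => Re c * g t) x (Re c * l)) by now apply @is_derive_scal.
  assert (Him : is_derive (fun t => Im c * g t) x (Im c * l)) by now apply @is_derive_scal.
  assert (He : is_derive (fun t => exp (Re c * g t)) x (Re c * l * exp (Re c * g x))).
  { apply (is_derive_comp exp (fun t => Re c * g t)); [apply is_derive_Reals, derivable_pt_lim_exp|exact Hre]. }
  assert (Hcs : is_derive (fun t => cos (Im c * g t)) x (Im c * l * - sin (Im c * g x))).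
  { apply (is_derive_comp cos (fun t => Im c * g t)); [apply is_derive_Reals, derivable_pt_lim_cos|exact Him]. }
  assert (Hsn : is_derive (fun t => sin (Im c * g t)) x (Im c * l * cos (Im c * g x))).
  { apply (is_derive_comp sin (fun t => Im c * g t)); [apply is_derive_Reals, derivable_pt_lim_sin|exact Him]. }
  assert (E1 : forall t, Re c * g t = Re (c * RtoC (g t))) by (intros; simpl; unfold Re, Im; ring).
  assert (E2 : forall t, Im c * g t = Im (c * RtoC (g t))) by (intros; simpl; unfold Re, Im; ring).
  split.
  - apply is_derive_ext with (fun t => exp (Re c * g t) * cos (Im c * g t)).
    { intros t. unfold Cexp; simpl; unfold Re, Im. f_equal; f_equal; ring. }
    assert (D := is_derive_mult_R _ _ _ _ _ He Hcs). simpl in D.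
    unfold Cexp. rewrite <- E1, <- E2. cbv beta in D.
    match type of D with is_derive _ _ ?v =>
      match goal with |- is_derive _ _ ?w => replace w with v; [exact D|] end end.
    simpl; unfold Re, Im; ring.
  - apply is_derive_ext with (fun t => exp (Re c * g t) * sin (Im c * g t)).
    { intros t. unfold Cexp; simpl; unfold Re, Im. f_equal; f_equal; ring. }
    assert (D := is_derive_mult_R _ _ _ _ _ He Hsn). simpl in D.
    unfold Cexp. rewrite <- E1, <- E2. cbv beta in D.
    match type of D with is_derive _ _ ?v =>
      match goal with |- is_derive _ _ ?w => replace w with v; [exact D|] end end.
    simpl; unfold Re, Im; ring.
Qed.

(** * Taylor remainders of real powers with complex exponents *)

(** Coefficients in [u] of [X ^ (c + u)]. *)
Definition pow_coef (X : R) (c : C) : nat -> C :=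
  fun k => (Cexp (c * RtoC (ln X)) * RtoC (ln X ^ k / INR (fact k)))%C.

(** Coefficients in [u] of [(X - y) ^ (c + u)] minus the first [K] terms of its
    binomial expansion in powers of [y]. *)
Definition binom_rem (K : nat) (c : C) (X y : R) : nat -> C :=
  fun k => (pow_coef (X - y) c k -
            csum (fun m => RtoC ((- y) ^ m) * mul_binom c m (pow_coef X (c - INR m)%C) k) K)%C.

(** The derivative of [X^(c+u)] is [(c+u) X^(c+u-1)], read on coefficients of [u]. *)
Lemma cderiv_pow_coef (c : C) (X y : R) (k : nat) :
  y < X ->
  cderiv (fun t => pow_coef (X - t) c k) y (- mul_lin c (pow_coef (X - y) (c - RtoC 1)%C) k)%C.
Proof.
  intros Hy.
  assert (Hl : is_derive (fun t => ln (X - t)) y (- / (X - y))).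
  { auto_derive; [lra|]. field; lra. }
  assert (H1 := cderiv_Cexp c _ _ _ Hl).
  assert (H2 : is_derive (fun t => ln (X - t) ^ k / INR (fact k)) y
                 (match k with O => 0 | S j => - / (X - y) * (ln (X - y) ^ j / INR (fact j)) end)).
  { destruct k as [|j].
    - simpl. apply @is_derive_const.
    - replace (- / (X - y) * (ln (X - y) ^ j / INR (fact j)))
        with (INR (S j) * - / (X - y) * ln (X - y) ^ j / INR (fact (S j))).
      + apply (is_derive_scal_l (V := R_NormedModule) (fun t => ln (X - t) ^ S j) y _ (/ INR (fact (S j)))).
        apply (is_derive_pow (fun t => ln (X - t)) (S j) y _ Hl).
      + rewrite fact_simpl, mult_INR. field.
        repeat split; first [apply INR_fact_neq_0 | apply (not_0_INR (S j)); lia | lra]. }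
  assert (H3 := cderiv_mult _ _ _ _ _ H1 (cderiv_RtoC _ _ _ H2)).
  cbv beta in H3. eapply cderiv_val; [|exact H3].
  assert (Ex : Cexp ((c - 1) * ln (X - y)) = (Cexp (c * ln (X - y)) * RtoC (/ (X - y)))%C).
  { replace ((c - 1) * ln (X - y))%C with (c * ln (X - y) + RtoC (- ln (X - y)))%C
      by (rewrite RtoC_opp; ring).
    rewrite Cexp_plus, Cexp_RtoC, exp_Ropp, exp_ln by lra. reflexivity. }
  unfold mul_lin, pow_coef. rewrite Ex. destruct k as [|j].
  - rewrite RtoC_opp. ring.
  - rewrite RtoC_mult, RtoC_opp. ring.
Qed.

(** Differentiating a binomial remainder lowers both the order and the exponent,
    which is what lets the bound below be proved by induction on the order. *)
Lemma cderiv_binom_rem (K : nat) (c : C) (X y : R) (k : nat) :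
  y < X ->
  cderiv (fun t => binom_rem (S K) c X t k) y (- mul_lin c (binom_rem K (c - RtoC 1)%C X y) k)%C.
Proof.
  intros Hy.
  set (v := fun m => mul_binom c m (pow_coef X (c - INR m)%C) k).
  apply cderiv_val with
    (- mul_lin c (pow_coef (X - y) (c - RtoC 1)%C) k
     - (RtoC 0 + csum (fun m => RtoC (- (INR (S m) * (- y) ^ m)) * v (S m)) K))%C.
  - unfold binom_rem. rewrite mul_lin_minus, mul_lin_csum.
    rewrite (csum_ext (fun m => RtoC (- (INR (S m) * (- y) ^ m)) * v (S m))%C
      (fun m => (- RtoC 1) * mul_lin c (fun j => RtoC ((- y) ^ m) *
                        mul_binom (c - RtoC 1) m (pow_coef X (c - RtoC 1 - INR m)) j) k)%C).
    + rewrite csum_scal. ring.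
    + intros m _. rewrite mul_lin_scal, mul_lin_binom_comm, <- mul_lin_binom_comm, <- mul_binom_absorb.
      unfold v. replace (c - INR (S m))%C with (c - RtoC 1 - INR m)%C
        by (rewrite S_INR, RtoC_plus; ring).
      rewrite RtoC_opp, RtoC_mult. ring.
  - apply cderiv_minus; [now apply cderiv_pow_coef|].
    apply cderiv_ext with
      (fun t => v 0%nat + csum (fun m => RtoC ((- t) ^ S m) * v (S m)) K)%C.
    { intros t. clear -v. fold v.
      change (fun m => RtoC ((- t) ^ m) * mul_binom c m (pow_coef X (c - INR m)) k)%C
        with (fun m => RtoC ((- t) ^ m) * v m)%C.
      induction K as [|K IH].
      - simpl. ring.
      - change (csum (fun m => RtoC ((- t) ^ m) * v m) (S (S K)))%C
          with (csum (fun m => RtoC ((- t) ^ m) * v m) (S K) + RtoC ((- t) ^ S K) * v (S K))%C.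
        rewrite <- IH.
        change (csum (fun m => RtoC ((- t) ^ S m) * v (S m)) (S K))%C
          with (csum (fun m => RtoC ((- t) ^ S m) * v (S m)) K + RtoC ((- t) ^ S K) * v (S K))%C.
        apply Cplus_assoc. }
    apply cderiv_plus; [apply cderiv_const|].
    apply (cderiv_csum (fun m t => RtoC ((- t) ^ S m) * v (S m))%C).
    intros m _.
    eapply cderiv_val; [|apply cderiv_mult; [|apply cderiv_const]].
    2:{ apply cderiv_RtoC with (l := - (INR (S m) * (- y) ^ m)).
        replace (- (INR (S m) * (- y) ^ m)) with (INR (S m) * - (1) * (- y) ^ m) by ring.
        apply (is_derive_pow (fun t => - t) (S m)).
        apply (is_derive_opp (fun t => t) y 1), @is_derive_id. }
    cbv beta. ring.
Qed.

Lemma binom_rem_at_0 (K : nat) (c : C) (X : R) (k : nat) : binom_rem (S K) c X 0 k = RtoC 0.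
Proof.
  unfold binom_rem. rewrite Rminus_0_r, Ropp_0.
  assert (Hs : csum (fun m => RtoC (0 ^ m) * mul_binom c m (pow_coef X (c - INR m)) k)%C (S K) = pow_coef X c k).
  { induction K as [|K IH].
    - simpl. replace (c - 0)%C with c by ring. ring.
    - change (csum ?f (S (S K))) with (csum f (S K) + f (S K))%C.
      rewrite IH. simpl pow. rewrite Rmult_0_l. ring. }
  rewrite Hs. ring.
Qed.

Lemma exp_le (x y : R) : x <= y -> exp x <= exp y.
Proof. intros [Hl | ->]; [left; now apply exp_increasing|lra]. Qed.

Lemma pow_fact_le_exp (x : R) (k : nat) : 0 <= x -> x ^ k / INR (fact k) <= exp x.
Proof.
  intros Hx. assert (HS := is_exp_Reals x). apply is_pseries_R in HS.
  assert (H0 : forall n, 0 <= / INR (fact n) * x ^ n).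
  { intros n. apply Rmult_le_pos; [left; apply Rinv_0_lt_compat, INR_fact_lt_0|now apply pow_le]. }
  apply Rle_trans with (sum_n (fun n => / INR (fact n) * x ^ n) k).
  - destruct k as [|k]; [rewrite sum_O|rewrite sum_Sn].
    + simpl. lra.
    + change (plus ?a ?b) with (a + b).
      assert (0 <= sum_n (fun n => / INR (fact n) * x ^ n) k).
      { rewrite <- (Rmult_0_r (INR (S k))), <- sum_n_const.
        apply sum_n_m_le. exact H0. }
      unfold Rdiv. lra.
  - apply (is_lim_seq_incr_compare (sum_n (fun n => / INR (fact n) * x ^ n)) (exp x) HS).
    intros n. rewrite sum_Sn. change (plus ?a ?b) with (a + b). specialize (H0 (S n)). lra.
Qed.

(** By induction on [K]: the remainder of order [K+1] vanishes at [y = 0] and its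
    derivative is a linear polynomial in [u] times a remainder of order [K], so the mean
    value theorem gains one power of [X] at each step. The loss [rho] in the exponent
    pays for [|X^u| <= X^rho] on the disc. *)
Lemma binom_rem_bound (rho : R) (K : nat) (c : C) :
  0 < rho ->
  exists D, 0 <= D /\ forall X y, 2 <= X -> 0 <= y <= 1 ->
    coef_bound (D * exp ((Re c - INR K + rho) * ln X)) rho (binom_rem K c X y).
Proof.
  intros Hr. revert c; induction K as [|K IH]; intros c.
  - exists (exp (Rabs (Re c) * ln 2)); split; [left; apply exp_pos|].
    intros X y HX Hy k.
    unfold binom_rem, pow_coef; simpl csum.
    replace (Cexp (c * ln (X - y)) * RtoC (ln (X - y) ^ k / INR (fact k)) - 0)%C
      with (Cexp (c * ln (X - y)) * RtoC (ln (X - y) ^ k / INR (fact k)))%C by ring.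
    rewrite Cmod_mult, Cmod_Cexp, Cmod_R.
    assert (L0 : 0 <= ln (X - y)) by (rewrite <- ln_1; apply ln_le; lra).
    assert (L1 : ln (X - y) <= ln X) by (apply ln_le; lra).
    assert (L2 : ln X - ln 2 <= ln (X - y)).
    { replace (ln X - ln 2) with (ln (X / 2)).
      - apply ln_le; lra.
      - unfold Rdiv. rewrite ln_mult, ln_Rinv by lra. ring. }
    rewrite Rabs_right.
    2:{ apply Rle_ge, Rmult_le_pos; [now apply pow_le|left; apply Rinv_0_lt_compat, INR_fact_lt_0]. }
    replace (exp (Re (c * ln (X - y))) * (ln (X - y) ^ k / INR (fact k)) * rho ^ k)
      with (exp (Re (c * ln (X - y))) * ((rho * ln (X - y)) ^ k / INR (fact k)))
      by (rewrite Rpow_mult_distr; field; apply INR_fact_neq_0).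
    apply Rle_trans with (exp (Re (c * ln (X - y))) * exp (rho * ln X)).
    + apply Rmult_le_compat_l; [left; apply exp_pos|].
      eapply Rle_trans; [apply pow_fact_le_exp; apply Rmult_le_pos; lra|].
      apply exp_le, Rmult_le_compat_l; lra.
    + rewrite <- !exp_plus. apply exp_le.
      replace (Re (c * RtoC (ln (X - y)))) with (Re c * ln (X - y))
        by (simpl; unfold Re, Im; ring).
      change (INR 0) with 0.
      assert (Re c * ln (X - y) <= Re c * ln X + Rabs (Re c) * ln 2).
      { assert (Hc : Re c * (ln (X - y) - ln X) <= Rabs (Re c) * ln 2); [|lra].
        eapply Rle_trans; [apply Rle_abs|]. rewrite Rabs_mult.
        apply Rmult_le_compat_l; [apply Rabs_pos|]. rewrite Rabs_left1; lra. }
      nra.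
  - destruct (IH (c - RtoC 1)%C) as [D [HD Hb]].
    exists (2 * ((Cmod c + rho) * D)); split.
    { pose proof (Cmod_ge_0 c). apply Rmult_le_pos; [lra|]. apply Rmult_le_pos; lra. }
    intros X y HX Hy k.
    assert (Hp : 0 < rho ^ k) by now apply pow_lt.
    set (W := D * exp ((Re c - INR (S K) + rho) * ln X)).
    assert (HW : forall t, 0 <= t <= 1 -> coef_bound W rho (binom_rem K (c - RtoC 1)%C X t)).
    { intros t Ht. specialize (Hb X t HX Ht).
      replace (Re (c - 1) - INR K + rho) with (Re c - INR (S K) + rho) in Hb
        by (rewrite S_INR; simpl; unfold Re, Im; ring).
      exact Hb. }
    apply Rmult_le_reg_r with (/ rho ^ k); [now apply Rinv_0_lt_compat|].
    rewrite Rmult_assoc, Rinv_r, Rmult_1_r by lra.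
    replace (2 * ((Cmod c + rho) * D) * exp ((Re c - INR (S K) + rho) * ln X) * / rho ^ k)
      with (2 * ((Cmod c + rho) * W * / rho ^ k)) by (unfold W; ring).
    apply (cderiv_mvt (fun t => binom_rem (S K) c X t k)
             (fun t => - mul_lin c (binom_rem K (c - RtoC 1)%C X t) k)%C); auto.
    + intros t Ht. apply cderiv_binom_rem; lra.
    + apply binom_rem_at_0.
    + intros t Ht. rewrite Cmod_opp.
      apply Rmult_le_reg_r with (rho ^ k); auto.
      rewrite Rmult_assoc, Rinv_l, Rmult_1_r by lra.
      now apply (coef_bound_mul_lin W rho c _ Hr (HW t Ht) k).
Qed.

(** * The Euler-Maclaurin sequence *)

(** The usual recursion of the Bernoulli numbers, normalized at [q = 1]. *)
Definition bern_rec (B : nat -> R) : Prop :=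
  forall q, rsum (fun i => Binomial.C q i * B i) q = if Nat.eqb q 1 then 1 else 0.

(** The Bernoulli numbers in the convention [B_1 = 1/2]. *)
Definition beta (B : nat -> R) (i : nat) : R := (-1) ^ i * B i.

(** Coefficients in [u], where [x = w + u], of the Euler-Maclaurin expression
    [(x+1) (1^x + .. + N^x) - sum_(i <= M) binom(x+1,i) beta_i N^(x+1-i)]. *)
Definition em_coef (B : nat -> R) (M N : nat) (w : C) : nat -> C :=
  fun k => (mul_lin (w + RtoC 1) (fun j => csum (fun n => pow_coef (INR (S n)) w j) N) k
            - csum (fun i => RtoC (beta B i) *
                      mul_binom (w + RtoC 1) i (pow_coef (INR N) (w + RtoC 1 - INR i)%C) k) (S M))%C.

Lemma mul_binom_rem (d : C) (i K : nat) (X : R) (k : nat) :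
  mul_binom d i (binom_rem K (d - INR i)%C X 1) k =
  (mul_binom d i (pow_coef (X - 1) (d - INR i)%C) k
   - csum (fun m => RtoC ((- (1)) ^ m * Binomial.C (i + m) i) *
        mul_binom d (i + m) (pow_coef X (d - INR (i + m))%C) k) K)%C.
Proof.
  unfold binom_rem. rewrite mul_binom_minus, mul_binom_csum. f_equal.
  apply csum_ext; intros m _.
  rewrite (mul_binom_scal d (RtoC ((- (1)) ^ m)) i (mul_binom (d - INR i) m (pow_coef X (d - INR i - INR m)))).
  rewrite (mul_binom_comm d (d - INR i)%C i m), mul_binom_trinomial.
  replace (d - INR i - INR m)%C with (d - INR (i + m))%C
    by (rewrite plus_INR, RtoC_plus; ring).
  rewrite RtoC_mult. ring.
Qed.

(** Expand [(X-1)^(x+1-i)] in powers of [1/X] to the order at which all the terms of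
    degree at most [M] are present. In [sum_i binom(x+1,i) beta_i (X-1)^(x+1-i)] the term
    of degree [q] then carries [binom(x+1,q) (-1)^q sum_(i <= q) binom(q,i) B_i]. By the
    recursion this sum is [B_q] for [q <> 1], so that the term cancels the term [i = q]
    at [N + 1]; for [q = 1] it is [B_1 + 1], and the excess cancels the new summand
    [(x+1) X^x]. Only the remainders are left. *)
Lemma em_coef_step (B : nat -> R) (M N : nat) (w : C) (k : nat) :
  bern_rec B -> (1 <= M)%nat ->
  (em_coef B M (S N) w k - em_coef B M N w k)%C =
  csum (fun i => RtoC (beta B i) *
     mul_binom (w + RtoC 1) i (binom_rem (S M - i) (w + RtoC 1 - INR i)%C (INR (S N)) 1) k)%C (S M).
Proof.
  intros Hrec HM. set (d := (w + RtoC 1)%C). set (X := INR (S N)).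
  set (v := fun q => mul_binom d q (pow_coef X (d - INR q)%C) k).
  assert (HX : X - 1 = INR N) by (unfold X; rewrite S_INR; ring).
  rewrite (csum_ext (fun i => RtoC (beta B i) * mul_binom d i (binom_rem (S M - i) (d - INR i)%C X 1) k)%C
    (fun i => RtoC (beta B i) * mul_binom d i (pow_coef (INR N) (d - INR i)%C) k +
       (- RtoC 1) * csum (fun m => RtoC ((-1) ^ (i + m) * (Binomial.C (i + m) i * B i)) * v (i + m)%nat)
                       (S M - i))%C).
  2:{ intros i _. rewrite mul_binom_rem, HX.
      transitivity (RtoC (beta B i) * mul_binom d i (pow_coef (INR N) (d - INR i)%C) k +
        (- RtoC (beta B i)) * csum (fun m => RtoC ((- (1)) ^ m * Binomial.C (i + m) i) *
                 mul_binom d (i + m) (pow_coef X (d - INR (i + m))%C) k) (S M - i))%C; [ring|].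
      f_equal. rewrite <- !csum_scal.
      apply csum_ext; intros m _. unfold v, beta.
      replace (- (1)) with (-1) by ring. rewrite pow_add, !RtoC_mult. ring. }
  rewrite csum_plus, csum_scal.
  (* Collect the terms of equal degree [q]; the recursion evaluates their sum. *)
  rewrite (csum_triangle (fun i q => RtoC ((-1) ^ q * (Binomial.C q i * B i)) * v q)%C).
  rewrite (csum_ext (fun q => csum (fun i => RtoC ((-1) ^ q * (Binomial.C q i * B i)) * v q) (S q))%C
     (fun q => RtoC (beta B q) * v q + (if Nat.eqb q 1 then - v 1%nat else RtoC 0))%C).
  2:{ intros q _.
      rewrite (csum_ext _ (fun i => v q * RtoC ((-1) ^ q * (Binomial.C q i * B i)))%C)
        by (intros; apply Cmult_comm).
      rewrite csum_scal, csum_RtoC, rsum_scal. simpl rsum. rewrite Hrec, C_n_n.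
      unfold beta. destruct (Nat.eqb_spec q 1) as [->|Hq].
      - rewrite !RtoC_mult, RtoC_plus. simpl pow. rewrite !RtoC_mult. ring_simplify.
        replace (RtoC (-1)) with (- RtoC 1)%C by (rewrite <- RtoC_opp; reflexivity). ring.
      - rewrite Rplus_0_l, Rmult_1_l. ring. }
  rewrite csum_plus.
  assert (Hv : forall n, csum (fun q => if Nat.eqb q 1 then - v 1%nat else RtoC 0)%C (S (S n))
                = (- v 1%nat)%C).
  { induction n as [|n IH]; [simpl; ring|].
    change (csum ?f (S (S (S n)))) with (csum f (S (S n)) + f (S (S n)))%C.
    rewrite IH. simpl. ring. }
  destruct M as [|M']; [lia|]. rewrite Hv.
  unfold em_coef. fold d. fold X.
  change (csum (fun i => RtoC (beta B i) * mul_binom d i (pow_coef X (d - INR i)) k)%C)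
    with (csum (fun i => RtoC (beta B i) * v i)%C).
  assert (Hv1 : v 1%nat = mul_lin d (pow_coef X w) k).
  { unfold v. simpl. rewrite Rinv_1. replace (d - 0)%C with d by ring.
    replace (d - 1)%C with w by (unfold d; ring). ring. }
  rewrite Hv1, !mul_lin_csum. 
  change (csum (fun i => mul_lin d (fun k0 => pow_coef (INR (S i)) w k0) k) (S N))
    with (csum (fun i => mul_lin d (pow_coef (INR (S i)) w) k) N + mul_lin d (pow_coef X w) k)%C.
  change (fun i => mul_lin d (fun k0 => pow_coef (INR (S i)) w k0) k)
    with (fun i => mul_lin d (pow_coef (INR (S i)) w) k).
  ring.
Qed.

(** Every remainder in the increment has the same size [X^(Re w - M + rho)]: the order
    decreases with [i] exactly as the exponent does. *)
Lemma em_coef_step_bound (B : nat -> R) (M : nat) (w : C) (rho : R) :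
  bern_rec B -> (1 <= M)%nat -> 0 < rho ->
  exists D, 0 <= D /\ forall N, (1 <= N)%nat ->
    coef_bound (D * exp ((Re w - INR M + rho) * ln (INR (S N)))) rho
        (fun k => em_coef B M (S N) w k - em_coef B M N w k)%C.
Proof.
  intros Hrec HM Hr.
  assert (Hi : forall i, (i < S M)%nat -> exists D, 0 <= D /\ forall N, (1 <= N)%nat ->
    coef_bound (D * exp ((Re w - INR M + rho) * ln (INR (S N)))) rho
      (fun k => RtoC (beta B i) *
     mul_binom (w + RtoC 1) i (binom_rem (S M - i) (w + RtoC 1 - INR i)%C (INR (S N)) 1) k)%C).
  { intros i Hi.
    destruct (binom_rem_bound rho (S M - i) (w + RtoC 1 - INR i)%C Hr) as [D1 [HD1 H1]].
    destruct (coef_bound_mul_binom rho (w + RtoC 1)%C i Hr) as [D2 [HD2 H2]].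
    exists (Cmod (RtoC (beta B i)) * (D2 * D1)); split.
    { pose proof (Cmod_ge_0 (RtoC (beta B i))). apply Rmult_le_pos; [lra|]. now apply Rmult_le_pos. }
    intros N HN. rewrite !Rmult_assoc. apply coef_bound_scal, H2.
    - apply Rmult_le_pos; [auto|left; apply exp_pos].
    - specialize (H1 (INR (S N)) 1).
      replace (Re (w + 1 - INR i) - INR (S M - i) + rho) with (Re w - INR M + rho) in H1.
      + apply H1; [|lra]. apply (le_INR 2); lia.
      + rewrite minus_INR, S_INR by lia. simpl. unfold Re. ring. }
  assert (Hn : forall n, (n <= S M)%nat -> exists D, 0 <= D /\ forall N, (1 <= N)%nat ->
    coef_bound (D * exp ((Re w - INR M + rho) * ln (INR (S N)))) rho
      (fun k => csum (fun i => RtoC (beta B i) *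
     mul_binom (w + RtoC 1) i (binom_rem (S M - i) (w + RtoC 1 - INR i)%C (INR (S N)) 1) k)%C n)).
  { induction n as [|n IH]; intros Hle.
    - exists 0; split; [lra|]. intros N HN k. simpl. rewrite Cmod_0. lra.
    - destruct (IH ltac:(lia)) as [D1 [HD1 H1]]. destruct (Hi n ltac:(lia)) as [D2 [HD2 H2]].
      exists (D1 + D2); split; [lra|]. intros N HN k.
      specialize (H1 N HN k); specialize (H2 N HN k).
      assert (Hp : 0 <= rho ^ k) by (apply pow_le; lra).
      simpl csum. eapply Rle_trans.
      { apply Rmult_le_compat_r; [exact Hp|apply Cmod_triangle]. }
      rewrite Rmult_plus_distr_r, Rmult_plus_distr_r. now apply Rplus_le_compat. }
  destruct (Hn (S M) (le_n _)) as [D [HD H1]].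
  exists D; split; auto. intros N HN k. rewrite (em_coef_step B M N w k Hrec HM). now apply H1.
Qed.

(** * Convergence with a rate *)

(** From the index [n] on, the increment at [j] is dominated by
    [D n^(-q) (1/j - 1/(j+1))], which telescopes. *)
Lemma telescoping_rate (a : nat -> R) (D : R) (q : nat) :
  0 <= D ->
  (forall n, (1 <= n)%nat -> Rabs (a (S n) - a n) <= D / (INR n ^ S q * INR (S n))) ->
  exists l, is_lim_seq a (Finite l) /\
    forall n, (1 <= n)%nat -> Rabs (l - a n) <= D / INR n ^ S q.
Proof.
  intros HD Ha.
  assert (Hpos : forall n, (1 <= n)%nat -> 1 <= INR n) by (intros; now apply (le_INR 1)).
  assert (Hinc : forall n j, (1 <= n)%nat ->
     Rabs (a (n + j)%nat - a n) <= D / INR n ^ q * (/ INR n - / INR (n + j))).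
  { intros n j Hn. pose proof (Hpos n Hn) as Pn. induction j as [|j IH].
    - rewrite Nat.add_0_r, !Rminus_diag, Rabs_R0. lra.
    - replace (n + S j)%nat with (S (n + j)) by lia.
      replace (a (S (n + j)) - a n) with ((a (S (n + j)) - a (n + j)%nat) + (a (n + j)%nat - a n)) by ring.
      eapply Rle_trans; [apply Rabs_triang|].
      assert (Pj := Hpos (n + j)%nat ltac:(lia)).
      assert (Hs := Ha (n + j)%nat ltac:(lia)).
      assert (Hq : D / (INR (n + j) ^ S q * INR (S (n + j))) <=
                   D / INR n ^ q * (/ INR (n + j) - / INR (S (n + j)))).
      { replace (/ INR (n + j) - / INR (S (n + j))) with (/ (INR (n + j) * INR (S (n + j))))
          by (rewrite S_INR; field; lra).
        unfold Rdiv. rewrite Rmult_assoc, <- Rinv_mult. apply Rmult_le_compat_l; auto.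
        assert (0 < INR n ^ q) by (apply pow_lt; lra).
        assert (INR n ^ q <= INR (n + j) ^ q).
        { apply pow_incr. split; [lra|]. apply le_INR; lia. }
        assert (0 < INR (S (n + j))) by (apply lt_0_INR; lia).
        apply Rinv_le_contravar.
        - apply Rmult_lt_0_compat; auto. apply Rmult_lt_0_compat; lra.
        - rewrite <- tech_pow_Rmult, (Rmult_comm (INR (n + j)) (INR (n + j) ^ q)), Rmult_assoc.
          apply Rmult_le_compat_r; [apply Rmult_le_pos; lra|lra]. }
      lra. }
  assert (Hinc' : forall n j, (1 <= n)%nat -> Rabs (a (n + j)%nat - a n) <= D / INR n ^ S q).
  { intros n j Hn. eapply Rle_trans; [apply Hinc; auto|].
    pose proof (Hpos n Hn) as Pn. assert (0 < INR (n + j)) by (apply lt_0_INR; lia).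
    replace (D / INR n ^ S q) with (D / INR n ^ q * / INR n)
      by (rewrite <- tech_pow_Rmult; field; split; first [apply pow_nonzero; lra|lra]).
    apply Rmult_le_compat_l.
    - apply Rmult_le_pos; auto. left; apply Rinv_0_lt_compat, pow_lt; lra.
    - assert (0 < / INR (n + j)) by now apply Rinv_0_lt_compat. lra. }
  assert (Hex : ex_finite_lim_seq a).
  { apply ex_lim_seq_cauchy_corr. intros eps.
    destruct (archimed_cor1 (eps / (2 * (D + 1)))) as [n0 [Hn0 Hp]].
    { apply Rdiv_lt_0_compat; [apply cond_pos|lra]. }
    exists n0. assert (P0 := Hpos n0 ltac:(lia)).
    assert (Hsmall : D / INR n0 ^ S q < eps / 2).
    { apply Rle_lt_trans with (D * / INR n0).
      - apply Rmult_le_compat_l; auto. apply Rinv_le_contravar; [lra|].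
        simpl. rewrite <- (Rmult_1_r (INR n0)) at 1.
        apply Rmult_le_compat_l; [lra|]. apply pow_R1_Rle; lra.
      - assert (0 < / INR n0) by (apply Rinv_0_lt_compat; lra).
        apply Rle_lt_trans with ((D + 1) * / INR n0); [nra|].
        replace (eps / 2) with ((D + 1) * (eps / (2 * (D + 1)))) by (field; lra).
        apply Rmult_lt_compat_l; lra. }
    intros n m Hn Hm.
    replace n with (n0 + (n - n0))%nat by lia. replace m with (n0 + (m - n0))%nat by lia.
    assert (H1 := Hinc' n0 (n - n0)%nat ltac:(lia)).
    assert (H2 := Hinc' n0 (m - n0)%nat ltac:(lia)).
    apply Rabs_le_between in H1. apply Rabs_le_between in H2. apply Rabs_lt_between. lra. }
  destruct Hex as [l Hl]. exists l; split; auto.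
  intros n Hn.
  assert (HL : is_lim_seq (fun j => Rabs (a (j + n)%nat - a n)) (Rabs (l - a n))).
  { apply (is_lim_seq_abs _ (Finite (l - a n))).
    apply is_lim_seq_minus'; [now apply is_lim_seq_incr_n|apply is_lim_seq_const]. }
  apply (is_lim_seq_le _ (fun _ => D / INR n ^ S q) (Rabs (l - a n)) (D / INR n ^ S q)) in HL; auto.
  - intros j. rewrite Nat.add_comm. now apply Hinc'.
  - apply is_lim_seq_const.
Qed.

Lemma Cmod_le_sum (z : C) : Cmod z <= Rabs (Re z) + Rabs (Im z).
Proof.
  replace z with (RtoC (Re z) + Ci * RtoC (Im z))%C at 1
    by (apply C_eq; simpl; unfold Re, Im; ring).
  eapply Rle_trans; [apply Cmod_triangle|].
  rewrite Cmod_mult, Cmod_Ci, !Cmod_R. lra.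
Qed.

Lemma im_le_Cmod (z : C) : Rabs (Im z) <= Cmod z.
Proof. eapply Rle_trans; [apply Rmax_r|apply Rmax_Cmod]. Qed.

(** Taking [M] large makes the increments as small as any power of [1/N]. *)
Lemma em_coef_limit (B : nat -> R) (M q : nat) (w : C) (rho : R) :
  bern_rec B -> (1 <= M)%nat -> 0 < rho -> Re w + rho + INR q + 2 <= INR M ->
  exists (g : nat -> C) (D : R), 0 <= D /\
    forall N, (1 <= N)%nat -> coef_bound (D / INR N ^ S q) rho (fun k => g k - em_coef B M N w k)%C.
Proof.
  intros Hrec HM Hr Hq.
  destruct (em_coef_step_bound B M w rho Hrec HM Hr) as [D [HD HG]].
  assert (Hk : forall k, exists g : C, forall N, (1 <= N)%nat ->
            Cmod (g - em_coef B M N w k) * rho ^ k <= 2 * D / INR N ^ S q).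
  { intros k. assert (Hp : 0 < rho ^ k) by now apply pow_lt.
    assert (Hs : forall n, (1 <= n)%nat ->
      Cmod (em_coef B M (S n) w k - em_coef B M n w k) <= D / rho ^ k / (INR n ^ S q * INR (S n))).
    { intros n Hn. assert (P1 : 1 <= INR n) by now apply (le_INR 1).
      assert (PX : 1 < INR (S n)) by (rewrite S_INR; lra).
      specialize (HG n Hn k). simpl in HG. 
      apply Rmult_le_reg_r with (rho ^ k); auto.
      eapply Rle_trans; [exact HG|].
      replace (D / rho ^ k / (INR n ^ S q * INR (S n)) * rho ^ k)
        with (D * / (INR n ^ S q * INR (S n)))
        by (field; repeat split; try lra; apply pow_nonzero; lra).
      apply Rmult_le_compat_l; auto.
      apply Rle_trans with (exp (- INR (S (S q)) * ln (INR (S n)))).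
      - apply exp_le, Rmult_le_compat_r; [left; rewrite <- ln_1; apply ln_increasing; lra|].
        rewrite !S_INR; lra.
      - rewrite Ropp_mult_distr_l_reverse, exp_Ropp.
        change (exp (INR (S (S q)) * ln (INR (S n)))) with (Rpower (INR (S n)) (INR (S (S q)))).
        rewrite Rpower_pow by lra.
        assert (0 < INR n ^ S q) by (apply pow_lt; lra).
        apply Rinv_le_contravar; [apply Rmult_lt_0_compat; lra|].
        rewrite <- (tech_pow_Rmult _ (S q)), Rmult_comm. apply Rmult_le_compat_l; [lra|].
        apply pow_incr; rewrite S_INR; lra. }
    assert (HD' : 0 <= D / rho ^ k) by (apply Rmult_le_pos; [auto|left; now apply Rinv_0_lt_compat]).
    destruct (telescoping_rate (fun n => Re (em_coef B M n w k)) (D / rho ^ k) q HD') as [l1 [_ H1]].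
    { intros n Hn. eapply Rle_trans; [|apply Hs; auto].
      apply (re_le_Cmod (em_coef B M (S n) w k - em_coef B M n w k)). }
    destruct (telescoping_rate (fun n => Im (em_coef B M n w k)) (D / rho ^ k) q HD') as [l2 [_ H2]].
    { intros n Hn. eapply Rle_trans; [|apply Hs; auto].
      apply (im_le_Cmod (em_coef B M (S n) w k - em_coef B M n w k)). }
    exists (l1, l2). intros N HN. specialize (H1 N HN); specialize (H2 N HN).
    assert (P1 : 1 <= INR N) by now apply (le_INR 1).
    assert (0 < INR N ^ S q) by (apply pow_lt; lra).
    apply Rle_trans with ((D / rho ^ k / INR N ^ S q + D / rho ^ k / INR N ^ S q) * rho ^ k).
    - apply Rmult_le_compat_r; [lra|].
      eapply Rle_trans; [apply Cmod_le_sum|]. now apply Rplus_le_compat.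
    - right. field. lra. }
  exists (fun k => (real (Lim_seq (fun N => Re (em_coef B M N w k))), real (Lim_seq (fun N => Im (em_coef B M N w k))))).
  exists (2 * D); split; [lra|].
  intros N HN k. destruct (Hk k) as [g Hg].
  assert (Hp : 0 < rho ^ k) by now apply pow_lt.
  assert (L : forall (p : C -> R), (forall z z', p (z - z')%C = p z - p z') ->
             (forall z, Rabs (p z) <= Cmod z) -> real (Lim_seq (fun N => p (em_coef B M N w k))) = p g).
  { intros p Hlin Hle. replace (p g) with (real (Finite (p g))) by reflexivity. f_equal.
    apply is_lim_seq_unique.
    apply is_lim_seq_ext with (fun n => p g - (p g - p (em_coef B M n w k))); [intros; ring|].
    replace (Finite (p g)) with (Finite (p g - 0)) by (f_equal; ring).
    apply is_lim_seq_minus'; [apply is_lim_seq_const|].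
    apply is_lim_seq_abs_0.
    apply is_lim_seq_le_le_loc with (fun _ => 0) (fun n => (2 * D / rho ^ k) * / INR n).
    - exists 1%nat. intros n Hn. split; [apply Rabs_pos|].
      rewrite <- Hlin. eapply Rle_trans; [apply Hle|].
      apply Rmult_le_reg_r with (rho ^ k); auto. eapply Rle_trans; [now apply Hg|].
      assert (P1 : 1 <= INR n) by now apply (le_INR 1).
      replace (2 * D / rho ^ k * / INR n * rho ^ k) with (2 * D * / INR n) by (field; lra).
      apply Rmult_le_compat_l; [lra|]. apply Rinv_le_contravar; [lra|].
      simpl. rewrite <- (Rmult_1_r (INR n)) at 1.
      apply Rmult_le_compat_l; [lra|]. apply pow_R1_Rle; lra.
    - apply is_lim_seq_const.
    - replace (Finite 0) with (Rbar_mult (2 * D / rho ^ k) (Rbar_inv p_infty))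
        by (simpl; f_equal; ring).
      apply is_lim_seq_scal_l. apply is_lim_seq_inv; [apply is_lim_seq_INR|discriminate]. }
  rewrite (L Re), (L Im).
  - rewrite <- surjective_pairing. now apply Hg.
  - intros; simpl; unfold Im; ring.
  - apply im_le_Cmod.
  - intros; simpl; unfold Re; ring.
  - apply re_le_Cmod.
Qed.

(** * Complex series *)

(** Componentwise, so that the theory of real series applies. *)
Definition is_cseries (u : nat -> C) (l : C) : Prop :=
  is_series (fun n => Re (u n)) (Re l) /\ is_series (fun n => Im (u n)) (Im l).

Definition is_clim (u : nat -> C) (l : C) : Prop :=
  is_lim_seq (fun n => Re (u n)) (Re l) /\ is_lim_seq (fun n => Im (u n)) (Im l).

Lemma Re_csum (u : nat -> C) (n : nat) : Re (csum u n) = rsum (fun i => Re (u i)) n.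
Proof. induction n as [|n IH]; [reflexivity|]. simpl. rewrite <- IH. reflexivity. Qed.

Lemma Im_csum (u : nat -> C) (n : nat) : Im (csum u n) = rsum (fun i => Im (u i)) n.
Proof. induction n as [|n IH]; [reflexivity|]. simpl. rewrite <- IH. reflexivity. Qed.

Lemma sum_n_rsum (f : nat -> R) (n : nat) : sum_n f n = rsum f (S n).
Proof. apply (rsum_sum_n_m_0 f n). Qed.

Lemma sum_n_csum (u : nat -> C) (n : nat) :
  sum_n (G := C_NormedModule) u n = csum u (S n).
Proof.
  induction n as [|n IH].
  - rewrite sum_O. simpl. symmetry. apply Cplus_0_l.
  - rewrite sum_Sn, IH. reflexivity.
Qed.

Lemma is_series_clim (u : nat -> C) (l : C) :
  @is_series C_AbsRing C_NormedModule u l -> is_clim (csum u) l.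
Proof.
  intros HS.
  assert (H1 : forall eps : posreal, eventually (fun n =>
            Rabs (Re (csum u (S n)) - Re l) < eps /\ Rabs (Im (csum u (S n)) - Im l) < eps)).
  { intros eps. assert (Hb := proj1 (filterlim_locally _ _) HS eps).
    destruct Hb as [N HN]. exists N. intros n Hn. specialize (HN n Hn).
    rewrite sum_n_csum in HN. exact HN. }
  split; apply is_lim_seq_incr_1, is_lim_seq_spec; intros eps;
    destruct (H1 eps) as [N HN]; exists N; intros n Hn; apply HN; auto.
Qed.

Lemma is_clim_cseries (u : nat -> C) (l : C) : is_clim (csum u) l -> is_cseries u l.
Proof.
  intros [H1 H2]; split.
  - apply is_lim_seq_incr_1 in H1. revert H1.
    change (is_series (fun n => Re (u n)) (Re l)) with (is_lim_seq (sum_n (fun n => Re (u n))) (Re l)).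
    apply is_lim_seq_ext.
    intros n. now rewrite Re_csum, sum_n_rsum.
  - apply is_lim_seq_incr_1 in H2. revert H2.
    change (is_series (fun n => Im (u n)) (Im l)) with (is_lim_seq (sum_n (fun n => Im (u n))) (Im l)).
    apply is_lim_seq_ext.
    intros n. now rewrite Im_csum, sum_n_rsum.
Qed.

Lemma is_cseries_clim (u : nat -> C) (l : C) : is_cseries u l -> is_clim (csum u) l.
Proof.
  intros [H1 H2]; split; apply is_lim_seq_incr_1.
  - revert H1.
    change (is_series (fun n => Re (u n)) (Re l)) with (is_lim_seq (sum_n (fun n => Re (u n))) (Re l)).
    apply is_lim_seq_ext. intros n. now rewrite Re_csum, sum_n_rsum.
  - revert H2.
    change (is_series (fun n => Im (u n)) (Im l)) with (is_lim_seq (sum_n (fun n => Im (u n))) (Im l)).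
    apply is_lim_seq_ext. intros n. now rewrite Im_csum, sum_n_rsum.
Qed.

Lemma is_clim_ext (u v : nat -> C) (l : C) : (forall n, u n = v n) -> is_clim u l -> is_clim v l.
Proof.
  intros Huv [H1 H2]; split; (eapply is_lim_seq_ext; [|eassumption]);
    intros n; simpl; now rewrite Huv.
Qed.

Lemma is_clim_plus (u v : nat -> C) (l l' : C) :
  is_clim u l -> is_clim v l' -> is_clim (fun n => u n + v n)%C (l + l')%C.
Proof. intros [H1 H2] [H3 H4]; split; simpl; now apply is_lim_seq_plus'. Qed.

Lemma is_clim_minus (u v : nat -> C) (l l' : C) :
  is_clim u l -> is_clim v l' -> is_clim (fun n => u n - v n)%C (l - l')%C.
Proof. intros [H1 H2] [H3 H4]; split; simpl; now apply is_lim_seq_minus'. Qed.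

Lemma is_clim_scal (s : C) (u : nat -> C) (l : C) :
  is_clim u l -> is_clim (fun n => s * u n)%C (s * l)%C.
Proof.
  intros [H1 H2]; split; simpl.
  - apply is_lim_seq_minus'; (apply is_lim_seq_mult'; [apply is_lim_seq_const|assumption]).
  - apply is_lim_seq_plus'; (apply is_lim_seq_mult'; [apply is_lim_seq_const|assumption]).
Qed.

Lemma is_clim_const (l : C) : is_clim (fun _ => l) l.
Proof. split; apply is_lim_seq_const. Qed.

Lemma is_clim_unique (u : nat -> C) (l l' : C) : is_clim u l -> is_clim u l' -> l = l'.
Proof.
  intros [H1 H2] [H3 H4]; apply C_eq.
  - apply is_lim_seq_unique in H1. apply is_lim_seq_unique in H3.
    rewrite H1 in H3. now injection H3.
  - apply is_lim_seq_unique in H2. apply is_lim_seq_unique in H4.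
    rewrite H2 in H4. now injection H4.
Qed.

Lemma is_clim_Cmod (u : nat -> C) (l : C) :
  is_lim_seq (fun n => Cmod (u n - l)) 0 -> is_clim u l.
Proof.
  intros Hl.
  assert (aux : forall p : C -> R, (forall z z', p (z - z')%C = p z - p z') ->
     (forall z, Rabs (p z) <= Cmod z) -> is_lim_seq (fun n => p (u n)) (p l)).
  { intros p Hlin Hle.
    apply is_lim_seq_ext with (fun n => (p (u n) - p l) + p l); [intros; ring|].
    replace (Finite (p l)) with (Finite (0 + p l)) by (f_equal; ring).
    apply is_lim_seq_plus'; [|apply is_lim_seq_const].
    apply is_lim_seq_abs_0.
    apply is_lim_seq_le_le with (fun _ => 0) (fun n => Cmod (u n - l)); auto.
    - intros n. split; [apply Rabs_pos|]. rewrite <- Hlin. apply Hle.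
    - apply is_lim_seq_const. }
  split; [apply (aux Re)|apply (aux Im)].
  - intros; simpl; unfold Re; ring.
  - apply re_le_Cmod.
  - intros; simpl; unfold Im; ring.
  - apply im_le_Cmod.
Qed.

Lemma is_clim_csum (f : nat -> nat -> C) (l : nat -> C) (n : nat) :
  (forall i, (i < n)%nat -> is_clim (f i) (l i)) ->
  is_clim (fun N => csum (fun i => f i N) n) (csum l n).
Proof.
  induction n as [|n IH]; intros Hf; simpl.
  - apply is_clim_const.
  - apply is_clim_plus; [apply IH; intros; apply Hf; lia|apply Hf; lia].
Qed.

Lemma is_cseries_ext (u v : nat -> C) (l : C) : (forall n, u n = v n) -> is_cseries u l -> is_cseries v l.
Proof.
  intros Huv HS. apply is_clim_cseries, is_clim_ext with (csum u); [|now apply is_cseries_clim].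
  intros n; apply csum_ext; auto.
Qed.

Lemma is_cseries_minus (u v : nat -> C) (l l' : C) :
  is_cseries u l -> is_cseries v l' -> is_cseries (fun n => u n - v n)%C (l - l')%C.
Proof.
  intros H1 H2. apply is_cseries_clim in H1. apply is_cseries_clim in H2. apply is_clim_cseries.
  eapply is_clim_ext; [|apply is_clim_minus; eassumption].
  intros n; simpl. induction n as [|n IH]; simpl; [ring|]. rewrite <- IH. ring.
Qed.

Lemma is_cseries_plus (u v : nat -> C) (l l' : C) :
  is_cseries u l -> is_cseries v l' -> is_cseries (fun n => u n + v n)%C (l + l')%C.
Proof.
  intros H1 H2. apply is_cseries_clim in H1. apply is_cseries_clim in H2. apply is_clim_cseries.
  eapply is_clim_ext; [|apply is_clim_plus; eassumption].
  intros n; simpl. now rewrite csum_plus.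
Qed.

Lemma is_cseries_scal (s : C) (u : nat -> C) (l : C) :
  is_cseries u l -> is_cseries (fun n => s * u n)%C (s * l)%C.
Proof.
  intros H1. apply is_cseries_clim in H1. apply is_clim_cseries.
  eapply is_clim_ext; [|apply is_clim_scal; eassumption].
  intros n; simpl. now rewrite csum_scal.
Qed.

Lemma is_cseries_0 : is_cseries (fun _ => RtoC 0) (RtoC 0).
Proof.
  apply is_clim_cseries. eapply is_clim_ext; [|apply is_clim_const].
  intros n; simpl. now rewrite csum_0.
Qed.

Lemma is_cseries_csum (u : nat -> nat -> C) (l : nat -> C) (n : nat) :
  (forall i, (i < n)%nat -> is_cseries (u i) (l i)) ->
  is_cseries (fun k => csum (fun i => u i k) n) (csum l n).
Proof.
  induction n as [|n IH]; intros Hf; simpl.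
  - apply is_cseries_0.
  - apply is_cseries_plus; [apply IH; intros; apply Hf; lia|apply Hf; lia].
Qed.

Lemma is_cseries_unique (u : nat -> C) (l l' : C) : is_cseries u l -> is_cseries u l' -> l = l'.
Proof. intros H1 H2. apply is_clim_unique with (csum u); now apply is_cseries_clim. Qed.

Lemma is_cseries_shift (u : nat -> C) (l : C) :
  is_cseries u l -> is_cseries (fun k => match k with O => RtoC 0 | S j => u j end) l.
Proof.
  intros H1. apply is_cseries_clim in H1. apply is_clim_cseries.
  assert (E1 : forall n, csum (fun k => match k with O => RtoC 0 | S j => u j end) (S n) = csum u n).
  { induction n as [|n IH]; [simpl; ring|].
    change (csum ?f (S (S n))) with (csum f (S n) + f (S n))%C.
    rewrite IH. reflexivity. }
  destruct H1 as [H1 H2]; split; apply is_lim_seq_incr_1;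
    (eapply is_lim_seq_ext; [|eassumption]); intros n; simpl; now rewrite <- E1.
Qed.

(** The factor [2] accounts for the two components. *)
Lemma is_cseries_geom (u : nat -> C) (D t : R) :
  0 <= t < 1 -> (forall k, Cmod (u k) <= D * t ^ k) ->
  exists l, is_cseries u l /\ Cmod l <= 2 * (D / (1 - t)).
Proof.
  intros Ht Hu.
  assert (Hg : is_series (fun k => D * t ^ k) (D * / (1 - t))).
  { apply (is_series_scal_l D (fun k => t ^ k) (/ (1 - t))).
    apply is_series_geom. rewrite Rabs_right; lra. }
  assert (aux : forall p : C -> R, (forall z, Rabs (p z) <= Cmod z) ->
    exists s, is_series (fun k => p (u k)) s /\ Rabs s <= D / (1 - t)).
  { intros p Hp.
    assert (Ha : ex_series (fun k => Rabs (p (u k)))).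
    { apply (ex_series_le (K := R_AbsRing) (V := R_CompleteNormedModule) _ (fun k => D * t ^ k)).
      - intros k. change (Rabs (Rabs (p (u k))) <= D * t ^ k). rewrite Rabs_Rabsolu.
        eapply Rle_trans; [apply Hp|apply Hu].
      - eexists; exact Hg. }
    exists (Series (fun k => p (u k))); split.
    - now apply Series_correct, ex_series_Rabs.
    - eapply Rle_trans; [now apply Series_Rabs|].
      unfold Rdiv. rewrite <- (is_series_unique _ _ Hg).
      apply Series_le; [|eexists; exact Hg].
      intros k; split; [apply Rabs_pos|]. eapply Rle_trans; [apply Hp|apply Hu]. }
  destruct (aux Re re_le_Cmod) as [s1 [H1 B1]].
  destruct (aux Im im_le_Cmod) as [s2 [H2 B2]].
  exists (s1, s2); split; [split; assumption|].
  eapply Rle_trans; [apply Cmod_le_sum|]. simpl. lra.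
Qed.

(** * Power series of the Euler-Maclaurin sequence *)

Lemma Cexp_0 : Cexp (RtoC 0) = RtoC 1.
Proof. rewrite Cexp_RtoC, exp_0. reflexivity. Qed.

(** The derivatives in [t] of both components of [Cexp (v t)] are bounded by
    [exp |v t|] as soon as [|v| <= 1], whatever their order; hence the scaling of
    [z] below. *)
Lemma Cexp_series (z : C) : is_cseries (fun k => z ^ k * RtoC (/ INR (fact k)))%C (Cexp z).
Proof.
  (* One more than the modulus, so that the case [z = 0] is covered too. *)
  set (t := Cmod z + 1). assert (Ht : 1 <= t) by (unfold t; pose proof (Cmod_ge_0 z); lra).
  set (v := (z * RtoC (/ t))%C).
  assert (Ez : z = (v * RtoC t)%C).
  { unfold v. rewrite <- Cmult_assoc, <- RtoC_mult, Rinv_l by lra. ring. }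
  assert (Hv : Cmod v <= 1).
  { unfold v. rewrite Cmod_mult, Cmod_R, Rabs_right.
    - apply Rmult_le_reg_r with t; [lra|]. rewrite Rmult_assoc, Rinv_l by lra. unfold t; lra.
    - left; apply Rinv_0_lt_compat; lra. }
  assert (Hd : forall n x, cderiv (fun y => v ^ n * Cexp (v * RtoC y))%C x
                             (v ^ S n * Cexp (v * RtoC x))%C).
  { intros n x. eapply cderiv_val; [|apply cderiv_scal, (cderiv_Cexp v (fun y => y) x 1), @is_derive_id].
    rewrite Cpow_S. ring. }
  assert (Hb : forall n x, Rabs x < t + 1 -> Cmod (v ^ n * Cexp (v * RtoC x)) <= exp (t + 1)).
  { intros n x Hx. rewrite Cmod_mult, Cmod_pow, Cmod_Cexp.
    assert (Cmod v ^ n <= 1).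
    { rewrite <- (pow1 n). apply pow_incr. split; [apply Cmod_ge_0|auto]. }
    assert (exp (Re (v * RtoC x)) <= exp (t + 1)).
    { apply exp_le. eapply Rle_trans; [apply Rle_abs|]. eapply Rle_trans; [apply re_le_Cmod|].
      rewrite Cmod_mult, Cmod_R. pose proof (Cmod_ge_0 v). pose proof (Rabs_pos x). nra. }
    assert (0 <= Cmod v ^ n) by (apply pow_le, Cmod_ge_0).
    pose proof (exp_pos (Re (v * RtoC x))). nra. }
  assert (aux : forall p : C -> R, (forall f x l, cderiv f x l -> is_derive (fun y => p (f y)) x (p l)) ->
     (forall w, Rabs (p w) <= Cmod w) -> (forall w s, p (w * RtoC s)%C = p w * s) ->
     is_series (fun k => p (z ^ k * RtoC (/ INR (fact k)))%C) (p (Cexp z))).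
  { intros p Hp1 Hp2 Hp3.
    set (f := fun y => p (Cexp (v * RtoC y))).
    assert (HD : forall n x, Derive_n f n x = p (v ^ n * Cexp (v * RtoC x))%C).
    { induction n as [|n IH]; intros x.
      - simpl. unfold f. f_equal. ring.
      - simpl. rewrite (Derive_ext _ (fun y => p (v ^ n * Cexp (v * RtoC y))%C)) by exact IH.
        apply is_derive_unique. apply (Hp1 (fun y => v ^ n * Cexp (v * RtoC y))%C). apply Hd. }
    assert (HP := mk_pseries f (exp (t + 1)) (t + 1)).
    specialize (HP ltac:(intros n x Hx; split;
      [destruct n as [|n]; [exact I|simpl;
         apply (ex_derive_ext (fun y => p (v ^ n * Cexp (v * RtoC y))%C));
         [intros; symmetry; apply HD|eexists; apply Hp1; apply Hd]]
      |rewrite HD; eapply Rle_trans; [apply Hp2|now apply Hb]])).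
    specialize (HP t). simpl in HP. rewrite Rabs_right in HP by lra.
    specialize (HP ltac:(lra)). apply is_pseries_R in HP.
    unfold f in HP at 2. rewrite <- Ez in HP. revert HP. apply is_series_ext.
    intros n. rewrite HD.
    replace (z ^ n * RtoC (/ INR (fact n)))%C with (v ^ n * RtoC (t ^ n * / INR (fact n)))%C.
    - rewrite Hp3.
      replace (v * RtoC 0)%C with (RtoC 0) by ring. rewrite Cexp_0, Cmult_1_r.
      unfold Rdiv.
      real_ring.
    - rewrite Ez at 1. rewrite Cpow_mult_l, RtoC_mult, RtoC_pow. ring. }
  split.
  - apply (aux Re); [now intros f x l [Hf _]|apply re_le_Cmod|].
    intros; simpl; unfold Re; ring.
  - apply (aux Im); [now intros f x l [_ Hf]|apply im_le_Cmod|].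
    intros; simpl; unfold Im; ring.
Qed.

Lemma pow_coef_cseries (X : R) (c u : C) :
  is_cseries (fun k => pow_coef X c k * u ^ k)%C (Cexp ((c + u) * RtoC (ln X))).
Proof.
  rewrite Cmult_plus_distr_r, Cexp_plus.
  eapply is_cseries_ext; [|apply is_cseries_scal, (Cexp_series (u * RtoC (ln X)))].
  intros k. unfold pow_coef. simpl. unfold Rdiv.
  rewrite Cpow_mult_l, RtoC_mult, RtoC_pow. ring.
Qed.

Lemma mul_lin_cseries (c : C) (a : nat -> C) (u l : C) :
  is_cseries (fun k => a k * u ^ k)%C l -> is_cseries (fun k => mul_lin c a k * u ^ k)%C ((c + u) * l)%C.
Proof.
  intros Ha. rewrite Cmult_plus_distr_r.
  eapply is_cseries_ext; [|apply is_cseries_plus; [apply is_cseries_scal, Ha|apply is_cseries_shift, is_cseries_scal, Ha]].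
  intros [|k]; unfold mul_lin; simpl; ring.
Qed.

Fixpoint cbinom (x : C) (m : nat) : C :=
  match m with
  | O => RtoC 1
  | S j => (RtoC (/ INR (S j)) * ((x - INR j) * cbinom x j))%C
  end.

Lemma mul_binom_cseries (c : C) (m : nat) (a : nat -> C) (u l : C) :
  is_cseries (fun k => a k * u ^ k)%C l ->
  is_cseries (fun k => mul_binom c m a k * u ^ k)%C (cbinom (c + u) m * l)%C.
Proof.
  intros Ha. induction m as [|m IH].
  - simpl. now rewrite Cmult_1_l.
  - change (cbinom (c + u) (S m)) with (RtoC (/ INR (S m)) * ((c + u - INR m) * cbinom (c + u) m))%C.
    rewrite <- !Cmult_assoc.
    replace (c + u - INR m)%C with (c - INR m + u)%C by ring.
    eapply is_cseries_ext; [|apply is_cseries_scal, (mul_lin_cseries (c - INR m)), IH].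
    intros k. simpl. ring.
Qed.

Definition em_fun (B : nat -> R) (M N : nat) (x : C) : C :=
  ((x + RtoC 1) * csum (fun n => Cexp (x * RtoC (ln (INR (S n))))) N
   - csum (fun i => RtoC (beta B i) *
       (cbinom (x + RtoC 1) i * Cexp ((x + RtoC 1 - INR i) * RtoC (ln (INR N))))) (S M))%C.

Lemma em_coef_cseries (B : nat -> R) (M N : nat) (w u : C) :
  is_cseries (fun k => em_coef B M N w k * u ^ k)%C (em_fun B M N (w + u)).
Proof.
  unfold em_coef, em_fun.
  eapply is_cseries_ext with (u := fun k => (mul_lin (w + RtoC 1) (fun j => csum (fun n => pow_coef (INR (S n)) w j) N) k * u ^ k
     - csum (fun i => RtoC (beta B i) *
            (mul_binom (w + RtoC 1) i (pow_coef (INR N) (w + RtoC 1 - INR i)%C) k * u ^ k)) (S M))%C).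
  { intros k. rewrite (csum_ext (fun i => RtoC (beta B i) * (mul_binom (w + RtoC 1) i (pow_coef (INR N) (w + RtoC 1 - INR i)%C) k * u ^ k))%C
      (fun i => u ^ k * (RtoC (beta B i) * mul_binom (w + RtoC 1) i (pow_coef (INR N) (w + RtoC 1 - INR i)%C) k))%C)
      by (intros; ring).
    rewrite csum_scal. ring. }
  apply is_cseries_minus.
  - replace (w + u + RtoC 1)%C with (w + RtoC 1 + u)%C by ring.
    apply mul_lin_cseries.
    eapply is_cseries_ext; [|apply (is_cseries_csum (fun n k => pow_coef (INR (S n)) w k * u ^ k)%C)].
    + intros k. simpl. rewrite Cmult_comm, <- csum_scal. apply csum_ext; intros; ring.
    + intros i _. apply pow_coef_cseries.
  - apply (is_cseries_csum (fun i k => RtoC (beta B i) *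
            (mul_binom (w + RtoC 1) i (pow_coef (INR N) (w + RtoC 1 - INR i)%C) k * u ^ k))%C).
    intros i _. apply is_cseries_scal.
    replace (w + u + RtoC 1)%C with (w + RtoC 1 + u)%C by ring.
    apply mul_binom_cseries.
    replace (w + RtoC 1 + u - INR i)%C with (w + RtoC 1 - INR i + u)%C by ring.
    apply pow_coef_cseries.
Qed.

(** The coefficientwise error decays like [1/N] uniformly in the degree, after
    weighting by [rho^k], so it can be summed over the degrees inside the disc. *)
Lemma em_fun_limit (B : nat -> R) (M : nat) (w : C) (rho : R) (g : nat -> C) (D : R) :
  0 < rho -> 0 <= D ->
  (forall N, (1 <= N)%nat -> coef_bound (D / INR N ^ 1) rho (fun k => g k - em_coef B M N w k)%C) ->
  forall u, Cmod u < rho ->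
  exists l, is_cseries (fun k => g k * u ^ k)%C l /\ is_clim (fun N => em_fun B M N (w + u)) l.
Proof.
  intros Hr HD Hg u Hu.
  set (t := Cmod u / rho).
  assert (Ht : 0 <= t < 1).
  { unfold t; split.
    - apply Rmult_le_pos; [apply Cmod_ge_0|left; now apply Rinv_0_lt_compat].
    - apply Rmult_lt_reg_r with rho; auto. unfold Rdiv. rewrite Rmult_assoc, Rinv_l by lra. lra. }
  assert (Hser : forall N, (1 <= N)%nat -> exists s,
     is_cseries (fun k => (g k - em_coef B M N w k) * u ^ k)%C s /\ Cmod s <= 2 * (D / INR N ^ 1 / (1 - t))).
  { intros N HN. apply (is_cseries_geom _ _ _ Ht). intros k.
    rewrite Cmod_mult, Cmod_pow. specialize (Hg N HN k). simpl in Hg.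
    unfold t, Rdiv at 2. rewrite Rpow_mult_distr, pow_inv.
    assert (Hp : 0 < rho ^ k) by now apply pow_lt.
    assert (Hu' : 0 <= Cmod u ^ k) by apply pow_le, Cmod_ge_0.
    replace (Cmod (g k - em_coef B M N w k) * Cmod u ^ k)
      with (Cmod (g k - em_coef B M N w k) * rho ^ k * (Cmod u ^ k * / rho ^ k)) by (field; lra).
    apply Rmult_le_compat_r.
    - apply Rmult_le_pos; auto. left; now apply Rinv_0_lt_compat.
    - exact Hg. }
  destruct (Hser 1%nat (le_n _)) as [s1 [Hs1 _]].
  exists (s1 + em_fun B M 1 (w + u))%C.
  assert (HL : is_cseries (fun k => g k * u ^ k)%C (s1 + em_fun B M 1 (w + u))%C).
  { eapply is_cseries_ext; [|apply is_cseries_plus; [exact Hs1|apply (em_coef_cseries B M 1 w u)]].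
    intros k; simpl; ring. }
  split; auto.
  apply is_clim_Cmod.
  apply is_lim_seq_le_le_loc with (fun _ => 0) (fun n => (2 * D / (1 - t)) * / INR n).
  - exists 1%nat. intros N HN. split; [apply Cmod_ge_0|].
    destruct (Hser N HN) as [s [Hs Bs]].
    assert (Es : s = (s1 + em_fun B M 1 (w + u) - em_fun B M N (w + u))%C).
    { eapply is_cseries_unique; [exact Hs|].
      eapply is_cseries_ext; [|apply is_cseries_minus; [exact HL|apply (em_coef_cseries B M N w u)]].
      intros k; simpl; ring. }
    rewrite <- Cmod_opp.
    replace (- (em_fun B M N (w + u) - (s1 + em_fun B M 1 (w + u))))%C with s by (rewrite Es; ring).
    eapply Rle_trans; [exact Bs|]. right.
    assert (0 < INR N) by (apply lt_0_INR; lia). simpl. field. lra.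
  - apply is_lim_seq_const.
  - replace (Finite 0) with (Rbar_mult (2 * D / (1 - t)) (Rbar_inv p_infty))
      by (simpl; f_equal; ring).
    apply is_lim_seq_scal_l. apply is_lim_seq_inv; [apply is_lim_seq_INR|discriminate].
Qed.

Lemma is_lim_seq_ln : is_lim_seq (fun n => ln (INR n)) p_infty.
Proof.
  apply (is_lim_comp_seq ln INR p_infty p_infty is_lim_ln_p).
  - exists 0%nat. intros; discriminate.
  - apply is_lim_seq_INR.
Qed.

Lemma is_lim_seq_exp_neg (s : R) : s < 0 -> is_lim_seq (fun n => exp (s * ln (INR n))) 0.
Proof.
  intros Hs.
  apply (is_lim_comp_seq exp (fun n => s * ln (INR n)) m_infty 0 is_lim_exp_m).
  - exists 0%nat. intros; discriminate.
  - replace m_infty with (Rbar_mult s p_infty).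
    + apply is_lim_seq_scal_l, is_lim_seq_ln.
    + simpl. destruct (Rle_dec 0 s) as [Hle|]; [exfalso; lra|reflexivity].
Qed.

(** Every correction term is a constant times [N^(x+1-i)] and [Re (x+1-i) < 0]. *)
Lemma em_fun_dirichlet (B : nat -> R) (M : nat) (x l : C) :
  Re x < - 1 ->
  @is_series C_AbsRing C_NormedModule (fun n => Cexp (x * RtoC (ln (INR (S n))))%C) l ->
  is_clim (fun N => em_fun B M N x) ((x + RtoC 1) * l)%C.
Proof.
  intros Hx Hl. apply is_series_clim in Hl.
  replace ((x + RtoC 1) * l)%C with ((x + RtoC 1) * l - csum (fun _ => RtoC 0) (S M))%C
    by (rewrite csum_0 by auto; ring).
  apply is_clim_minus; [now apply is_clim_scal|].
  apply (is_clim_csum (fun i N => RtoC (beta B i) *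
       (cbinom (x + RtoC 1) i * Cexp ((x + RtoC 1 - INR i) * RtoC (ln (INR N)))))%C).
  intros i _.
  replace (RtoC 0) with (RtoC (beta B i) * (cbinom (x + RtoC 1) i * RtoC 0))%C by ring.
  apply is_clim_scal, is_clim_scal, is_clim_Cmod.
  apply is_lim_seq_ext with (fun N => exp ((Re x + 1 - INR i) * ln (INR N))).
  - intros N. replace (Cexp ((x + 1 - INR i) * ln (INR N)) - 0)%C
      with (Cexp ((x + 1 - INR i) * ln (INR N))) by ring.
    rewrite Cmod_Cexp. f_equal. simpl. unfold Re. ring.
  - apply is_lim_seq_exp_neg. pose proof (pos_INR i). lra.
Qed.

(** * Uniqueness of power series coefficients *)

Lemma CV_radius_gt (a : nat -> R) (x y l : R) :
  0 <= y < x -> is_series (fun n => a n * x ^ n) l -> Rbar_lt y (CV_radius a).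
Proof.
  intros Hx Hl. destruct (Rbar_lt_le_dec y (CV_radius a)) as [Hlt|Hle]; auto. exfalso.
  apply (CV_disk_outside a x).
  - apply Rbar_le_lt_trans with y; auto. simpl. rewrite Rabs_right; lra.
  - apply ex_series_lim_0. eexists; exact Hl.
Qed.

Lemma is_lim_seq_inv_INR : is_lim_seq (fun n => / INR n) 0.
Proof.
  change (Finite 0) with (Rbar_inv p_infty).
  apply is_lim_seq_inv; [apply is_lim_seq_INR|discriminate].
Qed.

(** By continuity of the sum at the centre. *)
Lemma pseries_zero_0 (a : nat -> R) (eps : R) :
  0 < eps -> (forall x, 0 < x < eps -> is_series (fun n => a n * x ^ n) 0) ->
  a 0%nat = 0.
Proof.
  intros He Ha.
  assert (Hr : Rbar_lt 0 (CV_radius a)).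
  { apply (CV_radius_gt a (eps / 2) 0 0); [lra|]. apply Ha; lra. }
  assert (Hc : continuity_pt (PSeries a) 0).
  { apply PSeries_continuity. now rewrite Rabs_R0. }
  assert (Hs : is_lim_seq (fun n => eps / 2 * / INR (S n)) 0).
  { replace (Finite 0) with (Rbar_mult (eps / 2) 0) by (simpl; f_equal; ring).
    apply is_lim_seq_scal_l. apply (is_lim_seq_incr_1 (fun n => / INR n)), is_lim_seq_inv_INR. }
  apply (is_lim_seq_continuous _ _ _ Hc) in Hs.
  rewrite PSeries_0 in Hs.
  apply (is_lim_seq_ext _ (fun _ => 0)) in Hs.
  - apply is_lim_seq_unique in Hs. rewrite Lim_seq_const in Hs. injection Hs; auto.
  - intros k. apply is_pseries_unique, is_pseries_R, Ha.
    assert (1 <= INR (S k)) by (apply (le_INR 1); lia).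
    assert (0 < / INR (S k)) by (apply Rinv_0_lt_compat; lra).
    assert (/ INR (S k) <= 1) by (rewrite <- Rinv_1; apply Rinv_le_contravar; lra).
    split; nra.
Qed.

(** Zeros on one side of the centre suffice, so that the identity theorem can be run
    along a path. *)
Lemma pseries_zero (a : nat -> R) (eps : R) :
  0 < eps -> (forall x, 0 < x < eps -> is_series (fun n => a n * x ^ n) 0) ->
  forall n, a n = 0.
Proof.
  intros He Ha n. revert a Ha. induction n as [|n IH]; intros a Ha.
  - now apply pseries_zero_0 with eps.
  - apply (IH (fun k => a (S k))). intros x Hx.
    assert (H0 := pseries_zero_0 a eps He Ha).
    specialize (Ha x Hx). apply is_pseries_R in Ha.
    apply (is_pseries_decr_1 a x (/ x)) in Ha.
    + apply is_pseries_R in Ha. rewrite H0 in Ha.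
      match type of Ha with is_series _ ?l => assert (El : l = 0) end.
      { change (/ x * (0 + - 0) = 0). ring. }
      rewrite El in Ha. exact Ha.
    + change (/ x * x = 1). field. lra.
Qed.

(** Zeros on a ray from the centre reduce to the real case after absorbing the
    direction [d] of the ray into the coefficients. *)
Lemma cseries_zero (c : nat -> C) (d : C) (eps : R) :
  d <> RtoC 0 -> 0 < eps ->
  (forall x, 0 < x < eps -> is_cseries (fun k => c k * (d * RtoC x) ^ k)%C (RtoC 0)) ->
  forall k, c k = RtoC 0.
Proof.
  intros Hd He Hc k.
  assert (E0 : (c k * d ^ k)%C = RtoC 0).
  { assert (Hx : forall x n, (c n * (d * RtoC x) ^ n)%C = (c n * d ^ n * RtoC (x ^ n))%C).
    { intros x n. rewrite Cpow_mult_l, RtoC_pow. ring. }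
    apply C_eq.
    - apply (pseries_zero (fun n => Re (c n * d ^ n)%C) eps He).
      intros x Hxe. destruct (Hc x Hxe) as [H1 _].
      eapply is_series_ext; [|exact H1]. intros n. cbv beta. rewrite Hx. simpl. unfold Re.
      simpl; real_ring.
    - apply (pseries_zero (fun n => Im (c n * d ^ n)%C) eps He).
      intros x Hxe. destruct (Hc x Hxe) as [_ H1].
      eapply is_series_ext; [|exact H1]. intros n. cbv beta. rewrite Hx. simpl. unfold Im.
      simpl; real_ring. }
  assert (Hn := Cpow_nz d k Hd).
  replace (c k) with (c k * d ^ k * / d ^ k)%C by (field; auto).
  rewrite E0. ring.
Qed.

(** * Analytic continuation of the zeta function *)

Lemma pow_n_Cpow (z : C) (k : nat) : pow_n (K := C_Ring) z k = (z ^ k)%C.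
Proof. induction k as [|k IH]; [reflexivity|]. simpl. rewrite IH. reflexivity. Qed.

Lemma analytic_cseries (f : C -> C) (z0 : C) :
  analytic_at f z0 ->
  exists (a : nat -> C) (rho : R), 0 < rho /\
    forall v, Cmod v < rho -> is_cseries (fun k => a k * v ^ k)%C (f (z0 + v)%C).
Proof.
  intros (a & rho & Hr & Ha). exists a, rho; split; auto. intros v Hv.
  specialize (Ha (z0 + v)%C). replace (z0 + v - z0)%C with v in Ha by ring.
  specialize (Ha Hv). apply is_clim_cseries, is_series_clim.
  eapply is_series_ext; [|exact Ha]. intros n. simpl.
  rewrite pow_n_Cpow. apply Cmult_comm.
Qed.

(** On the real axis the real part of the function is the real power series whose
    coefficients are the [Re (a k)]; its derivative at [0] is the coefficient of degree [1]. *)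
Lemma Re_C_derive (f : C -> C) (x0 rho : R) (a : nat -> C) :
  0 < rho ->
  (forall v, Cmod v < rho -> is_cseries (fun k => a k * v ^ k)%C (f (RtoC x0 + v)%C)) ->
  Re (C_derive f (RtoC x0)) = Re (a 1%nat).
Proof.
  intros Hr Ha.
  set (b := fun k => Re (a k)).
  assert (Hb : forall t, Rabs t < rho -> is_series (fun k => b k * t ^ k) (Re (f (RtoC (x0 + t))))).
  { intros t Ht. specialize (Ha (RtoC t)). rewrite Cmod_R in Ha. destruct (Ha Ht) as [H1 _].
    rewrite <- RtoC_plus in H1. eapply is_series_ext; [|exact H1].
    intros n. simpl. rewrite <- RtoC_pow. unfold b. simpl. unfold Re.
    real_ring. }
  assert (Hcv : Rbar_lt 0 (CV_radius b)).
  { apply (CV_radius_gt b (rho / 2) 0 (Re (f (RtoC (x0 + rho / 2))))); [lra|].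
    apply Hb. rewrite Rabs_right; lra. }
  assert (HD : is_derive (PSeries b) 0 (b 1%nat)).
  { replace (b 1%nat) with (PSeries (PS_derive b) 0).
    - apply is_derive_PSeries. now rewrite Rabs_R0.
    - rewrite PSeries_0. unfold PS_derive. simpl. ring. }
  apply is_derive_Reals in HD.
  assert (HP : forall t, Rabs t < rho -> PSeries b t = Re (f (RtoC (x0 + t)))).
  { intros t Ht. now apply is_pseries_unique, is_pseries_R, Hb. }
  unfold C_derive, C_lim. simpl.
  change (real (Lim (fun x => Re ((f (RtoC x) - f (RtoC x0)) / (RtoC x - RtoC x0))%C) x0) = b 1%nat).
  rewrite (is_lim_unique _ x0 (b 1%nat)); [reflexivity|].
  apply is_lim_spec. intros eps.
  destruct (HD eps (cond_pos eps)) as [del Hdel].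
  assert (Hm : 0 < Rmin del rho) by (apply Rmin_pos; [apply cond_pos|auto]).
  exists (mkposreal _ Hm). intros y Hy Hne. change R in y.
  assert (Hy' : Rabs (y - x0) < Rmin del rho) by exact Hy.
  specialize (Hdel (y - x0)).
  rewrite Rplus_0_l in Hdel. rewrite !HP in Hdel.
  - replace (x0 + (y - x0)) with y in Hdel by ring. rewrite Rplus_0_r in Hdel.
    replace (Re ((f (RtoC y) - f (RtoC x0)) / (RtoC y - RtoC x0))%C)
      with ((Re (f (RtoC y)) - Re (f (RtoC x0))) / (y - x0)).
    + apply Hdel; [lra|]. eapply Rlt_le_trans; [exact Hy'|apply Rmin_l].
    + rewrite <- RtoC_minus. unfold Cdiv. rewrite <- RtoC_inv by lra.
      simpl. unfold Re. field. lra.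
  - rewrite Rabs_R0; lra.
  - eapply Rlt_le_trans; [exact Hy'|apply Rmin_r].
Qed.

Section Continuation.

Variables (B : nat -> R) (zeta : C -> C) (r M : nat).
Hypothesis Hrec : bern_rec B.
Hypothesis Hzeta : is_riemann_zeta zeta.
Hypothesis HM : (r + 3 <= M)%nat.

(** The factor [x + 1] is the one in front of the Dirichlet sum in [em_fun]; it makes all
    the corrections entire in [x]. *)
Definition refl_zeta (x : C) : C := ((x + RtoC 1) * zeta (- x))%C.

Lemma refl_zeta_analytic (x : C) (a : nat -> C) (rho : R) :
  (forall v, Cmod v < rho -> is_cseries (fun k => a k * v ^ k)%C (zeta (- x + v)%C)) ->
  forall u, Cmod u < rho ->
  is_cseries (fun k => mul_lin (x + RtoC 1) (fun j => (- RtoC 1) ^ j * a j)%C k * u ^ k)%C (refl_zeta (x + u)).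
Proof.
  intros Ha u Hu. unfold refl_zeta.
  replace (x + u + RtoC 1)%C with (x + RtoC 1 + u)%C by ring.
  apply mul_lin_cseries. specialize (Ha (- u)%C). rewrite Cmod_opp in Ha.
  replace (- (x + u))%C with (- x + - u)%C by ring.
  eapply is_cseries_ext; [|exact (Ha Hu)].
  intros k. simpl. replace (- u)%C with (- RtoC 1 * u)%C by ring.
  rewrite Cpow_mult_l. ring.
Qed.

(** The identity theorem at one centre [x]: the limit of the Euler-Maclaurin functions
    and the reflected zeta function are both sums of power series around [x]; if they
    agree on a ray ending at [x] then they have the same coefficients, hence agree on a
    whole disc. *)
Lemma continuation_step (x d : C) (a : nat -> C) (rho del : R) :
  0 < rho ->
  (forall u, Cmod u < rho -> is_cseries (fun k => a k * u ^ k)%C (refl_zeta (x + u))) ->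
  Re x <= INR r -> d <> RtoC 0 -> 0 < del ->
  (forall t, 0 < t < del ->
     is_clim (fun N => em_fun B M N (x + d * RtoC t)) (refl_zeta (x + d * RtoC t))) ->
  (forall k, is_clim (fun N => em_coef B M N x k) (a k)) /\
  exists eps, 0 < eps /\ forall u, Cmod u < eps ->
     is_clim (fun N => em_fun B M N (x + u)) (refl_zeta (x + u)).
Proof.
  intros Hr Ha Hx Hd Hdel Hz.
  assert (HMr : INR r + 3 <= INR M).
  { replace (INR r + 3) with (INR (r + 3)) by (rewrite plus_INR; simpl; ring). now apply le_INR. }
  destruct (em_coef_limit B M 0 x 1 Hrec ltac:(lia) Rlt_0_1 ltac:(simpl; lra)) as (g & D & HD & Hg).
  assert (Hgl := em_fun_limit B M x 1 g D Rlt_0_1 HD Hg).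
  assert (Hdp : 0 < Cmod d) by now apply Cmod_gt_0.
  assert (Hrm : 0 < Rmin rho 1) by (apply Rmin_pos; lra).
  assert (Heq : forall k, a k = g k).
  { assert (H0 : forall k, (a k - g k)%C = RtoC 0).
    { apply (cseries_zero (fun k => a k - g k)%C d (Rmin del (Rmin rho 1 / Cmod d))); auto.
      - apply Rmin_pos; auto. now apply Rdiv_lt_0_compat.
      - intros t [Ht1 Ht2].
        assert (Hm : Cmod (d * RtoC t) < Rmin rho 1).
        { rewrite Cmod_mult, Cmod_R, Rabs_right by lra.
          assert (t < Rmin rho 1 / Cmod d) by (eapply Rlt_le_trans; [exact Ht2|apply Rmin_r]).
          apply (Rmult_lt_compat_l (Cmod d)) in H; auto.
          replace (Cmod d * (Rmin rho 1 / Cmod d)) with (Rmin rho 1) in H by (field; lra). exact H. }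
        destruct (Hgl (d * RtoC t)%C) as [l [Hl1 Hl2]].
        { eapply Rlt_le_trans; [exact Hm|apply Rmin_r]. }
        assert (El : l = refl_zeta (x + d * RtoC t)).
        { eapply is_clim_unique; [exact Hl2|]. apply Hz. split; auto.
          eapply Rlt_le_trans; [exact Ht2|apply Rmin_l]. }
        replace (RtoC 0) with (refl_zeta (x + d * RtoC t) - l)%C by (rewrite El; ring).
        eapply is_cseries_ext; [|apply is_cseries_minus; [apply Ha|exact Hl1]].
        + intros k; simpl; ring.
        + eapply Rlt_le_trans; [exact Hm|apply Rmin_l]. }
    intros k. replace (a k) with (a k - g k + g k)%C by ring. rewrite H0. ring. }
  split.
  - intros k. rewrite Heq. apply is_clim_Cmod.
    apply is_lim_seq_le_le_loc with (fun _ => 0) (fun n => D * / INR n).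
    + exists 1%nat. intros N HN. split; [apply Cmod_ge_0|].
      specialize (Hg N HN k). simpl in Hg. rewrite pow1, !Rmult_1_r in Hg.
      rewrite <- Cmod_opp.
      replace (- (em_coef B M N x k - g k))%C with (g k - em_coef B M N x k)%C by ring. exact Hg.
    + apply is_lim_seq_const.
    + replace (Finite 0) with (Rbar_mult D 0) by (simpl; f_equal; ring).
      apply is_lim_seq_scal_l, is_lim_seq_inv_INR.
  - exists (Rmin rho 1); split; auto. intros u Hu.
    destruct (Hgl u) as [l [Hl1 Hl2]].
    { eapply Rlt_le_trans; [exact Hu|apply Rmin_r]. }
    replace (refl_zeta (x + u)) with l; auto.
    eapply is_cseries_unique; [exact Hl1|].
    eapply is_cseries_ext; [|apply Ha].
    + intros k; simpl; now rewrite Heq.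
    + eapply Rlt_le_trans; [exact Hu|apply Rmin_l].
Qed.

(** The segment from [-2 + i] to [r] avoids [-1], the reflected pole. *)
Definition path_dir : C := (INR r + 2, - 1).
Definition path (t : R) : C := ((- 2, 1) + path_dir * RtoC t)%C.

Lemma Re_path (t : R) : Re (path t) = - 2 + (INR r + 2) * t.
Proof. unfold path, path_dir. simpl. ring. Qed.

Lemma Im_path (t : R) : Im (path t) = 1 - t.
Proof. unfold path, path_dir. simpl. ring. Qed.

Lemma path_1 : path 1 = RtoC (INR r).
Proof. apply C_eq; rewrite ?Re_path, ?Im_path; simpl; ring. Qed.

Lemma path_pole (t : R) : t <= 1 -> (- path t)%C <> RtoC 1.
Proof.
  intros Ht E.
  assert (E1 : Re (path t) = - 1).
  { replace (path t) with (- - path t)%C by ring. rewrite E. simpl. ring. }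
  assert (E2 : Im (path t) = 0).
  { replace (path t) with (- - path t)%C by ring. rewrite E. simpl. ring. }
  rewrite Re_path in E1. rewrite Im_path in E2.
  pose proof (pos_INR r). replace t with 1 in E1 by lra. lra.
Qed.

Lemma path_dir_neq : path_dir <> RtoC 0.
Proof. intros E. injection E. intros. lra. Qed.

Definition agrees (t : R) : Prop :=
  is_clim (fun N => em_fun B M N (path t)) (refl_zeta (path t)).

Lemma agrees_start (t : R) : t < / (INR r + 2) -> agrees t.
Proof.
  intros Ht. assert (Hr := pos_INR r).
  assert (Hre : Re (path t) < - 1).
  { rewrite Re_path. apply (Rmult_lt_compat_l (INR r + 2)) in Ht; [|lra].
    rewrite Rinv_r in Ht; lra. }
  apply em_fun_dirichlet; auto.
  assert (Hd := proj1 Hzeta (- path t)%C ltac:(simpl in *; unfold Re in *; lra)).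
  eapply is_series_ext; [|exact Hd]. intros n. simpl. f_equal. ring.
Qed.

(** The ray used at [path t] points backwards, along the part of the path where
    agreement is already known. *)
Lemma agrees_step (t : R) :
  0 < t <= 1 -> (forall s, 0 <= s < t -> agrees s) ->
  exists eps, 0 < eps /\ forall s, Rabs (s - t) < eps -> agrees s.
Proof.
  intros Ht Hs.
  destruct (analytic_cseries zeta (- path t)%C (proj2 Hzeta _ (path_pole t (proj2 Ht))))
    as (a & rho & Hr & Ha).
  assert (Hf := refl_zeta_analytic _ _ _ Ha).
  assert (HX : forall s, path s = (path t + - path_dir * RtoC (t - s))%C).
  { intros s. unfold path. rewrite RtoC_minus. ring. }
  destruct (continuation_step (path t) (- path_dir)%C _ rho t Hr Hf) as [_ [eps [He Hz]]].
  - rewrite Re_path. pose proof (pos_INR r). nra.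
  - intros E. apply path_dir_neq. replace path_dir with (- - path_dir)%C by ring. rewrite E. ring.
  - lra.
  - intros s Hst. replace (path t + - path_dir * RtoC s)%C with (path (t - s)).
    + apply Hs; lra.
    + rewrite HX. do 3 f_equal. ring.
  - assert (Hdp : 0 < Cmod path_dir) by apply Cmod_gt_0, path_dir_neq.
    exists (eps / Cmod path_dir); split; [now apply Rdiv_lt_0_compat|].
    intros s Hst. unfold agrees. rewrite HX. apply Hz.
    rewrite Cmod_mult, Cmod_opp, Cmod_R, Rabs_minus_sym.
    apply (Rmult_lt_compat_l (Cmod path_dir)) in Hst; auto.
    replace (Cmod path_dir * (eps / Cmod path_dir)) with eps in Hst by (field; lra). exact Hst.
Qed.

(** Let [m] be the supremum of the parameters up to which agreement holds; if [m < 1],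
    a step at [m] pushes agreement beyond [m]. *)
Lemma agrees_all (t : R) : 0 <= t < 1 -> agrees t.
Proof.
  assert (Hr := pos_INR r).
  (* [/ (r + 2)] is where the path crosses the line [Re x = -1]. *)
  set (P := fun t => 0 <= t <= 1 /\ forall s, 0 <= s <= t -> agrees s).
  assert (H0 : P (/ (INR r + 2) / 2)).
  { assert (0 < / (INR r + 2)) by (apply Rinv_0_lt_compat; lra).
    assert (/ (INR r + 2) <= / 2) by (apply Rinv_le_contravar; lra).
    split; [lra|]. intros s Hs. apply agrees_start. lra. }
  destruct (completeness P) as [m [Hub Hlub]].
  { exists 1. intros s [Hs _]. lra. }
  { eexists; exact H0. }
  assert (Hm0 : 0 < m).
  { specialize (Hub _ H0). assert (0 < / (INR r + 2)) by (apply Rinv_0_lt_compat; lra). lra. }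
  assert (Hm1 : m <= 1) by (apply Hlub; intros s [Hs _]; lra).
  assert (Hlt : forall s, 0 <= s < m -> agrees s).
  { intros s Hs. apply NNPP; intros Hn.
    assert (Hb : is_upper_bound P s).
    { intros x [Hx1 Hx2]. destruct (Rle_lt_dec x s) as [|Hl]; auto.
      exfalso. apply Hn, Hx2. lra. }
    specialize (Hlub s Hb). lra. }
  intros Ht. destruct (Rlt_le_dec t m) as [|Hmt]; [apply Hlt; lra|].
  exfalso.
  destruct (agrees_step m (conj Hm0 Hm1) Hlt) as [eps [He Hz]].
  set (m' := Rmin 1 (m + eps / 2)).
  assert (Hm' : P m').
  { assert (m' <= 1) by apply Rmin_l. assert (m' <= m + eps / 2) by apply Rmin_r.
    split.
    - split; auto. unfold m'. apply Rmin_glb; lra.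
    - intros s Hs. destruct (Rlt_le_dec s m) as [|Hl]; [apply Hlt; lra|].
      apply Hz. rewrite Rabs_right; lra. }
  apply Hub in Hm'. unfold m' in Hm'. revert Hm'.
  apply Rmin_case_strong; lra.
Qed.

(** At the end point [r] of the path. With [zeta(-r+v) = z0 + z1 v + ...], the expansion
    of [(x+1) zeta(-x)] at [x = r+u] begins with [(r+1) z0 + (z0 - (r+1) z1) u]. *)
Lemma em_coef_clim :
  exists z0 z1 : C, Re z0 = zeta_neg zeta r /\ Re z1 = dzeta_neg zeta r /\
    is_clim (fun N => em_coef B M N (RtoC (INR r)) 0) ((INR r + 1) * z0)%C /\
    is_clim (fun N => em_coef B M N (RtoC (INR r)) 1) (z0 - (INR r + 1) * z1)%C.
Proof.
  destruct (analytic_cseries zeta (- path 1)%C (proj2 Hzeta _ (path_pole 1 (Rle_refl 1))))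
    as (a & rho & Hr & Ha).
  assert (Hf := refl_zeta_analytic _ _ _ Ha).
  destruct (continuation_step (path 1) (- path_dir)%C _ rho 1 Hr Hf) as [Hc _].
  - rewrite Re_path. lra.
  - intros E. apply path_dir_neq. replace path_dir with (- - path_dir)%C by ring. rewrite E. ring.
  - lra.
  - intros s Hs. replace (path 1 + - path_dir * RtoC s)%C with (path (1 - s)).
    + apply agrees_all; lra.
    + unfold path. rewrite RtoC_minus. ring.
  - rewrite path_1 in Hc, Ha.
    assert (Em : (- RtoC (INR r))%C = RtoC (- INR r)) by now rewrite RtoC_opp.
    rewrite Em in Ha.
    exists (a 0%nat), (a 1%nat). repeat split.
    + unfold zeta_neg.
      assert (H0 : is_cseries (fun k => a k * (RtoC 0) ^ k)%C (zeta (RtoC (- INR r)))).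
      { replace (RtoC (- INR r)) with (RtoC (- INR r) + RtoC 0)%C by ring.
        apply Ha. rewrite Cmod_0. exact Hr. }
      f_equal. eapply is_cseries_unique; [|exact H0].
      apply is_clim_cseries.
      assert (E1 : forall n, csum (fun k => a k * (RtoC 0) ^ k)%C (S n) = a 0%nat).
      { induction n as [|n IH]; [simpl; ring|].
        change (csum ?f (S (S n))) with (csum f (S n) + f (S n))%C. rewrite IH. simpl. ring. }
      split; apply is_lim_seq_incr_1; (eapply is_lim_seq_ext; [|apply is_lim_seq_const]);
        intros n; now rewrite E1.
    + symmetry. exact (Re_C_derive zeta (- INR r) rho a Hr Ha).
    + assert (H0 := proj1 (Hc 0%nat)). unfold mul_lin in H0. simpl in H0. revert H0.
      match goal with |- is_lim_seq ?u (Finite ?x) -> is_lim_seq ?v (Finite ?y) =>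
        replace y with x; [exact (fun h => h)|simpl; ring] end.
    + assert (H0 := proj2 (Hc 0%nat)). unfold mul_lin in H0. simpl in H0. revert H0.
      match goal with |- is_lim_seq ?u (Finite ?x) -> is_lim_seq ?v (Finite ?y) =>
        replace y with x; [exact (fun h => h)|simpl; ring] end.
    + assert (H0 := proj1 (Hc 1%nat)). unfold mul_lin in H0. simpl in H0. revert H0.
      match goal with |- is_lim_seq ?u (Finite ?x) -> is_lim_seq ?v (Finite ?y) =>
        replace y with x; [exact (fun h => h)|simpl; unfold Re, Im; ring] end.
    + assert (H0 := proj2 (Hc 1%nat)). unfold mul_lin in H0. simpl in H0. revert H0.
      match goal with |- is_lim_seq ?u (Finite ?x) -> is_lim_seq ?v (Finite ?y) =>
        replace y with x; [exact (fun h => h)|simpl; unfold Re, Im; ring] end.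
Qed.

End Continuation.

Lemma em_coef_zeta (B : nat -> R) (zeta : C -> C) (r q M : nat) :
  bern_rec B -> is_riemann_zeta zeta -> (r + q + 3 <= M)%nat ->
  exists D, 0 <= D /\ forall N, (1 <= N)%nat ->
    Rabs ((INR r + 1) * zeta_neg zeta r - Re (em_coef B M N (RtoC (INR r)) 0)) <= D / INR N ^ S q /\
    Rabs (zeta_neg zeta r - (INR r + 1) * dzeta_neg zeta r - Re (em_coef B M N (RtoC (INR r)) 1))
      <= D / INR N ^ S q.
Proof.
  intros Hrec Hz HM.
  assert (HMr : INR r + INR q + 3 <= INR M).
  { replace (INR r + INR q + 3) with (INR (r + q + 3)) by (rewrite !plus_INR; simpl; ring).
    now apply le_INR. }
  destruct (em_coef_limit B M q (RtoC (INR r)) 1 Hrec ltac:(lia) Rlt_0_1 ltac:(simpl; lra))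
    as (g & D & HD & Hg).
  assert (Hgl : forall k, is_clim (fun N => em_coef B M N (RtoC (INR r)) k) (g k)).
  { intros k. apply is_clim_Cmod.
    apply is_lim_seq_le_le_loc with (fun _ => 0) (fun n => D * / INR n).
    - exists 1%nat. intros N HN. split; [apply Cmod_ge_0|].
      specialize (Hg N HN k). cbv beta in Hg. rewrite pow1, !Rmult_1_r in Hg.
      rewrite <- Cmod_opp.
      replace (- (em_coef B M N (RtoC (INR r)) k - g k))%C with (g k - em_coef B M N (RtoC (INR r)) k)%C by ring.
      eapply Rle_trans; [exact Hg|]. apply Rmult_le_compat_l; auto.
      assert (1 <= INR N) by now apply (le_INR 1).
      apply Rinv_le_contravar; [lra|]. rewrite <- tech_pow_Rmult.
      assert (1 <= INR N ^ q) by (apply pow_R1_Rle; lra). nra.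
    - apply is_lim_seq_const.
    - replace (Finite 0) with (Rbar_mult D 0) by (simpl; f_equal; ring).
      apply is_lim_seq_scal_l, is_lim_seq_inv_INR. }
  destruct (em_coef_clim B zeta r M Hrec Hz ltac:(lia)) as (z0 & z1 & E0 & E1 & L0 & L1).
  assert (G0 := is_clim_unique _ _ _ (Hgl 0%nat) L0).
  assert (G1 := is_clim_unique _ _ _ (Hgl 1%nat) L1).
  exists D; split; auto. intros N HN. rewrite <- E0, <- E1. split.
  - specialize (Hg N HN 0%nat). cbv beta in Hg. rewrite pow1, !Rmult_1_r in Hg.
    eapply Rle_trans; [|exact Hg]. rewrite G0.
    eapply Rle_trans; [|apply re_le_Cmod]. right. f_equal. simpl. unfold Re. ring.
  - specialize (Hg N HN 1%nat). cbv beta in Hg. rewrite pow1, !Rmult_1_r in Hg.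
    eapply Rle_trans; [|exact Hg]. rewrite G1.
    eapply Rle_trans; [|apply re_le_Cmod]. right. f_equal. simpl. unfold Re. ring.
Qed.

(** * Bernoulli numbers *)

Lemma exp_neq_1 (z : R) : z <> 0 -> exp z - 1 <> 0.
Proof.
  intros Hz E. apply Hz, exp_inv. rewrite exp_0. lra.
Qed.

Lemma is_series_val (a : nat -> R) (l l' : R) : is_series a l -> l = l' -> is_series a l'.
Proof. now intros Ha <-. Qed.

Lemma is_series_delta (m : nat) (x : R) :
  is_series (fun k => (if Nat.eqb k m then 1 else 0) * x ^ k) (x ^ m).
Proof.
  assert (Hs : forall n, sum_n (fun k => (if Nat.eqb k m then 1 else 0) * x ^ k) n =
                 if Nat.leb m n then x ^ m else 0).
  { induction n as [|n IH].
    - rewrite sum_O. destruct m as [|m]; simpl; real_ring.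
    - rewrite sum_Sn, IH. change (plus ?a ?b) with (a + b).
      destruct (Nat.eqb_spec (S n) m) as [<-|Hn].
      + replace (S n <=? n) with false by (symmetry; apply Nat.leb_gt; lia).
        rewrite Nat.leb_refl. real_ring.
      + destruct (Nat.leb_spec m n); destruct (Nat.leb_spec m (S n)); try lia; real_ring. }
  change (is_lim_seq (sum_n (fun k => (if Nat.eqb k m then 1 else 0) * x ^ k)) (x ^ m)).
  apply is_lim_seq_ext_loc with (fun _ => x ^ m); [|apply is_lim_seq_const].
  exists m. intros n Hn. rewrite Hs. apply Nat.leb_le in Hn. now rewrite Hn.
Qed.

(** Cauchy product of the series of [z/(e^z-1)] with that of [(e^z-1)/z]. *)
Lemma bernoulli_rec (B : nat -> R) : is_bernoulli B -> bern_rec B.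
Proof.
  intros (rho & Hr & Hb).
  set (b := fun m => B m / INR (fact m)).
  set (e := fun k => / INR (fact (S k))).
  assert (Hbs : forall x, 0 < x < rho -> is_series (fun k => b k * x ^ k) (x / (exp x - 1))).
  { intros x Hx. apply is_pseries_R, Hb. rewrite Rabs_right; lra. }
  assert (Hes : forall x, 0 < x -> is_series (fun k => e k * x ^ k) ((exp x - 1) / x)).
  { intros x Hx. assert (He := is_exp_Reals x). 
    apply (is_pseries_decr_1 (V := R_NormedModule) _ x (/ x)) in He.
    - apply is_pseries_R in He.
      match type of He with is_series _ ?l => assert (El : l = (exp x - 1) / x) end.
      { change (/ x * (exp x + - / INR (fact 0)) = (exp x - 1) / x). simpl. field. lra. }
      rewrite El in He. exact He.
    - change (/ x * x = 1). field. lra. }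
  assert (Hz : forall n, PS_mult b e n - (if Nat.eqb n 0 then 1 else 0) = 0).
  { apply (pseries_zero (fun n => PS_mult b e n - (if Nat.eqb n 0 then 1 else 0)) rho Hr).
    intros x Hx.
    assert (Hm : is_pseries (PS_mult b e) x (x / (exp x - 1) * ((exp x - 1) / x))).
    { apply is_pseries_mult.
      - apply is_pseries_R, Hbs; auto.
      - apply is_pseries_R, Hes; lra.
      - rewrite Rabs_right by lra.
        apply (CV_radius_gt b ((x + rho) / 2) x _ ltac:(lra) (Hbs ((x + rho) / 2) ltac:(lra))).
      - rewrite Rabs_right by lra.
        apply (CV_radius_gt e (x + 1) x _ ltac:(lra) (Hes (x + 1) ltac:(lra))). }
    apply is_pseries_R in Hm.
    apply is_series_val with (x / (exp x - 1) * ((exp x - 1) / x) - x ^ 0).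
    - eapply is_series_ext; [|apply (is_series_minus _ _ _ _ Hm (is_series_delta 0 x))].
      intros n.
      match goal with |- ?a = ?b => change (@eq R a b) end.
      change (PS_mult b e n * x ^ n - (if Nat.eqb n 0 then 1 else 0) * x ^ n =
        (PS_mult b e n - (if Nat.eqb n 0 then 1 else 0)) * x ^ n). ring.
    - simpl. field. split; [lra|]. apply exp_neq_1; lra. }
  intros [|q]; [reflexivity|].
  specialize (Hz q). unfold PS_mult in Hz. rewrite <- sum_n_Reals, sum_n_rsum in Hz.
  transitivity (INR (fact (S q)) * rsum (fun k => b k * e (q - k)%nat) (S q)).
  - rewrite <- rsum_scal. apply rsum_ext. intros i Hi.
    unfold b, e, Binomial.C. replace (S (q - i)) with (S q - i)%nat by lia.
    field. split; apply INR_fact_neq_0.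
  - replace (rsum (fun k => b k * e (q - k)%nat) (S q)) with (if Nat.eqb q 0 then 1 else 0) by lra.
    destruct q as [|q]; simpl; ring.
Qed.

(** The function [f(z) = z/(e^z-1)] satisfies [f(-z) = f(z) + z]. *)
Lemma bernoulli_parity (B : nat -> R) :
  is_bernoulli B -> forall m, beta B m = B m + (if Nat.eqb m 1 then 1 else 0).
Proof.
  intros (rho & Hr & Hb) m.
  assert (Hz : forall n, (beta B n - B n) / INR (fact n) - (if Nat.eqb n 1 then 1 else 0) = 0).
  { apply (pseries_zero (fun n => (beta B n - B n) / INR (fact n) - (if Nat.eqb n 1 then 1 else 0)) rho Hr).
    intros x Hx.
    assert (H1 := Hb x ltac:(rewrite Rabs_right; lra)).
    assert (H2 := Hb (- x) ltac:(rewrite Rabs_left; lra)).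
    apply is_pseries_R in H1. apply is_pseries_R in H2.
    assert (H3 := is_series_minus _ _ _ _ (is_series_minus _ _ _ _ H2 H1) (is_series_delta 1 x)).
    apply is_series_val with (- x / (exp (- x) - 1) - x / (exp x - 1) - x ^ 1).
    - eapply is_series_ext; [|exact H3]. intros n.
      match goal with |- ?a = ?b => change (@eq R a b) end.
      change (B n / INR (fact n) * (- x) ^ n - B n / INR (fact n) * x ^ n -
         (if Nat.eqb n 1 then 1 else 0) * x ^ n =
        ((beta B n - B n) / INR (fact n) - (if Nat.eqb n 1 then 1 else 0)) * x ^ n).
      replace (- x) with (-1 * x) by ring. rewrite Rpow_mult_distr. unfold beta, Rdiv. ring.
    - assert (Hx1 := exp_neq_1 x ltac:(lra)). assert (Hp := exp_pos x).
      rewrite exp_Ropp, pow_1. field. repeat split; try lra. }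
  specialize (Hz m).
  assert (Hf := INR_fact_neq_0 m).
  assert (E1 : beta B m - B m = INR (fact m) * (if Nat.eqb m 1 then 1 else 0)).
  { replace (beta B m - B m) with (INR (fact m) * ((beta B m - B m) / INR (fact m))) by (field; auto).
    f_equal. lra. }
  destruct (Nat.eqb_spec m 1) as [Em|_]; [rewrite Em in E1 |- *; simpl in E1|]; lra.
Qed.

Lemma bernoulli_0 (B : nat -> R) : bern_rec B -> B 0%nat = 1.
Proof.
  intros Hrec. assert (E1 := Hrec 1%nat). simpl in E1. rewrite C_n_0 in E1. lra.
Qed.

Lemma bernoulli_1 (B : nat -> R) : bern_rec B -> B 1%nat = - / 2.
Proof.
  intros Hrec. assert (E1 := Hrec 2%nat). simpl in E1.
  rewrite C_n_0, (bernoulli_0 B Hrec) in E1. unfold Binomial.C in E1. simpl in E1. lra.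
Qed.

Lemma bernoulli_2 (B : nat -> R) : bern_rec B -> B 2%nat = / 6.
Proof.
  intros Hrec. assert (E1 := Hrec 3%nat). simpl in E1.
  rewrite C_n_0, (bernoulli_0 B Hrec), (bernoulli_1 B Hrec) in E1. unfold Binomial.C in E1. simpl in E1. lra.
Qed.

Lemma bernoulli_odd (B : nat -> R) (m : nat) :
  is_bernoulli B -> Nat.odd m = true -> m <> 1%nat -> B m = 0.
Proof.
  intros HB Ho Hm. assert (Hp := bernoulli_parity B HB m).
  apply Nat.odd_spec in Ho. destruct Ho as [k ->].
  apply Nat.eqb_neq in Hm. rewrite Hm in Hp. unfold beta in Hp.
  rewrite pow_add, pow_1_even in Hp. lra.
Qed.

(** * Faulhaber's formula *)

Lemma binomial_trinomial (p i m : nat) : (i + m <= p)%nat ->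
  Binomial.C p i * Binomial.C (p - i) m = Binomial.C p (i + m) * Binomial.C (i + m) i.
Proof.
  intros Hp. unfold Binomial.C.
  replace (p - i - m)%nat with (p - (i + m))%nat by lia.
  replace (i + m - i)%nat with m by lia.
  field. repeat split; apply INR_fact_neq_0.
Qed.

Lemma S_pow_S (r n : nat) : S_pow r (S n) = S_pow r n + INR (S n) ^ r.
Proof. unfold S_pow. rewrite !rsum_sum_n_m_1. reflexivity. Qed.

(** The same cancellation as in [em_coef_step], with an integral exponent and hence
    without remainder. *)
Lemma faulhaber_step (B : nat -> R) (p : nat) (x : R) :
  bern_rec B -> (forall m, beta B m = B m + (if Nat.eqb m 1 then 1 else 0)) ->
  (1 <= p)%nat ->
  rsum (fun i => Binomial.C p i * beta B i * x ^ (p - i)) (S p)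
  - rsum (fun i => Binomial.C p i * beta B i * (x - 1) ^ (p - i)) (S p)
  = INR p * x ^ (p - 1).
Proof.
  intros Hrec Hpar Hp.
  set (v := fun q => Binomial.C p q * x ^ (p - q)).
  assert (E1 : rsum (fun i => Binomial.C p i * beta B i * (x - 1) ^ (p - i)) (S p) =
    rsum (fun q => beta B q * v q + - (if Nat.eqb q 1 then v 1%nat else 0)) (S p)).
  { transitivity (rsum (fun i => rsum (fun m =>
        (-1) ^ (i + m) * (Binomial.C (i + m) i * B i) * v (i + m)%nat) (S p - i)) (S p)).
    - apply rsum_ext. intros i Hi.
      replace (x - 1) with (-1 + x) by ring.
      rewrite binomial, <- sum_n_Reals, sum_n_rsum.
      replace (S (p - i)) with (S p - i)%nat by lia.
      rewrite <- rsum_scal. apply rsum_ext. intros m Hm. unfold v.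
      replace (p - i - m)%nat with (p - (i + m))%nat by lia.
      transitivity (Binomial.C p i * Binomial.C (p - i) m * beta B i * (-1) ^ m * x ^ (p - (i + m))); [ring|].
      rewrite binomial_trinomial by lia. unfold beta. rewrite pow_add. ring.
    - rewrite (rsum_triangle (fun i q => (-1) ^ q * (Binomial.C q i * B i) * v q)).
      apply rsum_ext. intros q _.
      rewrite (rsum_ext _ (fun i => (-1) ^ q * v q * (Binomial.C q i * B i))) by (intros; ring).
      rewrite rsum_scal. simpl rsum. rewrite Hrec, C_n_n. unfold beta.
      destruct (Nat.eqb_spec q 1) as [->|]; simpl; ring. }
  rewrite E1, rsum_plus.
  assert (E2 : forall n, (1 <= n)%nat ->
    rsum (fun q => - (if Nat.eqb q 1 then v 1%nat else 0)) (S n) = - v 1%nat).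
  { induction n as [|n IH]; [lia|]. intros _. destruct n as [|n]; [simpl; ring|].
    change (rsum ?f (S (S (S n)))) with (rsum f (S (S n)) + f (S (S n))).
    rewrite IH by lia. simpl. ring. }
  rewrite E2 by auto.
  rewrite (rsum_ext (fun i => Binomial.C p i * beta B i * x ^ (p - i)) (fun q => beta B q * v q))
    by (intros; unfold v; ring).
  unfold v.
  replace (Binomial.C p 1) with (INR p).
  - ring.
  - destruct p as [|p]; [lia|]. unfold Binomial.C. rewrite fact_simpl, mult_INR.
    replace (S p - 1)%nat with p by lia. simpl (fact 1). simpl (INR 1). field. apply INR_fact_neq_0.
Qed.

Lemma faulhaber (B : nat -> R) (r n : nat) :
  bern_rec B -> (forall m, beta B m = B m + (if Nat.eqb m 1 then 1 else 0)) ->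
  (INR r + 1) * S_pow r n =
  rsum (fun i => Binomial.C (S r) i * beta B i * INR n ^ (S r - i)) (S r).
Proof.
  intros Hrec Hpar.
  assert (Hl : forall x, rsum (fun i => Binomial.C (S r) i * beta B i * x ^ (S r - i)) (S (S r)) =
     rsum (fun i => Binomial.C (S r) i * beta B i * x ^ (S r - i)) (S r) + beta B (S r)).
  { intros x. change (rsum ?f (S (S r))) with (rsum f (S r) + f (S r)).
    cbv beta. rewrite C_n_n, Nat.sub_diag. simpl pow. ring. }
  induction n as [|n IH].
  - unfold S_pow. rewrite sum_n_m_zero by lia. rewrite rsum_0; [change zero with 0; ring|].
    intros i Hi. simpl INR. rewrite pow_i by lia. ring.
  - rewrite S_pow_S, Rmult_plus_distr_l, IH.
    assert (E1 := faulhaber_step B (S r) (INR (S n)) Hrec Hpar ltac:(lia)).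
    rewrite !Hl in E1.
    replace (INR (S n) - 1) with (INR n) in E1 by (rewrite S_INR; ring).
    replace (S r - 1)%nat with r in E1 by lia. rewrite (S_INR r) in E1. lra.
Qed.

(** * Real form of the Euler-Maclaurin expansion *)

Fixpoint rbinom (x : R) (m : nat) : R :=
  match m with O => 1 | S j => / INR (S j) * ((x - INR j) * rbinom x j) end.

(** Derivative of [rbinom] with respect to [x]. *)
Fixpoint drbinom (x : R) (m : nat) : R :=
  match m with O => 0 | S j => / INR (S j) * ((x - INR j) * drbinom x j + rbinom x j) end.

Lemma mul_binom_real (x : R) (m : nat) (a : nat -> C) :
  mul_binom (RtoC x) m a 0%nat = (RtoC (rbinom x m) * a 0%nat)%C /\
  mul_binom (RtoC x) m a 1%nat = (RtoC (rbinom x m) * a 1%nat + RtoC (drbinom x m) * a 0%nat)%C.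
Proof.
  induction m as [|m [IH0 IH1]].
  - split; simpl; ring.
  - split; simpl; unfold mul_lin; rewrite ?IH0, ?IH1.
    + rewrite !RtoC_mult, RtoC_minus. ring.
    + rewrite !RtoC_mult, RtoC_plus, !RtoC_mult, RtoC_minus. ring.
Qed.

Lemma pow_coef_real (X c : R) :
  pow_coef X (RtoC c) 0 = RtoC (exp (c * ln X)) /\ pow_coef X (RtoC c) 1 = RtoC (exp (c * ln X) * ln X).
Proof.
  unfold pow_coef. rewrite <- RtoC_mult, Cexp_RtoC. split; rewrite <- RtoC_mult; f_equal; simpl; field.
Qed.

Definition sum_pow_ln (r n : nat) : R := rsum (fun k => INR (S k) ^ r * ln (INR (S k))) n.

Lemma exp_INR_ln (n r : nat) : (1 <= n)%nat -> exp (INR r * ln (INR n)) = INR n ^ r.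
Proof. intros Hn. apply (Rpower_pow r (INR n)). apply lt_0_INR; lia. Qed.

Lemma Re_em_coef_1 (B : nat -> R) (M r N : nat) : (1 <= N)%nat ->
  Re (em_coef B M N (RtoC (INR r)) 1) =
  (INR r + 1) * sum_pow_ln r N + S_pow r N
  - rsum (fun i => beta B i * exp ((INR r + 1 - INR i) * ln (INR N)) *
            (rbinom (INR r + 1) i * ln (INR N) + drbinom (INR r + 1) i)) (S M).
Proof.
  intros HN. unfold em_coef, mul_lin.
  rewrite <- RtoC_plus.
  rewrite (csum_ext (fun i => RtoC (beta B i) * _)%C
    (fun i => RtoC (beta B i * exp ((INR r + 1 - INR i) * ln (INR N)) *
            (rbinom (INR r + 1) i * ln (INR N) + drbinom (INR r + 1) i)))).
  2:{ intros i _. rewrite <- RtoC_minus.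
      rewrite (proj2 (mul_binom_real _ _ _)), (proj1 (pow_coef_real _ _)), (proj2 (pow_coef_real _ _)).
      rewrite <- !RtoC_mult, <- RtoC_plus, <- RtoC_mult. f_equal. ring. }
  rewrite (csum_ext (fun n => pow_coef (INR (S n)) (RtoC (INR r)) 1)
     (fun n => RtoC (INR (S n) ^ r * ln (INR (S n))))).
  2:{ intros i _. now rewrite (proj2 (pow_coef_real _ _)), exp_INR_ln by lia. }
  rewrite (csum_ext (fun n => pow_coef (INR (S n)) (RtoC (INR r)) 0) (fun n => RtoC (INR (S n) ^ r))).
  2:{ intros i _. now rewrite (proj1 (pow_coef_real _ _)), exp_INR_ln by lia. }
  rewrite !csum_RtoC. unfold S_pow. rewrite rsum_sum_n_m_1. unfold sum_pow_ln.
  simpl. unfold Re. simpl. ring.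
Qed.

Lemma Re_em_coef_0 (B : nat -> R) (M r N : nat) : (1 <= N)%nat ->
  Re (em_coef B M N (RtoC (INR r)) 0) =
  (INR r + 1) * S_pow r N
  - rsum (fun i => beta B i * exp ((INR r + 1 - INR i) * ln (INR N)) * rbinom (INR r + 1) i) (S M).
Proof.
  intros HN. unfold em_coef, mul_lin.
  rewrite <- RtoC_plus.
  rewrite (csum_ext (fun i => RtoC (beta B i) * _)%C
    (fun i => RtoC (beta B i * exp ((INR r + 1 - INR i) * ln (INR N)) * rbinom (INR r + 1) i))).
  2:{ intros i _. rewrite <- RtoC_minus.
      rewrite (proj1 (mul_binom_real _ _ _)), (proj1 (pow_coef_real _ _)).
      rewrite <- !RtoC_mult. f_equal. ring. }
  rewrite (csum_ext (fun n => pow_coef (INR (S n)) (RtoC (INR r)) 0) (fun n => RtoC (INR (S n) ^ r))).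
  2:{ intros i _. now rewrite (proj1 (pow_coef_real _ _)), exp_INR_ln by lia. }
  rewrite !csum_RtoC. unfold S_pow. rewrite rsum_sum_n_m_1.
  simpl. unfold Re. simpl. ring.
Qed.

Lemma rbinom_nat (p i : nat) : (i <= p)%nat -> rbinom (INR p) i = Binomial.C p i.
Proof.
  induction i as [|i IH]; intros Hi.
  - now rewrite C_n_0.
  - change (rbinom (INR p) (S i)) with (/ INR (S i) * ((INR p - INR i) * rbinom (INR p) i)).
    rewrite IH by lia. rewrite pascal_step3 by lia. rewrite minus_INR by lia.
    unfold Rdiv. ring.
Qed.

Lemma rbinom_nat_gt (p i : nat) : (p < i)%nat -> rbinom (INR p) i = 0.
Proof.
  induction i as [|i IH]; intros Hi; [lia|].
  change (rbinom (INR p) (S i)) with (/ INR (S i) * ((INR p - INR i) * rbinom (INR p) i)).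
  destruct (Nat.eq_dec p i) as [->|]; [ring|]. rewrite IH by lia. ring.
Qed.

Lemma harmonic_S (n : nat) : H (S n) = H n + / INR (S n).
Proof. unfold H. rewrite !rsum_sum_n_m_1. reflexivity. Qed.

Lemma harmonic_0 : H 0 = 0.
Proof. unfold H. now rewrite rsum_sum_n_m_1. Qed.

(** Logarithmic derivative of [x(x-1)...(x-i+1)/i!] at [x = p]; for [i > p] it breaks down,
    because the factor [x-p] vanishes there. *)
Lemma drbinom_nat (p i : nat) : (i <= p)%nat ->
  drbinom (INR p) i = Binomial.C p i * (H p - H (p - i)).
Proof.
  induction i as [|i IH]; intros Hi.
  - rewrite Nat.sub_0_r. simpl. ring.
  - change (drbinom (INR p) (S i)) with
      (/ INR (S i) * ((INR p - INR i) * drbinom (INR p) i + rbinom (INR p) i)).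
    rewrite IH, rbinom_nat by lia. rewrite pascal_step3 by lia.
    replace (p - i)%nat with (S (p - S i)) by lia. rewrite harmonic_S.
    replace (S (p - S i)) with (p - i)%nat by lia. rewrite minus_INR by lia.
    assert (INR i < INR p) by (apply lt_INR; lia).
    assert (INR (S i) <> 0) by (apply not_0_INR; lia). field. lra.
Qed.

(** Beyond [i = 1] the binomial coefficient vanishes at [x = 1], and its derivative is the
    product of the remaining factors; these derivatives are the coefficients of
    Stirling's series. *)
Lemma drbinom_1 (i : nat) : drbinom 1 (S (S i)) = (-1) ^ i / (INR (S (S i)) * INR (S i)).
Proof.
  induction i as [|i IH].
  - simpl. field.
  - change (drbinom 1 (S (S (S i)))) with
      (/ INR (S (S (S i))) * ((1 - INR (S (S i))) * drbinom 1 (S (S i)) + rbinom 1 (S (S i)))).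
    rewrite IH. change 1 with (INR 1) at 2. rewrite (rbinom_nat_gt 1) by lia.
    assert (0 < INR (S i)) by (apply lt_0_INR; lia).
    rewrite !S_INR in *. simpl. field. lra.
Qed.

(** At an integral exponent the Euler-Maclaurin expression of degree [0] is constant in [N], by
    Faulhaber's formula. *)
Lemma zeta_neg_value (B : nat -> R) (zeta : C -> C) (r : nat) :
  is_bernoulli B -> is_riemann_zeta zeta ->
  (INR r + 1) * zeta_neg zeta r = - beta B (S r).
Proof.
  intros HB Hz. assert (Hrec := bernoulli_rec B HB).
  destruct (em_coef_zeta B zeta r 0 (r + 3) Hrec Hz ltac:(lia)) as (D & HD & Hlim).
  (* The binomial coefficients of [r + 1] vanish beyond [i = r + 1]. *)
  assert (Hc : forall N, (1 <= N)%nat -> Re (em_coef B (r + 3) N (RtoC (INR r)) 0) = - beta B (S r)).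
  { intros N HN. rewrite Re_em_coef_0 by auto.
    rewrite (faulhaber B r N Hrec (bernoulli_parity B HB)).
    replace (S (r + 3)) with (S (S (S (S r)))) by lia.
    change (rsum ?f (S (S (S (S r))))) with (rsum f (S r) + f (S r) + f (S (S r)) + f (S (S (S r)))).
    cbv beta. replace (INR r + 1) with (INR (S r)) by (rewrite S_INR; ring).
    rewrite (rbinom_nat_gt (S r) (S (S r))), (rbinom_nat_gt (S r) (S (S (S r)))) by lia.
    rewrite (rbinom_nat (S r) (S r)) by lia.
    rewrite C_n_n, Rminus_diag, Rmult_0_l, exp_0.
    rewrite (rsum_ext (fun i => beta B i * exp ((INR (S r) - INR i) * ln (INR N)) * rbinom (INR (S r)) i)
              (fun i => Binomial.C (S r) i * beta B i * INR N ^ (S r - i))).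
    - ring.
    - intros i Hi. rewrite <- minus_INR, exp_INR_ln, rbinom_nat by lia. ring. }
  assert (Hl : is_lim_seq (fun N => Re (em_coef B (r + 3) N (RtoC (INR r)) 0)) ((INR r + 1) * zeta_neg zeta r)).
  { apply is_lim_seq_ext with (fun N => (INR r + 1) * zeta_neg zeta r -
      ((INR r + 1) * zeta_neg zeta r - Re (em_coef B (r + 3) N (RtoC (INR r)) 0))); [intros; ring|].
    replace (Finite ((INR r + 1) * zeta_neg zeta r)) with (Finite ((INR r + 1) * zeta_neg zeta r - 0))
      by (f_equal; ring).
    apply is_lim_seq_minus'; [apply is_lim_seq_const|].
    apply is_lim_seq_abs_0.
    apply is_lim_seq_le_le_loc with (fun _ => 0) (fun n => D * / INR n).
    - exists 1%nat. intros N HN. split; [apply Rabs_pos|].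
      destruct (Hlim N HN) as [H1 _]. simpl in H1. rewrite Rmult_1_r in H1. exact H1.
    - apply is_lim_seq_const.
    - replace (Finite 0) with (Rbar_mult D 0) by (simpl; f_equal; ring).
      apply is_lim_seq_scal_l, is_lim_seq_inv_INR. }
  apply (is_lim_seq_ext_loc _ (fun _ => - beta B (S r))) in Hl.
  - apply is_lim_seq_unique in Hl. rewrite Lim_seq_const in Hl. injection Hl; auto.
  - exists 1%nat. exact Hc.
Qed.

(** * Asymptotics of the sums of powers times logarithms *)

(** The coefficient of [n^(j+1)] in [S_pow r n]. *)
Definition faul_coef (B : nat -> R) (r j : nat) : R :=
  Binomial.C r j * (-1) ^ (r - j) * (B (r - j)%nat / INR (j + 1)).

Lemma binomial_S_div (r j : nat) : (j <= r)%nat ->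
  Binomial.C (S r) (r - j) = (INR r + 1) * (Binomial.C r j / INR (j + 1)).
Proof.
  intros Hj. unfold Binomial.C.
  replace (S r - (r - j))%nat with (S j) by lia.
  rewrite !fact_simpl, !mult_INR, (S_INR r), (S_INR j), plus_INR. simpl (INR 1).
  pose proof (pos_INR j). field. repeat split; try apply INR_fact_neq_0; lra.
Qed.

Lemma faul_coef_beta (B : nat -> R) (r j : nat) : (j <= r)%nat ->
  Binomial.C (S r) (r - j) * beta B (r - j) = (INR r + 1) * faul_coef B r j.
Proof.
  intros Hj. rewrite binomial_S_div by auto. unfold faul_coef, beta.
  assert (INR (j + 1) <> 0) by (apply not_0_INR; lia). field. auto.
Qed.

Lemma S_pow_faul_coef (B : nat -> R) (r n : nat) : is_bernoulli B ->
  S_pow r n = rsum (fun j => faul_coef B r j * INR n ^ (j + 1)) (S r).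
Proof.
  intros HB. pose proof (pos_INR r).
  apply Rmult_eq_reg_l with (INR r + 1); [|lra].
  rewrite (faulhaber B r n (bernoulli_rec B HB) (bernoulli_parity B HB)).
  rewrite rsum_rev, <- rsum_scal. apply rsum_ext. intros j Hj.
  rewrite faul_coef_beta by lia. replace (S r - (r - j))%nat with (j + 1)%nat by lia. ring.
Qed.

Lemma logQ_faul_coef (B : nat -> R) (zeta : C -> C) (r n : nat) :
  logQ B zeta r n = (S_pow r n - zeta_neg zeta r) * ln (INR n) +
    rsum (fun j => faul_coef B r j * INR n ^ (j + 1) * (H r - H (j + 1))) (S r).
Proof.
  unfold logQ. rewrite rsum_sum_n_m_0. f_equal. apply rsum_ext. intros j _.
  unfold faul_coef, Rdiv. ring.
Qed.

Lemma exp_neg_ln (n k : nat) : (1 <= n)%nat -> exp (- INR k * ln (INR n)) = / INR n ^ k.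
Proof.
  intros Hn. rewrite Ropp_mult_distr_l_reverse, exp_Ropp, exp_INR_ln by auto. reflexivity.
Qed.

(** The coefficient of degree [1] of the Euler-Maclaurin expression at [r]. The terms
    [i <= r] give [log Q_r], the harmonic numbers coming from the derivatives of the
    binomial coefficients; the term [i = r+1] gives [-zeta(-r) (log N + H_(r+1))]; the
    terms [i > r+1] tend to zero and are kept as the tail of the expansion. *)
Lemma sum_pow_ln_expansion (B : nat -> R) (zeta : C -> C) (r q : nat) :
  is_bernoulli B -> is_riemann_zeta zeta ->
  exists D, 0 <= D /\ forall N, (1 <= N)%nat ->
    Rabs (sum_pow_ln r N - (logA zeta r + logQ B zeta r N
          + rsum (fun j => beta B (r + 2 + j) * drbinom (INR r + 1) (r + 2 + j) / (INR r + 1)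
                           * / INR N ^ S j) (q + 2)))
      <= D / INR N ^ S q.
Proof.
  intros HB Hz. pose proof (pos_INR r) as Hr.
  assert (Hrec := bernoulli_rec B HB).
  destruct (em_coef_zeta B zeta r q (r + q + 3) Hrec Hz (le_n _)) as (D & HD & Hlim).
  exists D; split; auto. intros N HN. destruct (Hlim N HN) as [_ H1].
  assert (PN : 1 <= INR N) by now apply (le_INR 1).
  assert (HDN : 0 <= D / INR N ^ S q).
  { apply Rmult_le_pos; auto. left; apply Rinv_0_lt_compat, pow_lt; lra. }
  match goal with |- Rabs ?X <= _ => set (Y := X) end.
  match type of H1 with Rabs ?X <= _ => assert (EY : (INR r + 1) * Y = - X) end.
  2:{ assert (E2 : Rabs Y <= Rabs ((INR r + 1) * Y)).
      { rewrite Rabs_mult, (Rabs_right (INR r + 1)) by lra. pose proof (Rabs_pos Y). nra. }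
      rewrite EY, Rabs_Ropp in E2. lra. }
  unfold Y. rewrite Re_em_coef_1 by auto.
  replace (S (r + q + 3)) with (S (S r) + (q + 2))%nat by lia.
  rewrite (rsum_split _ (S (S r)) (q + 2)).
  change (rsum ?f (S (S r))) with (rsum f (S r) + f (S r)). cbv beta.
  replace (INR r + 1) with (INR (S r)) by apply S_INR.
  rewrite (rbinom_nat (S r) (S r)), (drbinom_nat (S r) (S r)), C_n_n, Nat.sub_diag, harmonic_0 by lia.
  rewrite Rminus_diag, Rmult_0_l, exp_0.
  rewrite (rsum_ext (fun i => beta B i * exp ((INR (S r) - INR i) * ln (INR N)) *
       (rbinom (INR (S r)) i * ln (INR N) + drbinom (INR (S r)) i))
    (fun i => (ln (INR N) + / INR (S r)) * (Binomial.C (S r) i * beta B i * INR N ^ (S r - i)) +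
              Binomial.C (S r) i * beta B i * INR N ^ (S r - i) * (H r - H (S r - i)))).
  2:{ intros i Hi. rewrite <- minus_INR, exp_INR_ln, rbinom_nat, drbinom_nat, harmonic_S by lia. ring. }
  rewrite rsum_plus, rsum_scal.
  rewrite <- (faulhaber B r N Hrec (bernoulli_parity B HB)).
  rewrite (rsum_rev (fun i => Binomial.C (S r) i * beta B i * INR N ^ (S r - i) * (H r - H (S r - i)))).
  rewrite (rsum_ext (fun i => Binomial.C (S r) (r - i) * beta B (r - i) * INR N ^ (S r - (r - i)) * (H r - H (S r - (r - i))))
    (fun j => (INR r + 1) * (faul_coef B r j * INR N ^ (j + 1) * (H r - H (j + 1))))).
  2:{ intros j Hj. rewrite faul_coef_beta by lia. replace (S r - (r - j))%nat with (j + 1)%nat by lia. ring. }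
  rewrite rsum_scal.
  rewrite (rsum_ext (fun j => beta B (S (S r) + j) * exp ((INR (S r) - INR (S (S r) + j)) * ln (INR N)) *
       (rbinom (INR (S r)) (S (S r) + j) * ln (INR N) + drbinom (INR (S r)) (S (S r) + j)))
    (fun j => INR (S r) * (beta B (r + 2 + j) * drbinom (INR (S r)) (r + 2 + j) / INR (S r) * / INR N ^ S j))).
  2:{ intros j _. rewrite rbinom_nat_gt by lia.
      replace (INR (S r) - INR (S (S r) + j)) with (- INR (S j))
        by (rewrite plus_INR, !S_INR; ring).
      rewrite exp_neg_ln by auto. replace (S (S r) + j)%nat with (r + 2 + j)%nat by lia.
      field. split; [apply pow_nonzero; lra|apply not_0_INR; lia]. }
  rewrite rsum_scal, logQ_faul_coef. unfold logA.
  assert (Hzv := zeta_neg_value B zeta r HB Hz).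
  rewrite harmonic_S. replace (beta B (S r)) with (- ((INR r + 1) * zeta_neg zeta r)) by lra.
  rewrite (S_INR r). field. lra.
Qed.

(** * Constant terms of asymptotic expansions *)

Definition plog (p q : nat -> R) (d n : nat) : R :=
  rsum (fun k => (p k + q k * ln (INR n)) * INR n ^ k) (S d).

(** The function [f] has an expansion in the monomials [n^k] and [n^k log n], up to
    [o(1)], with constant term [c]. The sequences [p] and [q] vanish beyond the degree so
    that expansions of different degrees can be added. *)
Definition asy (f : nat -> R) (c : R) : Prop :=
  exists d p q, (forall k, (d < k)%nat -> p k = 0 /\ q k = 0) /\ p 0%nat = c /\
    is_lim_seq (fun n => f n - plog p q d n) 0.

Lemma plog_pad (p q : nat -> R) (d e n : nat) :
  (forall k, (d < k)%nat -> p k = 0 /\ q k = 0) -> (d <= e)%nat ->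
  plog p q d n = plog p q e n.
Proof.
  intros Hz He. unfold plog. replace (S e) with (S d + (e - d))%nat by lia.
  rewrite rsum_split. match goal with |- _ = _ + ?t => assert (Et : t = 0) end.
  - apply rsum_0. intros i Hi. destruct (Hz (S d + i)%nat ltac:(lia)) as [-> ->]. ring.
  - rewrite Et. ring.
Qed.

Lemma is_lim_seq_0_plus (u v : nat -> R) :
  is_lim_seq u 0 -> is_lim_seq v 0 -> is_lim_seq (fun n => u n + v n) 0.
Proof.
  intros. replace (Finite 0) with (Finite (0 + 0)) by (f_equal; ring).
  now apply is_lim_seq_plus'.
Qed.

Lemma is_lim_seq_0_scal (s : R) (u : nat -> R) :
  is_lim_seq u 0 -> is_lim_seq (fun n => s * u n) 0.
Proof.
  intros. replace (Finite 0) with (Finite (s * 0)) by (f_equal; ring).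
  apply is_lim_seq_mult'; auto. apply is_lim_seq_const.
Qed.

Lemma asy_plus (f g : nat -> R) (c c' : R) :
  asy f c -> asy g c' -> asy (fun n => f n + g n) (c + c').
Proof.
  intros (d & p & q & Hz & Hc & Hl) (d' & p' & q' & Hz' & Hc' & Hl').
  exists (Nat.max d d'), (fun k => p k + p' k), (fun k => q k + q' k). repeat split.
  - destruct (Hz k ltac:(lia)) as [-> _]. destruct (Hz' k ltac:(lia)) as [-> _]. ring.
  - destruct (Hz k ltac:(lia)) as [_ ->]. destruct (Hz' k ltac:(lia)) as [_ ->]. ring.
  - now rewrite Hc, Hc'.
  - eapply is_lim_seq_ext; [|exact (is_lim_seq_0_plus _ _ Hl Hl')].
    intros n. simpl. rewrite (plog_pad p q d (Nat.max d d')), (plog_pad p' q' d' (Nat.max d d')) by (auto; lia).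
    unfold plog.
    rewrite (rsum_ext (fun k => (p k + p' k + (q k + q' k) * ln (INR n)) * INR n ^ k)
      (fun k => (p k + q k * ln (INR n)) * INR n ^ k + (p' k + q' k * ln (INR n)) * INR n ^ k))
      by (intros; ring).
    rewrite rsum_plus. ring.
Qed.

Lemma asy_scal (s : R) (f : nat -> R) (c : R) : asy f c -> asy (fun n => s * f n) (s * c).
Proof.
  intros (d & p & q & Hz & Hc & Hl).
  exists d, (fun k => s * p k), (fun k => s * q k). repeat split.
  - destruct (Hz k ltac:(lia)) as [-> _]. ring.
  - destruct (Hz k ltac:(lia)) as [_ ->]. ring.
  - now rewrite Hc.
  - eapply is_lim_seq_ext; [|exact (is_lim_seq_0_scal s _ Hl)].
    intros n. simpl. unfold plog.
    rewrite (rsum_ext (fun k => (s * p k + s * q k * ln (INR n)) * INR n ^ k)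
      (fun k => s * ((p k + q k * ln (INR n)) * INR n ^ k))) by (intros; ring).
    rewrite rsum_scal. ring.
Qed.

Lemma asy_eq (f g : nat -> R) (c c' : R) :
  asy f c -> (forall n, (1 <= n)%nat -> f n = g n) -> c = c' -> asy g c'.
Proof.
  intros (d & p & q & Hz & Hc & Hl) Hfg <-. exists d, p, q. repeat split; auto; try apply Hz; auto.
  eapply is_lim_seq_ext_loc; [|exact Hl]. exists 1%nat. intros n Hn. now rewrite Hfg.
Qed.

Lemma asy_null (f : nat -> R) : is_lim_seq f 0 -> asy f 0.
Proof.
  intros Hf. exists 0%nat, (fun _ => 0), (fun _ => 0). repeat split.
  eapply is_lim_seq_ext; [|exact Hf]. intros n. unfold plog. simpl. ring.
Qed.

Lemma asy_mon (a b : R) (k : nat) :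
  asy (fun n => (a + b * ln (INR n)) * INR n ^ k) (if Nat.eqb k 0 then a else 0).
Proof.
  exists k, (fun i => if Nat.eqb i k then a else 0), (fun i => if Nat.eqb i k then b else 0).
  repeat split.
  - destruct (Nat.eqb_spec k0 k); [lia|auto].
  - destruct (Nat.eqb_spec k0 k); [lia|auto].
  - rewrite Nat.eqb_sym. reflexivity.
  - eapply is_lim_seq_ext; [|apply is_lim_seq_const]. intros n. simpl. unfold plog.
    rewrite (rsum_ext _ (fun i => if Nat.eqb i k then (a + b * ln (INR n)) * INR n ^ i else 0)).
    + rewrite (rsum_delta (fun i => (a + b * ln (INR n)) * INR n ^ i)) by lia. ring.
    + intros i _. destruct (Nat.eqb_spec i k); ring.
Qed.

Lemma asy_rsum (f : nat -> nat -> R) (c : nat -> R) (m : nat) :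
  (forall i, (i < m)%nat -> asy (f i) (c i)) -> asy (fun n => rsum (fun i => f i n) m) (rsum c m).
Proof.
  induction m as [|m IH]; intros Hf.
  - apply asy_null, is_lim_seq_const.
  - simpl. apply asy_plus; [apply IH; intros; apply Hf; lia|apply Hf; lia].
Qed.

Lemma is_lim_seq_ln_div : is_lim_seq (fun n => ln (INR n) / INR n) 0.
Proof.
  apply (is_lim_comp_seq (fun y => ln y / y) INR p_infty 0 is_lim_div_ln_p).
  - exists 0%nat. intros; discriminate.
  - apply is_lim_seq_INR.
Qed.

Lemma is_lim_seq_inv_pow (j : nat) : is_lim_seq (fun n => / INR n ^ S j) 0.
Proof.
  induction j as [|j IHj].
  - apply is_lim_seq_ext with (fun n => / INR n); [intros; now rewrite pow_1|apply is_lim_seq_inv_INR].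
  - apply is_lim_seq_ext with (fun n => / INR n * / INR n ^ S j).
    + intros n. now rewrite <- (tech_pow_Rmult _ (S j)), Rinv_mult.
    + replace (Finite 0) with (Finite (0 * 0)) by (f_equal; ring).
      apply is_lim_seq_mult'; [apply is_lim_seq_inv_INR|exact IHj].
Qed.

Lemma plog_dominated (p q : nat -> R) (d : nat) :
  is_lim_seq (fun n => plog p q d n / INR n ^ S d) 0.
Proof.
  assert (Hm : forall k j, is_lim_seq (fun n => (p k + q k * ln (INR n)) * / INR n ^ S j) 0).
  { intros k j. induction j as [|j IH].
    - apply is_lim_seq_ext with (fun n => p k * / INR n + q k * (ln (INR n) / INR n)).
      { intros n. simpl. rewrite Rmult_1_r. unfold Rdiv. ring. }
      apply is_lim_seq_0_plus; apply is_lim_seq_0_scal; [apply is_lim_seq_inv_INR|apply is_lim_seq_ln_div].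
    - apply is_lim_seq_ext with (fun n => (p k + q k * ln (INR n)) * / INR n ^ S j * / INR n).
      { intros n. rewrite <- (tech_pow_Rmult _ (S j)), Rinv_mult. ring. }
      replace (Finite 0) with (Finite (0 * 0)) by (f_equal; ring).
      apply is_lim_seq_mult'; [exact IH|apply is_lim_seq_inv_INR]. }
  assert (Hs : forall m, (m <= S d)%nat -> is_lim_seq
     (fun n => rsum (fun k => (p k + q k * ln (INR n)) * INR n ^ k) m / INR n ^ S d) 0).
  { induction m as [|m IH]; intros Hle.
    - apply is_lim_seq_ext with (fun _ => 0); [intros; simpl; unfold Rdiv; ring|apply is_lim_seq_const].
    - apply is_lim_seq_ext_loc with (fun n =>
        rsum (fun k => (p k + q k * ln (INR n)) * INR n ^ k) m / INR n ^ S d +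
        (p m + q m * ln (INR n)) * / INR n ^ S (d - m)).
      + exists 1%nat. intros n Hn. assert (0 < INR n) by (apply lt_0_INR; lia).
        change (rsum ?f (S m)) with (rsum f m + f m). cbv beta.
        replace (S d) with (m + S (d - m))%nat by lia. rewrite pow_add.
        field. split; apply pow_nonzero; lra.
      + apply is_lim_seq_0_plus; [apply IH; lia|apply Hm]. }
  apply Hs. lia.
Qed.

(** Since [log n] is unbounded. *)
Lemma lin_ln_lim (a b l : R) :
  is_lim_seq (fun n => a + b * ln (INR n)) l -> b = 0 /\ a = l.
Proof.
  intros Hl.
  assert (Hb : b = 0).
  { destruct (Req_dec b 0) as [|Hb]; auto. exfalso.
    assert (Hc : is_lim_seq (fun n => ln (INR n)) ((l - a) / b)).
    { apply is_lim_seq_ext with (fun n => (a + b * ln (INR n) - a) / b); [intros; field; auto|].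
      apply is_lim_seq_div'; auto; [|apply is_lim_seq_const].
      apply is_lim_seq_minus'; [exact Hl|apply is_lim_seq_const]. }
    assert (E1 := is_lim_seq_unique _ _ Hc). rewrite (is_lim_seq_unique _ _ is_lim_seq_ln) in E1.
    discriminate. }
  split; auto. subst b.
  apply (is_lim_seq_ext _ (fun _ => a)) in Hl; [|intros; ring].
  apply is_lim_seq_unique in Hl. rewrite Lim_seq_const in Hl. now injection Hl.
Qed.

(** By descent on the degree: after division by [n^(d+1)] the leading coefficient
    [p + q log n] tends to zero, hence vanishes. *)
Lemma plog_limit (p q : nat -> R) (d : nat) (l : R) :
  is_lim_seq (plog p q d) l -> p 0%nat = l.
Proof.
  induction d as [|d IH]; intros Hl.
  - apply (lin_ln_lim (p 0%nat) (q 0%nat) l).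
    eapply is_lim_seq_ext; [|exact Hl]. intros n. unfold plog. simpl. ring.
  - assert (Hs : forall n, plog p q (S d) n =
       plog p q d n + (p (S d) + q (S d) * ln (INR n)) * INR n ^ S d) by reflexivity.
    assert (Hz : is_lim_seq (fun n => p (S d) + q (S d) * ln (INR n)) 0).
    { apply is_lim_seq_ext_loc with
        (fun n => plog p q (S d) n * / INR n ^ S d + (- 1) * (plog p q d n / INR n ^ S d)).
      - exists 1%nat. intros n Hn. assert (0 < INR n) by (apply lt_0_INR; lia).
        rewrite Hs. field. apply pow_nonzero; lra.
      - apply is_lim_seq_0_plus; [|apply is_lim_seq_0_scal, plog_dominated].
        replace (Finite 0) with (Finite (l * 0)) by (f_equal; ring).
        apply is_lim_seq_mult'; auto.
        apply is_lim_seq_inv_pow. }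
    apply lin_ln_lim in Hz. destruct Hz as [Hq Hp]. apply IH.
    eapply is_lim_seq_ext; [|exact Hl]. intros n. rewrite Hs, Hq, Hp. ring.
Qed.

Lemma asy_limit (f : nat -> R) (c l : R) : asy f c -> is_lim_seq f l -> l = c.
Proof.
  intros (d & p & q & _ & <- & Hl) Hf. symmetry. apply (plog_limit p q d).
  apply is_lim_seq_ext with (fun n => f n - (f n - plog p q d n)); [intros; ring|].
  replace (Finite l) with (Finite (l - 0)) by (f_equal; ring).
  now apply is_lim_seq_minus'.
Qed.

Lemma asy_inv_pow (j : nat) : asy (fun n => / INR n ^ S j) 0.
Proof. apply asy_null, is_lim_seq_inv_pow. Qed.

Lemma asy_small (f : nat -> R) (D : R) :
  (forall n, (1 <= n)%nat -> Rabs (f n) <= D / INR n) -> asy f 0.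
Proof.
  intros Hf. apply asy_null, is_lim_seq_abs_0.
  apply is_lim_seq_le_le_loc with (fun _ => 0) (fun n => D * / INR n).
  - exists 1%nat. intros n Hn. split; [apply Rabs_pos|now apply Hf].
  - apply is_lim_seq_const.
  - apply is_lim_seq_0_scal, is_lim_seq_inv_INR.
Qed.

Lemma asy_const (c : R) : asy (fun _ => c) c.
Proof.
  eapply asy_eq; [apply (asy_mon c 0 0)| |reflexivity]. intros n _. simpl. ring.
Qed.

Lemma asy_S_pow (B : nat -> R) (r : nat) : is_bernoulli B -> asy (S_pow r) 0.
Proof.
  intros HB.
  eapply asy_eq with (c := rsum (fun _ => 0) (S r)).
  - apply (asy_rsum (fun j n => faul_coef B r j * INR n ^ (j + 1))). intros j _.
    eapply asy_eq; [apply (asy_mon (faul_coef B r j) 0 (j + 1))| |].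
    + intros n _; cbv beta; ring.
    + destruct (Nat.eqb_spec (j + 1) 0); [lia|reflexivity].
  - intros n _. symmetry. apply (S_pow_faul_coef B r n HB).
  - apply rsum_0. auto.
Qed.

Lemma asy_logQ (B : nat -> R) (zeta : C -> C) (r : nat) :
  is_bernoulli B -> asy (logQ B zeta r) 0.
Proof.
  intros HB.
  eapply asy_eq with (c := 0 + rsum (fun _ => 0) (S r)).
  - apply asy_plus.
    + apply (asy_mon 0 (- zeta_neg zeta r) 0).
    + apply (asy_rsum (fun j n => (faul_coef B r j * (H r - H (j + 1)) + faul_coef B r j * ln (INR n)) * INR n ^ (j + 1))).
      intros j _. eapply asy_eq; [apply asy_mon|reflexivity|].
      destruct (Nat.eqb_spec (j + 1) 0); [lia|reflexivity].
  - intros n _. cbv beta. rewrite logQ_faul_coef, (S_pow_faul_coef B r n HB).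
    rewrite (rsum_ext (fun j => (faul_coef B r j * (H r - H (j + 1)) + faul_coef B r j * ln (INR n)) * INR n ^ (j + 1))
      (fun j => faul_coef B r j * INR n ^ (j + 1) * (H r - H (j + 1)) + ln (INR n) * (faul_coef B r j * INR n ^ (j + 1))))
      by (intros; ring).
    rewrite rsum_plus, rsum_scal. simpl pow. ring.
  - rewrite rsum_0 by auto. ring.
Qed.

(** Every [S_k] has zero constant term, including [S_0(n) = n]. *)
Lemma asy_logP1 (B : nat -> R) (r : nat) : is_bernoulli B -> asy (logP1 B r) 0.
Proof.
  intros HB.
  eapply asy_eq with (c := (1 / 2 * ln (2 * PI)) * 0 + (- 1) * 0 + 0
     + rsum (fun j => Bhat B (2 * S j) 1 * 0) ((r + 1) / 2)).
  - apply asy_plus; [apply asy_plus; [apply asy_plus|]|].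
    + apply asy_scal, (asy_S_pow B r HB).
    + apply asy_scal, (asy_S_pow B (r + 1) HB).
    + apply (asy_mon 0 (Bhat B (r + 2) 1) 0).
    + apply (asy_rsum (fun j n => Bhat B (2 * S j) 1 * S_pow (r + 1 - 2 * S j) n)).
      intros j _. apply asy_scal, (asy_S_pow B _ HB).
  - intros n _. unfold logP1. rewrite rsum_sum_n_m_1. simpl pow. ring.
  - rewrite rsum_0; [ring|]. intros; ring.
Qed.

(** Generalized Glaisher-Kinkelin asymptotics: [log Q_r] collects the unbounded terms
    and has no constant term. *)
Lemma asy_sum_pow_ln (B : nat -> R) (zeta : C -> C) (r : nat) :
  is_bernoulli B -> is_riemann_zeta zeta -> asy (sum_pow_ln r) (logA zeta r).
Proof.
  intros HB Hz. destruct (sum_pow_ln_expansion B zeta r 0 HB Hz) as (D & HD & Hb).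
  set (t := fun j => beta B (r + 2 + j) * drbinom (INR r + 1) (r + 2 + j) / (INR r + 1)).
  set (T := fun n => rsum (fun j => t j * / INR n ^ S j) 2).
  eapply asy_eq with (c := 0 + (logA zeta r + 0 + rsum (fun j => t j * 0) 2)).
  - apply asy_plus.
    + apply (asy_small (fun n => sum_pow_ln r n - (logA zeta r + logQ B zeta r n + T n)) D).
      intros n Hn. specialize (Hb n Hn). simpl (INR n ^ 1) in Hb. rewrite Rmult_1_r in Hb. exact Hb.
    + apply asy_plus; [apply asy_plus; [apply asy_const|apply (asy_logQ B zeta r HB)]|].
      apply (asy_rsum (fun j n => t j * / INR n ^ S j)). intros j _.
      apply asy_scal, asy_inv_pow.
  - intros n _. unfold T; cbv beta; ring.
  - simpl. ring.
Qed.

Lemma tail_coeff (B : nat -> R) (j : nat) :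
  beta B (0 + 2 + j) * drbinom (INR 0 + 1) (0 + 2 + j) / (INR 0 + 1) = Bhat B (j + 2) 1.
Proof.
  replace (0 + 2 + j)%nat with (S (S j)) by lia. replace (j + 2)%nat with (S (S j)) by lia.
  replace (INR 0 + 1) with 1 by (simpl; ring). rewrite drbinom_1.
  unfold beta, Bhat. simpl (INR 1). rewrite pow1.
  replace ((-1) ^ S (S j)) with ((-1) ^ j) by (simpl; ring).
  replace (INR (S (S j)) - 1) with (INR (S j)) by (rewrite (S_INR (S j)); ring).
  assert (E1 : (-1) ^ j * (-1) ^ j = 1) by (rewrite <- Rpow_mult_distr; replace (-1 * -1) with 1 by ring; apply pow1).
  assert (INR (S (S j)) <> 0) by (apply not_0_INR; lia).
  assert (INR (S j) <> 0) by (apply not_0_INR; lia).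
  transitivity ((-1) ^ j * (-1) ^ j * B (S (S j)) / (INR (S (S j)) * INR (S j))); [field; auto|].
  rewrite E1. field. auto.
Qed.

(** In the product of [n^(j+1)] with Stirling's series, only the term in [n^(-j-1)] of
    the series reaches the constant term. *)
Lemma asy_pow_stirling (B : nat -> R) (zeta : C -> C) (j : nat) :
  is_bernoulli B -> is_riemann_zeta zeta ->
  asy (fun n => INR n ^ S j * sum_pow_ln 0 n) (Bhat B (j + 2) 1).
Proof.
  intros HB Hz. destruct (sum_pow_ln_expansion B zeta 0 (S j) HB Hz) as (D & HD & Hb).
  (* The error [D / n^(j+2)] has to survive multiplication by [n^(j+1)]; hence the rate [S j]. *)
  set (T := fun n => rsum (fun i => Bhat B (i + 2) 1 * / INR n ^ S i) (S j + 2)).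
  assert (Hq : forall n, logQ B zeta 0 n = (INR n - zeta_neg zeta 0) * ln (INR n) - INR n).
  { intros n. rewrite logQ_faul_coef, (S_pow_faul_coef B 0 n HB). unfold faul_coef. simpl.
    rewrite C_n_0, (bernoulli_0 B (bernoulli_rec B HB)), harmonic_S, harmonic_0. simpl. field. }
  eapply asy_eq with (c := 0 + (0 + (0 + (0 + rsum (fun i => if Nat.eqb i j then Bhat B (i + 2) 1 else 0) (S j + 2))))).
  - apply asy_plus; [|apply asy_plus; [|apply asy_plus; [|apply asy_plus]]].
    + apply (asy_small (fun n => INR n ^ S j * (sum_pow_ln 0 n - (logA zeta 0 + logQ B zeta 0 n + T n))) D).
      intros n Hn. specialize (Hb n Hn).
      assert (P1 : 1 <= INR n) by now apply (le_INR 1).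
      assert (P2 : 0 < INR n ^ S j) by (apply pow_lt; lra).
      rewrite (rsum_ext _ (fun i => Bhat B (i + 2) 1 * / INR n ^ S i)) in Hb
        by (intros; now rewrite tail_coeff).
      fold (T n) in Hb. rewrite Rabs_mult, (Rabs_right (INR n ^ S j)) by lra.
      apply Rle_trans with (INR n ^ S j * (D / INR n ^ S (S j))).
      * apply Rmult_le_compat_l; [lra|exact Hb].
      * right. rewrite <- (tech_pow_Rmult _ (S j)). field. lra.
    + apply (asy_eq _ (fun n => (logA zeta 0 + (- zeta_neg zeta 0) * ln (INR n)) * INR n ^ S j) _ _
               (asy_mon (logA zeta 0) (- zeta_neg zeta 0) (S j))); reflexivity.
    + apply (asy_eq _ (fun n => (-1 + 1 * ln (INR n)) * INR n ^ S (S j)) _ _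
               (asy_mon (-1) 1 (S (S j)))); reflexivity.
    + apply asy_const.
    + apply (asy_rsum (fun i n => Bhat B (i + 2) 1 * (INR n ^ S j * / INR n ^ S i))).
      intros i _.
      destruct (lt_eq_lt_dec i j) as [[Hij|Hij]|Hij].
      * eapply asy_eq; [apply (asy_mon (Bhat B (i + 2) 1) 0 (j - i))| |].
        -- intros n Hn. assert (0 < INR n) by (apply lt_0_INR; lia).
           replace (S j) with (j - i + S i)%nat by lia. rewrite pow_add. field. repeat split; apply pow_nonzero; lra.
        -- destruct (Nat.eqb_spec (j - i) 0); [lia|]. destruct (Nat.eqb_spec i j); [lia|reflexivity].
      * subst i. rewrite Nat.eqb_refl.
        eapply asy_eq; [apply (asy_const (Bhat B (j + 2) 1))| |reflexivity].
        intros n Hn. assert (0 < INR n) by (apply lt_0_INR; lia). cbv beta. field. repeat split; apply pow_nonzero; lra.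
      * eapply asy_eq; [apply (asy_scal (Bhat B (i + 2) 1)), (asy_inv_pow (i - S j))| |].
        -- intros n Hn. assert (0 < INR n) by (apply lt_0_INR; lia).
           replace (S i) with (S j + S (i - S j))%nat by lia. rewrite (pow_add _ (S j)). field.
           split; apply pow_nonzero; lra.
        -- destruct (Nat.eqb_spec i j); [lia|ring].
  - intros n Hn. cbv beta. rewrite Hq. unfold T.
    rewrite (rsum_ext (fun i => Bhat B (i + 2) 1 * (INR n ^ S j * / INR n ^ S i))
      (fun i => INR n ^ S j * (Bhat B (i + 2) 1 * / INR n ^ S i))) by (intros; ring).
    rewrite rsum_scal. rewrite <- (tech_pow_Rmult _ (S j)). ring.
  - rewrite (rsum_delta (fun i => Bhat B (i + 2) 1)) by lia. ring.
Qed.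

(** * The product of powers of factorials *)

Lemma ln_fact (n : nat) : ln (INR (fact n)) = sum_pow_ln 0 n.
Proof.
  induction n as [|n IH].
  - simpl. apply ln_1.
  - rewrite fact_simpl, mult_INR, ln_mult, IH.
    + unfold sum_pow_ln. change (rsum ?f (S n)) with (rsum f n + f n). cbv beta.
      change (INR (S n) ^ 0) with 1. ring.
    + apply lt_0_INR; lia.
    + apply INR_fact_lt_0.
Qed.

Lemma fact_prod_S (r n : nat) :
  fact_prod r (S n) = fact_prod r n * INR (fact (S n)) ^ (S n ^ r).
Proof.
  unfold fact_prod. rewrite seq_S, map_app, fold_right_app. cbn [map fold_right].
  rewrite Rmult_1_r. replace (1 + n)%nat with (S n) by lia.
  generalize (INR (fact (S n)) ^ (S n ^ r)) as x. intros x.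
  induction (map (fun nu => INR (fact nu) ^ (nu ^ r)) (seq 1 n)) as [|y l IH]; simpl.
  - ring.
  - rewrite IH. ring.
Qed.

Lemma fact_prod_pos (r n : nat) : 0 < fact_prod r n.
Proof.
  induction n as [|n IH].
  - unfold fact_prod. simpl. lra.
  - rewrite fact_prod_S. apply Rmult_lt_0_compat; auto. apply pow_lt, INR_fact_lt_0.
Qed.

(** Write [log nu!] as the sum of the [log k], [k <= nu], and exchange the summations:
    [log k] gets the weight [S_r(n) - S_r(k) + k^r], where [S_r(k)] is expanded by
    Faulhaber's formula. *)
Lemma ln_fact_prod (B : nat -> R) (r n : nat) : is_bernoulli B ->
  ln (fact_prod r n) =
  S_pow r n * sum_pow_ln 0 n + sum_pow_ln r n - rsum (fun j => faul_coef B r j * sum_pow_ln (j + 1) n) (S r).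
Proof.
  intros HB. induction n as [|n IH].
  - change (fact_prod r 0) with 1. rewrite ln_1.
    change (sum_pow_ln r 0) with 0. change (sum_pow_ln 0 0) with 0.
    rewrite (rsum_0 (fun j => faul_coef B r j * sum_pow_ln (j + 1) 0)); [ring|].
    intros j _. change (sum_pow_ln (j + 1) 0) with 0. ring.
  - rewrite fact_prod_S, ln_mult, IH by (try apply pow_lt, INR_fact_lt_0; apply fact_prod_pos).
    rewrite ln_pow by apply INR_fact_lt_0. rewrite ln_fact, pow_INR.
    assert (HL : forall k, sum_pow_ln k (S n) = sum_pow_ln k n + INR (S n) ^ k * ln (INR (S n))) by reflexivity.
    rewrite (rsum_ext (fun j => faul_coef B r j * sum_pow_ln (j + 1) (S n))
      (fun j => faul_coef B r j * sum_pow_ln (j + 1) n + ln (INR (S n)) * (faul_coef B r j * INR (S n) ^ (j + 1))))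
      by (intros; rewrite HL; ring).
    rewrite rsum_plus, rsum_scal, <- (S_pow_faul_coef B r (S n) HB), !HL, S_pow_S.
    change (INR (S n) ^ 0) with 1. ring.
Qed.

Lemma asy_ln_fact_prod (B : nat -> R) (zeta : C -> C) (r : nat) :
  is_bernoulli B -> is_riemann_zeta zeta ->
  asy (fun n => ln (fact_prod r n))
    (logA zeta r + rsum (fun j => faul_coef B r j * (Bhat B (j + 2) 1 - logA zeta (j + 1))) (S r)).
Proof.
  intros HB Hz.
  eapply asy_eq with (c := logA zeta r + rsum (fun j => faul_coef B r j * Bhat B (j + 2) 1 +
                          (- faul_coef B r j) * logA zeta (j + 1)) (S r)).
  - apply asy_plus; [apply (asy_sum_pow_ln B zeta r HB Hz)|].
    apply (asy_rsum (fun j n => faul_coef B r j * (INR n ^ S j * sum_pow_ln 0 n) + (- faul_coef B r j) * sum_pow_ln (j + 1) n)).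
    intros j _. apply asy_plus; apply asy_scal.
    + apply (asy_pow_stirling B zeta j HB Hz).
    + apply (asy_sum_pow_ln B zeta (j + 1) HB Hz).
  - intros n _. cbv beta. rewrite (ln_fact_prod B r n HB), (S_pow_faul_coef B r n HB).
    rewrite (rsum_ext _ (fun j => sum_pow_ln 0 n * (faul_coef B r j * INR n ^ (j + 1)) +
                                (-1) * (faul_coef B r j * sum_pow_ln (j + 1) n))).
    + rewrite rsum_plus, !rsum_scal. ring.
    + intros j _. rewrite Nat.add_1_r. ring.
  - f_equal. apply rsum_ext. intros; ring.
Qed.

Lemma ln_sqrt_exp (x : R) : ln (sqrt (exp x)) = 1 / 2 * x.
Proof.
  replace (exp x) with (exp (1 / 2 * x) * exp (1 / 2 * x)) by (rewrite <- exp_plus; f_equal; field).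
  rewrite sqrt_square by (left; apply exp_pos). apply ln_exp.
Qed.

(** The logarithm of the asymptotic equivalence that defines [F]. *)
Lemma F1_limit (B : nat -> R) (zeta : C -> C) (r : nat) (F : R) :
  is_F1 B zeta r F ->
  is_lim_seq (fun n => ln (fact_prod r n) - logP1 B r n - 1 / 2 * logQ B zeta r n
                       - logQ B zeta (r + 1) n)
    (ln F + 1 / 2 * logA zeta r + logA zeta (r + 1)).
Proof.
  intros [HF Hl].
  assert (Hc : continuity_pt ln 1).
  { apply derivable_continuous_pt. exists (/ 1). apply derivable_pt_lim_ln. lra. }
  apply (is_lim_seq_continuous _ _ _ Hc) in Hl. rewrite ln_1 in Hl.
  apply is_lim_seq_ext with (fun n => ln (fact_prod r n / (F * sqrt (A zeta r) * A zeta (r + 1) *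
              P1 B r n * sqrt (Q B zeta r n) * Q B zeta (r + 1) n))
       + (ln F + 1 / 2 * logA zeta r + logA zeta (r + 1))).
  - intros n. assert (Hp := fact_prod_pos r n).
    unfold A, P1, Q.
    assert (Hs1 : 0 < sqrt (exp (logA zeta r))) by apply sqrt_lt_R0, exp_pos.
    assert (Hs2 : 0 < sqrt (exp (logQ B zeta r n))) by apply sqrt_lt_R0, exp_pos.
    assert (He1 := exp_pos (logA zeta (r + 1))). assert (He2 := exp_pos (logP1 B r n)).
    assert (He3 := exp_pos (logQ B zeta (r + 1) n)).
    unfold Rdiv at 1. rewrite ln_mult, ln_Rinv by (auto; try apply Rinv_0_lt_compat; repeat apply Rmult_lt_0_compat; auto).
    rewrite !ln_mult by (repeat apply Rmult_lt_0_compat; auto).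
    rewrite !ln_sqrt_exp, !ln_exp. ring.
  - replace (Finite (ln F + 1 / 2 * logA zeta r + logA zeta (r + 1)))
      with (Finite (0 + (ln F + 1 / 2 * logA zeta r + logA zeta (r + 1)))) by (f_equal; ring).
    apply is_lim_seq_plus'; [exact Hl|apply is_lim_seq_const].
Qed.

Lemma ln_A (zeta : C -> C) (r : nat) : ln (A zeta r) = logA zeta r.
Proof. apply ln_exp. Qed.

Lemma ln_F1 (B : nat -> R) (zeta : C -> C) (r : nat) (F : R) :
  is_bernoulli B -> is_riemann_zeta zeta -> is_F1 B zeta r F ->
  ln F = 1 / 2 * logA zeta r - logA zeta (r + 1)
         + rsum (fun j => faul_coef B r j * (Bhat B (j + 2) 1 - logA zeta (j + 1))) (S r).
Proof.
  intros HB Hz HF. assert (Hl := F1_limit B zeta r F HF).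
  eapply asy_limit in Hl.
  2:{ eapply asy_eq with (g := fun n => ln (fact_prod r n) - logP1 B r n - 1 / 2 * logQ B zeta r n
                       - logQ B zeta (r + 1) n);
      [apply asy_plus; [apply asy_plus; [apply asy_plus; [apply (asy_ln_fact_prod B zeta r HB Hz)|
         apply (asy_scal (-1)), (asy_logP1 B r HB)]|
         apply (asy_scal (- (1 / 2))), (asy_logQ B zeta r HB)]|
         apply (asy_scal (-1)), (asy_logQ B zeta (r + 1) HB)]
      |intros n _; cbv beta; ring|reflexivity]. }
  lra.
Qed.

(** * Simplification by parity *)

(** Only [B_1] survives, and its sign change turns it into [1/2]. *)
Lemma faul_coef_odd (B : nat -> R) (r j : nat) : is_bernoulli B -> (j <= r)%nat ->
  Nat.odd (r - j) = true -> faul_coef B r j = if Nat.eqb (S j) r then 1 / 2 else 0.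
Proof.
  intros HB Hj Ho. unfold faul_coef. destruct (Nat.eqb_spec (S j) r) as [<-|Hn].
  - replace (S j - j)%nat with 1%nat by lia. rewrite (bernoulli_1 B (bernoulli_rec B HB)).
    rewrite Nat.add_1_r. 
    assert (Hb := pascal_step1 (S j) 1 ltac:(lia)). replace (S j - 1)%nat with j in Hb by lia.
    rewrite <- Hb. unfold Binomial.C. rewrite fact_simpl, mult_INR.
    replace (S j - 1)%nat with j by lia. simpl (fact 1). change (INR 1) with 1.
    assert (INR (S j) <> 0) by (apply not_0_INR; lia).
    field. repeat split; first [apply INR_fact_neq_0 | assumption].
  - rewrite (bernoulli_odd B (r - j) HB Ho); [unfold Rdiv; ring|]. intros E1. lia.
Qed.

Lemma faul_coef_even (B : nat -> R) (r j : nat) : (j <= r)%nat -> Nat.odd (r - j) = false ->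
  faul_coef B r j = Binomial.C r j * (B (r - j)%nat / INR (j + 1)).
Proof.
  intros Hj Ho. unfold faul_coef.
  assert (He : Nat.even (r - j) = true) by (rewrite <- Nat.negb_odd, Ho; reflexivity).
  apply Nat.even_spec in He. destruct He as [k Ek]. rewrite Ek, pow_1_even. ring.
Qed.

(** A nonzero term needs [j] even, because of [B_(j+2)]. For odd [r] then [r-j] is odd,
    which leaves [j = r-1] only; for even [r] the sign [(-1)^(r-j)] is [1]. *)
Lemma alpha0_sum (B : nat -> R) (r : nat) : is_bernoulli B -> (0 < r)%nat ->
  rsum (fun j => faul_coef B r j * Bhat B (j + 2) 1) (S r) = alpha0 B r.
Proof.
  intros HB Hr. unfold alpha0. destruct (Nat.odd r) eqn:Or.
  - rewrite (rsum_ext _ (fun j => if Nat.eqb j (r - 1) then 1 / 2 * Bhat B (j + 2) 1 else 0)).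
    + rewrite (rsum_delta (fun j => 1 / 2 * Bhat B (j + 2) 1)) by lia.
      replace (r - 1 + 2)%nat with (r + 1)%nat by lia. unfold Bhat.
      simpl (INR 1). rewrite pow1, plus_INR. simpl (INR 1).
      assert (0 < INR r) by (apply lt_0_INR; lia). field. lra.
    + intros j Hj. destruct (Nat.odd (r - j)) eqn:Oj.
      * rewrite faul_coef_odd by (auto; lia).
        destruct (Nat.eqb_spec (S j) r); destruct (Nat.eqb_spec j (r - 1)); try lia; ring.
      * assert (Oj2 : Nat.odd (j + 2) = true).
        { rewrite Nat.odd_sub, Or in Oj by lia. rewrite Nat.odd_add. simpl.
          destruct (Nat.odd j); simpl in *; auto. }
        unfold Bhat. rewrite (bernoulli_odd B (j + 2) HB Oj2) by lia.
        destruct (Nat.eqb_spec j (r - 1)) as [->|].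
        -- replace (r - (r - 1))%nat with 1%nat in Oj by lia. discriminate.
        -- unfold Rdiv. ring.
  - rewrite rsum_sum_n_m_0. apply rsum_ext. intros j Hj.
    assert (0 < INR (j + 1)) by (apply lt_0_INR; lia).
    assert (0 < INR (j + 2)) by (apply lt_0_INR; lia).
    destruct (Nat.odd (r - j)) eqn:Oj.
    + assert (Oj2 : Nat.odd (j + 2) = true).
      { rewrite Nat.odd_sub, Or in Oj by lia. rewrite Nat.odd_add. simpl.
        destruct (Nat.odd j); simpl in *; auto. }
      unfold Bhat. rewrite (bernoulli_odd B (j + 2) HB Oj2) by lia. unfold Rdiv. ring.
    + rewrite faul_coef_even by (auto; lia). unfold Bhat. simpl (INR 1). rewrite pow1.
      replace (INR (j + 2) - 1) with (INR (j + 1)) by (rewrite !plus_INR; simpl; ring).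
      field. lra.
Qed.

(** The two corrections are the coefficients of [(log A_r)/2] and [- log A_(r+1)] in the
    first formula; the inner test excludes [r = 0], where [r - 1] is truncated. *)
Lemma alpha_faul_coef (B : nat -> R) (r j : nat) : is_bernoulli B -> (j <= r)%nat ->
  alpha B r (S j) = - faul_coef B r j + (if Nat.eqb j (r - 1) then if Nat.eqb (S j) r then 1 / 2 else 0 else 0)
                    - (if Nat.eqb j r then 1 else 0).
Proof.
  intros HB Hj. unfold alpha.
  assert (Hpar : Nat.eqb (r mod 2) (S j mod 2) = Nat.odd (r - j)).
  { rewrite Nat.odd_sub by lia. rewrite <- !Nat.bit0_mod, !Nat.bit0_odd, Nat.odd_succ.
    rewrite <- Nat.negb_odd. destruct (Nat.odd r), (Nat.odd j); reflexivity. }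
  rewrite Hpar. destruct (Nat.odd (r - j)) eqn:Oj.
  - rewrite (faul_coef_odd B r j HB Hj Oj).
    destruct (Nat.eqb_spec (S j) r); destruct (Nat.eqb_spec j (r - 1));
      destruct (Nat.eqb_spec j r); try lia; try lra;
      replace (r - j)%nat with 0%nat in Oj by lia; discriminate.
  - rewrite (faul_coef_even B r j Hj Oj). unfold kronecker.
    replace (r + 1 - S j)%nat with (r - j)%nat by lia.
    replace (r + 1)%nat with (S r) by lia.
    assert (Hb := binomial_S_div r j Hj).
    rewrite (pascal_step1 (S r) (S j)) by lia.
    replace (S r - S j)%nat with (r - j)%nat by lia.
    rewrite Hb, (S_INR r). pose proof (pos_INR r).
    assert (INR (j + 1) <> 0) by (apply not_0_INR; lia).
    replace (Nat.eqb (S r) (S j)) with (Nat.eqb j r) by (rewrite Nat.eqb_sym; reflexivity).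
    destruct (Nat.eqb_spec j (r - 1)) as [Ej|]; [destruct (Nat.eqb_spec (S j) r) as [Er|]|].
    + rewrite <- Er in Oj. replace (S j - j)%nat with 1%nat in Oj by lia. discriminate.
    + destruct (Nat.eqb j r); field; split; auto; lra.
    + destruct (Nat.eqb j r); field; split; auto; lra.
Qed.

Theorem theorem5p4 :
  forall (B : nat -> R) (zeta : C -> C),
    is_bernoulli B -> is_riemann_zeta zeta ->
    forall (r : nat) (F : R), is_F1 B zeta r F ->
      ln F = 1 / 2 * ln (A zeta r) - ln (A zeta (r + 1))
             + sum_n_m (fun j => Binomial.C r j * (-1) ^ (r - j) *
                          (B (r - j)%nat / INR (j + 1)) *
                          (Bhat B (j + 2) 1 - ln (A zeta (j + 1)))) 0 r
      /\ (r = 0%nat ->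
          ln F = 1 / 12 + 1 / 2 * ln (A zeta 0) - 2 * ln (A zeta 1))
      /\ ((0 < r)%nat ->
          ln F = alpha0 B r
                 + sum_n_m (fun j => alpha B r j * ln (A zeta j)) 1 (r + 1)).
Proof.
  intros B zeta HB Hz r F HF.
  assert (Hmain := ln_F1 B zeta r F HB Hz HF).
  split; [|split].
  - rewrite rsum_sum_n_m_0, !ln_A, Hmain. f_equal.
    apply rsum_ext. intros j _. now rewrite ln_A.
  - intros ->. rewrite !ln_A, Hmain. unfold faul_coef, Bhat. simpl.
    rewrite C_n_0, (bernoulli_0 B (bernoulli_rec B HB)), (bernoulli_2 B (bernoulli_rec B HB)). field.
  - intros Hr. rewrite rsum_sum_n_m_1, Hmain, <- (alpha0_sum B r HB Hr).
    replace (r + 1)%nat with (S r) by lia.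
    rewrite (rsum_ext (fun i => alpha B r (S i) * ln (A zeta (S i)))
      (fun i => (- 1) * (faul_coef B r i * logA zeta (S i)) +
         ((if Nat.eqb i (r - 1) then 1 / 2 * logA zeta (S i) else 0) +
          (- 1) * (if Nat.eqb i r then logA zeta (S i) else 0)))).
    + rewrite !rsum_plus, !rsum_scal.
      rewrite (rsum_delta (fun i => 1 / 2 * logA zeta (S i))),
        (rsum_delta (fun i => logA zeta (S i))) by lia.
      replace (S (r - 1)) with r by lia.
      rewrite (rsum_ext (fun j => faul_coef B r j * (Bhat B (j + 2) 1 - logA zeta (j + 1)))
        (fun j => faul_coef B r j * Bhat B (j + 2) 1 + (- 1) * (faul_coef B r j * logA zeta (S j)))).
      * rewrite rsum_plus, rsum_scal. ring.
      * intros j _. rewrite Nat.add_1_r. ring.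
    + intros i Hi. rewrite ln_A, (alpha_faul_coef B r i HB) by lia.
      destruct (Nat.eqb_spec i (r - 1)); destruct (Nat.eqb_spec i r);
        destruct (Nat.eqb_spec (S i) r); try lia; ring.
Qed.
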